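(* Let $(M,g)$ be a compact Kähler manifold, let $a$ be a nonzero real constant, and let $u$ and $v$ be positive smooth solutions on $M\times[0,T)$, $0<T\le\infty$, of the nonlinear heat equation $$\frac{\partial}{\partial t}u=\Delta u+au\ln u$$ (that is, $u$ satisfies it, and $v$ satisfies the same equation $\frac{\partial}{\partial t}v=\Delta v+av\ln v$). Put $h=v/u$. Assume that one of the following two cases holds: (i) $a>0$, $0<h<1$ on $M\times[0,T)$, and $g$ has nonnegative holomorphic bisectional curvature; (ii) $a<0$, there is a constant $c>0$ with $0<c<h<1$ on $M\times[0,T)$, and the holomorphic bisectional curvature satisfies $R_{i\bar jk\bar l}\ge -aK\,(g_{i\bar j}g_{k\bar l}+g_{i\bar l}g_{k\bar j})$ for a constant $K$ with $K\ge -1-\dfrac{2\ln c}{1-c^2}$. Then for all $t\in(0,T)$, at every point of $M$, $$\nabla_i\nabla_{\bar j}\ln u+\frac{a}{1-e^{-at}}\,g_{i\bar j}>\frac{\nabla_ih\,\nabla_{\bar j}h}{1-h^2}.$$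
   Context: Let $g=(g_{i\bar j})$ be a Kähler metric in local holomorphic coordinates. $\nabla$ is its Levi-Civita (Chern) connection and $\Delta A=\frac12 g^{k\bar l}(\nabla_k\nabla_{\bar l}+\nabla_{\bar l}\nabla_k)A$, so $\Delta A=g^{k\bar l}\partial_k\partial_{\bar l}A$ on functions. The curvature is $R_{i\bar jk\bar l}=-g_{p\bar j}\,\partial_{\bar l}\Gamma^p_{ik}$ with $\Gamma^p_{ik}=g^{p\bar q}\partial_k g_{i\bar q}$ (positive on complex projective space with the Fubini–Study metric). Nonnegative holomorphic bisectional curvature means $R_{i\bar jk\bar l}v^i\overline{v^j}w^k\overline{w^l}\ge0$ for all $v,w\in T^{1,0}_xM$, $x\in M$. The inequality $R_{i\bar jk\bar l}\ge -aK(g_{i\bar j}g_{k\bar l}+g_{i\bar l}g_{k\bar j})$ means that $R_{i\bar jk\bar l}v^i\overline{v^j}w^k\overline{w^l}\ge -aK(g_{i\bar j}g_{k\bar l}+g_{i\bar l}g_{k\bar j})v^i\overline{v^j}w^k\overline{w^l}$ for all $v,w\in T^{1,0}_xM$, $x\in M$. An inequality $S_{i\bar j}>Q_{i\bar j}$ means that the Hermitian form $S-Q$ is positive definite at each point. *)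

(* Defs.v *)
From HB Require Import structures.
From mathcomp Require Import all_boot all_order all_algebra.
From mathcomp Require Import all_classical all_reals all_analysis.
From mathcomp Require Export complex.

Set Implicit Arguments.
Unset Strict Implicit.
Unset Printing Implicit Defensive.

Import Order.TTheory GRing.Theory Num.Theory.
Import numFieldNormedType.Exports.

Local Open Scope classical_set_scope.
Local Open Scope ring_scope.
Local Open Scope complex_scope.

Section Smooth.
Context {R : realType} {E : normedModType R}.

(* Only used on open sets [U]. *)
Fixpoint Ck (k : nat) (U : set E) (f : E -> R^o) : Prop :=
  (forall x, U x -> {for x, continuous f}) /\
  (if k is k'.+1 then
     forall w : E, (forall x, U x -> derivable f x w) /\ Ck k' U ('D_w f)
   else True).

Definition smooth (U : set E) (f : E -> R^o) : Prop := forall k, Ck k U f.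

Definition smoothC (U : set E) (f : E -> R[i]) : Prop :=
  smooth U (fun x => complex.Re (f x)) /\ smooth U (fun x => complex.Im (f x)).

End Smooth.

(* [C^n] as a real normed space: the pair [(x, y)] stands for [x + i y]. *)
Notation Cn R n := ('rV[R]_n * 'rV[R]_n)%type.

Section Wirtinger.
Context {R : realType} {n : nat}.
Implicit Types (f : Cn R n -> R[i]) (z : Cn R n) (k : 'I_n).

Definition zcoord k z : R[i] := z.1 0 k +i* z.2 0 k.

Definition dirC (w : Cn R n) f z : R[i] :=
  ('D_w (fun x => complex.Re (f x) : R^o) z) +i*
  ('D_w (fun x => complex.Im (f x) : R^o) z).

Definition dx k f : Cn R n -> R[i] := dirC (delta_mx 0 k, 0) f.
Definition dy k f : Cn R n -> R[i] := dirC (0, delta_mx 0 k) f.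

Definition dz k f z : R[i] := (dx k f z - (0 +i* 1) * dy k f z) / 2.
Definition dzb k f z : R[i] := (dx k f z + (0 +i* 1) * dy k f z) / 2.

Definition holomorphic (U : set (Cn R n)) (F : Cn R n -> Cn R n) :=
  forall k, smoothC U (zcoord k \o F) /\
    forall l z, U z -> dzb l (zcoord k \o F) z = 0.

End Wirtinger.

Record chart (R : realType) (n : nat) (M : topologicalType) := Chart {
  cdom : set M;
  cmap : M -> Cn R n;
  cinv : Cn R n -> M;
  cdom_open : open cdom;
  cimg_open : open (cmap @` cdom);
  cmapK : forall p, cdom p -> cinv (cmap p) = p;
  cmap_continuous : forall p, cdom p -> {for p, continuous cmap};
  cinv_continuous : forall p, cdom p -> {for cmap p, continuous cinv} }.

Definition cimg (R : realType) (n : nat) (M : topologicalType)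
  (c : chart R n M) : set (Cn R n) := cmap c @` cdom c.

Definition transition (R : realType) (n : nat) (M : topologicalType)
  (c d : chart R n M) : Cn R n -> Cn R n := cmap d \o cinv c.

Definition overlap (R : realType) (n : nat) (M : topologicalType)
  (c d : chart R n M) : set (Cn R n) := cmap c @` (cdom c `&` cdom d).

(* Complex dimension [n].  Second countability is omitted because it is
   automatic for compact spaces. *)
Record complexManifold (R : realType) (n : nat) := ComplexManifold {
  carrier :> topologicalType;
  carrier_hausdorff : hausdorff_space carrier;
  chart_index : Type;
  atlas : chart_index -> chart R n carrier;
  atlas_cover : forall p, exists c, cdom (atlas c) p;
  atlas_holomorphic : forall c d,
    holomorphic (overlap (atlas c) (atlas d)) (transition (atlas c) (atlas d)) }.

Section Hermitian.
Context {R : realType} {n : nat}.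

Definition hform (S : 'M[R[i]]_n) (v w : 'rV[R[i]]_n) : R[i] :=
  \sum_i \sum_j S i j * v 0 i * (w 0 j)^*.

(* The order of [R[i]] makes [0 < z] mean that [z] is real and positive, so
   this also forces [S] to be Hermitian. *)
Definition posdef (S : 'M[R[i]]_n) : Prop :=
  forall v : 'rV[R[i]]_n, v != 0 -> 0 < hform S v v.

End Hermitian.

(* [metric c z i j] is the component [g_{i \bar j}] in the chart [c] at the
   coordinate point [z].  [metric_kahler] is [d omega = 0] for the form [omega]
   proportional to [i g_{i \bar j} dz^i /\ d\bar z^j]; the (1,2)-part of the
   equation is the conjugate of the stated (2,1)-part. *)
Record kahlerMetric (R : realType) (n : nat) (M : complexManifold R n) :=
  KahlerMetric {
  metric :> chart_index M -> Cn R n -> 'M[R[i]]_n;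
  metric_smooth : forall c i j,
    smoothC (cimg (atlas c)) (fun z => metric c z i j);
  metric_posdef : forall c z, cimg (atlas c) z -> posdef (metric c z);
  metric_change : forall c d z, overlap (atlas c) (atlas d) z ->
    let tau := transition (atlas c) (atlas d) in
    forall i j, metric c z i j =
      \sum_p \sum_q metric d (tau z) p q *
        dz i (zcoord p \o tau) z * (dz j (zcoord q \o tau) z)^*;
  metric_kahler : forall c z, cimg (atlas c) z -> forall i j k,
    dz k (fun y => metric c y i j) z = dz i (fun y => metric c y k j) z }.

Section Geometry.
Context {R : realType} {n : nat} {M : complexManifold R n}.
Variable g : kahlerMetric M.
Implicit Types (c : chart_index M) (z : Cn R n) (i j k l p q : 'I_n).

(* [g^{i \bar j}], with [g^{i \bar j} g_{k \bar j} = delta^i_k]. *)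
Definition ginv c z i j : R[i] := invmx (g c z) j i.

Definition christoffel c p i k z : R[i] :=
  \sum_q ginv c z p q * dz k (fun y => g c y i q) z.

(* [R_{i \bar j k \bar l}] *)
Definition curv c z i j k l : R[i] :=
  - \sum_p g c z p j * dzb l (christoffel c p i k) z.

Definition bisect c z (v w : 'rV[R[i]]_n) : R[i] :=
  \sum_i \sum_j \sum_k \sum_l
    curv c z i j k l * v 0 i * (v 0 j)^* * w 0 k * (w 0 l)^*.

Definition bisect_model c z (v w : 'rV[R[i]]_n) : R[i] :=
  \sum_i \sum_j \sum_k \sum_l
    (g c z i j * g c z k l + g c z i l * g c z k j) *
      v 0 i * (v 0 j)^* * w 0 k * (w 0 l)^*.

Definition nonneg_bisectional : Prop :=
  forall c z, cimg (atlas c) z -> forall v w, 0 <= bisect c z v w.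

Definition bisectional_ge (kappa : R) : Prop :=
  forall c z, cimg (atlas c) z -> forall v w,
    kappa%:C * bisect_model c z v w <= bisect c z v w.

Definition in_chart c (f : M -> R) z : R[i] := (f (cinv (atlas c) z))%:C.

(* [nabla_i nabla_{\bar j} f] and [nabla_{\bar j} nabla_i f] for a function:
   the only nonzero Christoffel symbols are [Gamma^p_{ik}] and their
   conjugates, so no connection term occurs. *)
Definition hess c (f : M -> R) i j z : R[i] := dz i (dzb j (in_chart c f)) z.
Definition hess_bar c (f : M -> R) i j z : R[i] := dzb j (dz i (in_chart c f)) z.

Definition laplacian c (f : M -> R) z : R[i] :=
  2^-1 * \sum_k \sum_l ginv c z k l * (hess c f k l z + hess_bar c f k l z).

End Geometry.

Section Parabolic.
Context {R : realType} {n : nat} {M : complexManifold R n}.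
Implicit Types (T : \bar R) (u : M -> R -> R).

Definition times T : set R := [set t | 0 <= t /\ (t%:E < T)%E].

(* Smoothness up to [t = 0], as usual on a manifold with boundary: near every
   point, [u] read in a chart has a smooth extension to an open subset of
   [C^n * R]. *)
Definition smooth_spacetime T u : Prop :=
  forall (c : chart_index M) (z : Cn R n) (t : R),
    cimg (atlas c) z -> times T t ->
    exists (W : set (Cn R n * R^o)) (F : Cn R n * R^o -> R^o),
      [/\ open W, W (z, t), smooth W F &
        forall y s, W (y, s) -> cimg (atlas c) y -> times T s ->
          u (cinv (atlas c) y) s = F (y, s)].

(* Two-sided for [0 < t < T] and one-sided at [t = 0]. *)
Definition time_derive T (f : R -> R) (t : R) : R :=
  lim ((fun s : R => (s - t)^-1 * (f s - f t) : R^o) @ within (times T) t^').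

Definition heat_solution (g : kahlerMetric M) (a : R) T u : Prop :=
  smooth_spacetime T u /\
  forall (c : chart_index M) (x : M) (t : R), cdom (atlas c) x -> times T t ->
    (time_derive T (u x) t)%:C =
      laplacian g c (u ^~ t) (cmap (atlas c) x) + (a * u x t * ln (u x t))%:C.

End Parabolic.

(* Main.v *)
(** Put [f = ln u], [h = v / u], [psi = 1 / (1 - h^2)].  Then
    [N = f_{i jbar} + phi g - psi h_i h_jbar], [phi = a / (1 - e^{-at})], is
    treated by the tensor maximum principle, with [phi] replaced by the strict
    supersolution [chi = phi + eps phi'] of [chi' + chi^2 - a chi = 0]
    ([chi' + chi^2 - a chi = (eps phi')^2]); as [phi' < 0], [chi < phi].  Since
    [phi] blows up like [1/t] at [t = 0], [N] is positive for small time.  At the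
    first time at which [N] has a null vector [V], pass to holomorphic normal
    coordinates with [g = delta]: the heat operator applied to [N(V, Vbar)] is,
    by the evolution identity, a sum of squares, of curvature terms that are
    nonnegative because the bisectional curvature is at least [kappa], of
    [(chi' + chi^2 - a chi) |V|^2 > 0] and of [psi |h_V|^2] times
    [kappa + a (- 1 - 2 psi ln h)].  The last factor is nonnegative in both cases,
    by [ln x <= x - 1] for [kappa = 0], and by the monotonicity of
    [ln x / (1 - x^2)] for [kappa = - a K]. *)
Require Import Defs.
From HB Require Import structures.
From mathcomp Require Import all_boot all_order all_algebra.
From mathcomp Require Import all_classical all_reals all_analysis.
From mathcomp Require Import ring lra.
Set Implicit Arguments.
Unset Strict Implicit.
Unset Printing Implicit Defensive.
Import Order.TTheory GRing.Theory Num.Theory.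
Import numFieldNormedType.Exports.
Local Open Scope classical_set_scope.
Local Open Scope complex_scope.
Local Open Scope ring_scope.

(** * Smooth functions *)

(** The tensor calculus is made algebraic: smooth functions on an open set of space-time form a
    commutative ring, vector fields act on it as derivations, and the evolution identity is a ring
    identity read at one point. Division and logarithms enter this ring only through equations such
    as [psi * (1 - h * h) = 1] and [u * d (ln u) = d u]. The null vector [V] is extended with
    constant coefficients in a chart where [g = delta] and [dg = 0] at the point; this chart is an
    explicit quadratic map, and all data are pulled back along it. The null condition is used in the
    form [N(V, .) = 0]: it turns one of the squares into [chi^2 |V|^2], while [a f_{V Vbar}]
    supplies [- a chi |V|^2]. Together with [chi' |V|^2] this is the Riccati expression of the
    barrier, and its strict sign gives the contradiction. A single [eps] replaces a limit
    [eps -> 0]: small-time positivity holds even for [phi - 1], [eps] is chosen so that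
    [chi = phi - 1] at one early time, and the room left by [chi < phi] makes the final inequality
    strict. *)

Section Smoothness.
Context {R : realType} {E : normedModType R}.
Implicit Types (U V : set E) (f g : E -> R^o) (k : nat).

Lemma near_open U x (P : E -> Prop) : open U -> U x -> (forall y, U y -> P y) ->
  \forall y \near x, P y.
Proof. by move=> oU Ux UP; apply: filterS UP _; exact: open_nbhs_nbhs. Qed.

Lemma Ck_continuous k U f x : Ck k U f -> U x -> {for x, continuous f}.
Proof. by case: k => [|k] [+ _] => /(_ x). Qed.

Lemma Ck_ext k U f g : open U -> (forall x, U x -> f x = g x) ->
  Ck k U f -> Ck k U g.
Proof.
move=> oU; elim: k f g => [|k IH] f g fg [cf df]; (split=> //;
    first (move=> x Ux; rewrite /prop_for /continuous_at -(fg _ Ux);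
  by apply: cvg_trans (cf x Ux); apply: near_eq_cvg; exact: near_open fg)).
move=> w; have [dfw Df] := df w; split=> [x Ux|].
  by apply: near_eq_derivable (dfw x Ux); exact: near_open fg.
by apply: IH Df => x Ux; apply: near_eq_derive; exact: near_open fg.
Qed.

Lemma Ck_sub k U V f : V `<=` U -> Ck k U f -> Ck k V f.
Proof.
move=> VU; elim: k f => [|k IH] f [cf df]; (split=> //; first by move=> x /VU; exact: cf).
by move=> w; have [dfw Df] := df w; split=> [x /VU|]; [exact: dfw|exact: IH].
Qed.

Lemma CkW k U f : Ck k.+1 U f -> Ck k U f.
Proof.
elim: k f => [|k IH] f [cf df]; split=> // w.
by have [dfw Df] := df w; split=> //; exact: IH.
Qed.

Lemma Ck_cst k U (r : R) : Ck k U (cst r).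
Proof.
elim: k r => [|k IH] r; (split=> //; first by move=> x _; exact: cvg_cst).
move=> w; split=> [x _|]; first exact: derivable_cst.
by rewrite (_ : 'D_w (cst r) = cst 0)//; apply/funext => x; exact: derive_cst.
Qed.

Lemma Ck_add k U f g : open U -> Ck k U f -> Ck k U g -> Ck k U (f + g).
Proof.
move=> oU; elim: k f g => [|k IH] f g [cf df] [cg dg]; (split=> //;
  first by move=> x Ux; apply: cvgD; [exact: cf|exact: cg]).
move=> w; have [dfw Df] := df w; have [dgw Dg] := dg w; split=> [x Ux|].
  by apply: derivableD; [exact: dfw|exact: dgw].
apply: (Ck_ext oU) (IH _ _ Df Dg) => x Ux.
by rewrite deriveD//; [exact: dfw|exact: dgw].
Qed.

Lemma Ck_mul k U f g : open U -> Ck k U f -> Ck k U g -> Ck k U (f * g).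
Proof.
move=> oU; elim: k f g => [|k IH] f g /[dup] Cf [cf df] /[dup] Cg [cg dg]; (split=> //;
  first by move=> x Ux; apply: cvgM; [exact: cf|exact: cg]).
move=> w; have [dfw Df] := df w; have [dgw Dg] := dg w; split=> [x Ux|].
  by apply: derivableM; [exact: dfw|exact: dgw].
apply: (Ck_ext oU) (Ck_add oU (IH _ _ (CkW Cf) Dg) (IH _ _ (CkW Cg) Df)) => x Ux.
by rewrite deriveM//; [exact: dfw|exact: dgw].
Qed.

Lemma Ck_opp k U f : open U -> Ck k U f -> Ck k U (- f).
Proof.
move=> oU Cf; apply: (Ck_ext oU) (Ck_mul oU (Ck_cst k U (-1)) Cf) => x _.
by rewrite [LHS]mulN1r.
Qed.

Lemma Ck_inv k U f : open U -> (forall x, U x -> f x != 0) -> Ck k U f ->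
  Ck k U (fun x => (f x)^-1).
Proof.
move=> oU f0; elim: k f f0 => [|k IH] f f0 /[dup] Cf [cf df]; (split=> //;
  first by move=> x Ux; apply: cvgV; [exact: f0|exact: cf]).
move=> w; have [dfw Df] := df w; split=> [x Ux|].
  by apply: derivableV; [exact: f0|exact: dfw].
have CI := IH _ f0 (CkW Cf).
apply: (Ck_ext oU) (Ck_opp oU (Ck_mul oU (Ck_mul oU CI CI) Df)) => x Ux.
rewrite deriveV; [|exact: f0|exact: dfw].
by rewrite -exprVn expr2; rewrite -mulNr.
Qed.

(** The derivative along [w] is the derivative at 0 of [F], the restriction of [f] to a line, so the
    one-variable chain rule applies. *)
Lemma is_derive_real_comp (phi : R -> R) f x w d :
  is_derive (f x : R^o) 1 (phi : R^o -> R^o) d -> derivable f x w ->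
  is_derive x w (fun y => phi (f y) : R^o) (d * 'D_w f x).
Proof.
move=> dphi dfx.
have e0 : f x = f (0 *: w + x) by rewrite scale0r add0r.
pose F (h : R) : R := f (h *: w + x).
have Df : 'D_1 F 0 = 'D_w f x.
  rewrite /derive; set g1 := (fun h => _); set g2 := (fun h => _).
  suff -> : g1 = g2 by []; apply/funext => h; rewrite /g1 /g2 /=.
  by rewrite /F addr0 scale0r add0r [_ *: 1]mulr1.
have dF : is_derive (0 : R) 1 F ('D_w f x).
  have d1 : derivable F 0 1 := iffLR (@derivable1P R E R^o f x w) dfx.
  by split; [exact: d1|exact: Df].
have dl : is_derive (F 0 : R^o) 1 (phi : R^o -> R^o) d by rewrite /F -e0.
have := @is_derive1_comp R phi F 0 _ _ dl dF => -[D1 D2].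
have ee : 'D_w (fun y => phi (f y) : R^o) x = 'D_1 (phi \o F) 0.
  rewrite /derive; set g1 := (fun h => _); set g2 := (fun h => _).
  suff -> : g1 = g2 by []; apply/funext => h; rewrite /g1 /g2 /=.
  by rewrite addr0 /F scale0r add0r [_ *: 1]mulr1.
split; last by rewrite ee D2.
by apply/derivable1P; exact: D1.
Qed.

Lemma is_derive_ln f x w : 0 < f x -> derivable f x w ->
  is_derive x w (fun y => ln (f y) : R^o) ((f x)^-1 * 'D_w f x).
Proof. by move=> fx0; apply: is_derive_real_comp; exact: is_derive1_ln. Qed.

Lemma Ck_exp k U f : open U -> Ck k U f -> Ck k U (fun x => expR (f x)).
Proof.
move=> oU; have ce x : U x -> {for x, continuous f} ->
    {for x, continuous (fun x => expR (f x) : R^o)}.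
  by move=> Ux cfx; apply: continuous_comp cfx _; exact: continuous_expR.
have de x w : derivable f x w -> is_derive x w (fun y => expR (f y) : R^o) (expR (f x) * 'D_w f x).
  exact: is_derive_real_comp.
elim: k f ce de => [|k IH] f ce de /[dup] Cf [cf df]; (split=> //; first by move=> x Ux; apply: ce => //; exact: cf).
move=> w; have [dfw Df] := df w; split=> [x Ux|].
  by have [] := de _ _ (dfw _ Ux).
apply: (Ck_ext oU) (Ck_mul oU (IH f ce de (CkW Cf)) Df) => x Ux.
by have [_ ->] := de _ _ (dfw _ Ux).
Qed.

Lemma Ck_ln k U f : open U -> (forall x, U x -> 0 < f x) -> Ck k U f ->
  Ck k U (fun x => ln (f x)).
Proof.
move=> oU f0; have fn0 x : U x -> f x != 0 by move=> /f0; exact: lt0r_neq0.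
have cl x : U x -> {for x, continuous f} ->
    {for x, continuous (fun x => ln (f x) : R^o)}.
  by move=> Ux cfx; apply: continuous_comp cfx (continuous_ln (f0 _ Ux)).
(* No induction: the derivative [f^-1 * 'D_w f] contains no logarithm, so [Ck_inv] settles it. *)
case: k => [|k] /[dup] Cf [cf df]; (split=> //; first by move=> x Ux; apply: cl => //; exact: cf).
move=> w; have [dfw Df] := df w; split=> [x Ux|].
  by have [] := is_derive_ln (f0 _ Ux) (dfw _ Ux).
apply: (Ck_ext oU) (Ck_mul oU (Ck_inv oU fn0 (CkW Cf)) Df) => x Ux.
by have [_ ->] := is_derive_ln (f0 _ Ux) (dfw _ Ux).
Qed.

Lemma Ck_linear k U (f : {linear E -> R^o}) : continuous f -> Ck k U f.
Proof.
move=> cf; have df x w : is_derive x w f (f w).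
  have df : differentiable f x by exact: linear_differentiable.
  by split; [exact: diff_derivable|rewrite deriveE// diff_lin].
case: k => [|k]; (split=> //; first by move=> x _; exact: cf).
move=> w; split=> [x _|]; first by have [] := df x w.
rewrite (_ : 'D_w f = cst (f w)); first exact: Ck_cst.
by apply/funext => x; have [_ ->] := df x w.
Qed.

Lemma smooth_ext U f g : open U -> (forall x, U x -> f x = g x) ->
  smooth U f -> smooth U g.
Proof. by move=> oU fg sf k; apply: Ck_ext (sf k). Qed.

Lemma smooth_sub U V f : V `<=` U -> smooth U f -> smooth V f.
Proof. by move=> VU sf k; apply: Ck_sub (sf k). Qed.

Lemma smooth_cst U (r : R) : smooth U (cst r).
Proof. by move=> k; exact: Ck_cst. Qed.

Lemma smooth_add U f g : open U -> smooth U f -> smooth U g -> smooth U (f + g).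
Proof. by move=> oU sf sg k; apply: Ck_add. Qed.

Lemma smooth_mul U f g : open U -> smooth U f -> smooth U g -> smooth U (f * g).
Proof. by move=> oU sf sg k; apply: Ck_mul. Qed.

Lemma smooth_opp U f : open U -> smooth U f -> smooth U (- f).
Proof. by move=> oU sf k; apply: Ck_opp. Qed.

Lemma smooth_inv U f : open U -> (forall x, U x -> f x != 0) -> smooth U f ->
  smooth U (fun x => (f x)^-1).
Proof. by move=> oU f0 sf k; apply: Ck_inv. Qed.

Lemma smooth_ln U f : open U -> (forall x, U x -> 0 < f x) -> smooth U f ->
  smooth U (fun x => ln (f x)).
Proof. by move=> oU f0 sf k; apply: Ck_ln. Qed.

Lemma smooth_exp U f : open U -> smooth U f -> smooth U (fun x => expR (f x)).
Proof. by move=> oU sf k; apply: Ck_exp. Qed.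

Lemma smooth_linear U (f : {linear E -> R^o}) : continuous f -> smooth U f.
Proof. by move=> cf k; exact: Ck_linear. Qed.

Lemma smooth_derive U f w : smooth U f -> smooth U ('D_w f).
Proof. by move=> sf k; have [_ /(_ w)[]] := sf k.+1. Qed.

Lemma smooth_derivable U f x w : smooth U f -> U x -> derivable f x w.
Proof. by move=> /(_ 1%N)[_ /(_ w)[+ _]]; exact. Qed.

Lemma smooth_continuous U f x : smooth U f -> U x -> {for x, continuous f}.
Proof. by move=> /(_ 0%N); exact: Ck_continuous. Qed.

End Smoothness.

(** * Directional derivatives: mean value theorem and symmetry of second derivatives *)

Section Calculus.
Context {R : realType} {E : normedModType R}.
Implicit Types (U V : set E) (f g : E -> R^o) (k : nat).

Lemma derive_line f (x w : E) (s : R) :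
  derivable f (x + s *: w) w -> is_derive (s : R) 1 (fun r : R => f (x + r *: w)) ('D_w f (x + s *: w)).
Proof.
move=> df.
have e h : f (x + (h *: 1 + s) *: w) = f (h *: w + (x + s *: w)).
  by congr f; rewrite [h *: 1]mulr1 scalerDl addrCA.
split; last first.
  rewrite /derive; set g1 := (fun h => _); set g2 := (fun h => _).
  by suff -> : g1 = g2 by []; apply/funext => h; rewrite /g1 /g2 /= e.
move: df; rewrite /derivable; set g1 := (fun h => _); set g2 := (fun h => _).
by suff -> : g2 = g1 by []; apply/funext => h; rewrite /g1 /g2 /= e.
Qed.

Lemma mean_value_line f (x w : E) (s : R) :
  (forall r : R, `|r| <= `|s| -> derivable f (x + r *: w) w) ->
  exists2 c : R, `|c| <= `|s| & f (x + s *: w) - f x = s * 'D_w f (x + c *: w).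
Proof.
move=> df; pose F (r : R) : R := f (x + r *: w).
have dF r : `|r| <= `|s| -> is_derive (r : R) 1 F ('D_w f (x + r *: w)).
  by move=> /df; exact: derive_line.
have cF r : `|r| <= `|s| -> {for r, continuous F}.
  move=> /dF[d _]; exact/differentiable_continuous/derivable1_diffP.
have [s0|s0] := leP 0 s.
  have rs r : 0 <= r <= s -> `|r| <= `|s|.
    by move=> /andP[r0 rs]; rewrite !ger0_norm.
  have [||c] := @MVT_segment R F (fun r => 'D_w f (x + r *: w)) 0 s s0.
  - by move=> r /itvP rs'; apply/dF/rs; rewrite !rs'.
  - by apply: continuous_in_subspaceT => r /[!inE]/= /itvP rs'; apply/cF/rs; rewrite !rs'.
  move=> /itvP cs; rewrite /F scale0r addr0 subr0 => ->.
  by exists c; [apply: rs; rewrite !cs|rewrite mulrC].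
have rs r : s <= r <= 0 -> `|r| <= `|s|.
  by move=> /andP[rs r0]; rewrite !ler0_norm ?lerN2 // ltW.
have [||c] := @MVT_segment R F (fun r => 'D_w f (x + r *: w)) s 0 (ltW s0).
- by move=> r /itvP rs'; apply/dF/rs; rewrite !rs'.
- by apply: continuous_in_subspaceT => r /[!inE]/= /itvP rs'; apply/cF/rs; rewrite !rs'.
move=> /itvP cs; rewrite /F scale0r addr0 sub0r => e.
exists c; first by apply: rs; rewrite !cs.
by rewrite -opprB e mulrN opprK mulrC.
Qed.

(** By the mean value theorem the difference quotient at [y] is a value of ['D_w f] near [x], and
    continuity of ['D_w f] bounds it uniformly in [y]. This uniformity in the base point is what
    second differences and the chain rule rely on. *)
Lemma strict_derive U f x w (e : R) : open U -> U x -> Ck 1 U f -> 0 < e ->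
  \forall y \near x & s \near (0 : R^o),
    `|f (y + s *: w) - f y - s * 'D_w f x| <= e * `|s|.
Proof.
move=> oU Ux [_ /(_ w)[df [cD _]]] e0.
have [r /= r0 rU] : exists2 r : R, 0 < r & forall y, `|y - x| < r ->
    U y /\ `|'D_w f y - 'D_w f x| <= e.
  have /cvgrPdist_le/(_ e e0) cDx := cD x Ux.
  have : \forall y \near x, U y /\ `|'D_w f y - 'D_w f x| <= e.
    near=> y; split; first by near: y; exact: open_nbhs_nbhs.
    by rewrite distrC; near: y; exact: cDx.
  move=> /nbhs_normP[r /= r0 rU]; exists r => // y yr; apply: rU.
  by rewrite /ball_/= distrC.
have H : \forall y \near x & s \near (0 : R^o), `|y - x| + `|s| * `|w| < r.
  have r2 : 0 < r / 2 by rewrite divr_gt0.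
  exists ([set y | `|y - x| < r / 2], [set s | `|s| * `|w| < r / 2]) => /=.
    split; first by apply/nbhs_normP; exists (r / 2) => //= y; rewrite /ball_/= distrC.
    have [->|w0] := eqVneq w 0; first by near=> s => /=; rewrite normr0 mulr0.
    near=> s; rewrite /= -ltr_pdivlMr ?normr_gt0//; near: s.
    by apply: (@nbhs0_lt R R^o); rewrite divr_gt0// normr_gt0.
  by move=> [y s] /= [ys sw]; rewrite (splitr r) ltrD.
move: H; apply: filterS => -[y s] /= ys.
have ball c : `|c| <= `|s| -> `|y + c *: w - x| < r.
  move=> cs; apply: le_lt_trans ys; rewrite addrAC (le_trans (ler_normD _ _))//.
  by rewrite lerD2l normrZ ler_wpM2r.
have [c cs ->] := @mean_value_line f y w s (fun c cs => df _ (rU _ (ball c cs)).1).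
by rewrite -mulrBr normrM mulrC ler_wpM2r// (rU _ (ball c cs)).2.
Unshelve. all: by end_near. Qed.

(** The double difference is the increment along [w] of [F y = f (y + s v) - f y]. The mean value
    theorem turns it into [s] times an increment of ['D_w f] along [v], which [strict_derive]
    estimates at the displaced base point. *)
Lemma second_difference U f x v w (e : R) : open U -> U x -> Ck 2 U f -> 0 < e ->
  \forall s \near (0 : R^o),
    `|f (x + s *: v + s *: w) - f (x + s *: v) - f (x + s *: w) + f x
      - s ^+ 2 * 'D_v ('D_w f) x| <= e * s ^+ 2.
Proof.
move=> oU Ux [_ Cf] e0; have [df C1] := Cf w.
have H := strict_derive v oU Ux C1 e0.
move: H => [[A B] /= [xA B0] AB].
have [r /= r0 rA] : exists2 r : R, 0 < r & forall y, `|y - x| < r -> A y /\ U y.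
  have : \forall y \near x, A y /\ U y.
    by apply: filterI => //; exact: open_nbhs_nbhs.
  move=> /nbhs_normP[r /= r0 rU]; exists r => // y yr; apply: rU.
  by rewrite /ball_/= distrC.
have small (z : E) : \forall s \near (0 : R^o), `|s| * `|z| < r / 2.
  have r2 : 0 < r / 2 by rewrite divr_gt0.
  have [->|z0] := eqVneq z 0.
    by near=> s; rewrite normr0 mulr0.
  near=> s; rewrite -ltr_pdivlMr ?normr_gt0//; near: s.
  by apply: (@nbhs0_lt R R^o); rewrite divr_gt0// normr_gt0.
near=> s.
have sv : `|s| * `|v| < r / 2 by near: s; exact: small.
have sw : `|s| * `|w| < r / 2 by near: s; exact: small.
have Bs : B s by near: s; exact: B0.
have bw (c : R) : `|c| <= `|s| -> `|c *: w| < r / 2.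
  by move=> cs; apply: le_lt_trans sw; rewrite normrZ ler_wpM2r.
have b1 (c : R) : `|c| <= `|s| -> U (x + c *: w) /\ A (x + c *: w).
  move=> /bw cs; suff /rA[] : `|x + c *: w - x| < r by [].
  rewrite addrAC subrr add0r.
  by rewrite (lt_trans cs)// ltr_pdivrMr// ltr_pMr// ltr1n.
have b2 (c : R) : `|c| <= `|s| -> U (x + c *: w + s *: v).
  move=> /bw cs; suff /rA[] : `|x + c *: w + s *: v - x| < r by [].
  rewrite -[x + _ + _]addrA addrAC subrr add0r (le_lt_trans (ler_normD _ _))//.
  by rewrite (splitr r) ltrD// normrZ.
pose F (y : E) : R^o := f (y + s *: v) - f y.
have dF (c : R) : `|c| <= `|s| -> is_derive (x + c *: w) w F
    ('D_w f (x + c *: w + s *: v) - 'D_w f (x + c *: w)).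
  move=> cs; have d1 := df _ (b1 c cs).1; have d2 := df _ (b2 c cs).
  have d3 : is_derive (x + c *: w) w (fun y => f (y + s *: v))
      ('D_w f (x + c *: w + s *: v)).
    have ee h : f (h *: w + (x + c *: w) + s *: v) = f (h *: w + (x + c *: w + s *: v)).
      by rewrite !addrA.
    split; last first.
      rewrite /derive; set g1 := (fun h => _); set g2 := (fun h => _).
      by suff -> : g1 = g2 by []; apply/funext => h; rewrite /g1 /g2 /= ee.
    move: d2; rewrite /derivable; set g1 := (fun h => _); set g2 := (fun h => _).
    by suff -> : g2 = g1 by []; apply/funext => h; rewrite /g1 /g2 /= ee.
  by apply: is_deriveB => //; exact: derivableP.
have [c cs] := @mean_value_line F x w s (fun c cs => @ex_derive _ _ _ _ _ _ _ (dF c cs)).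
have [_ ->] := dF c cs.
have -> : f (x + s *: v + s *: w) - f (x + s *: v) - f (x + s *: w) + f x =
    F (x + s *: w) - F x by rewrite /F [x + s *: v + s *: w]addrAC; ring.
move=> ->; rewrite expr2 -mulrA -mulrBr normrM.
have := AB (x + c *: w, s) (conj (b1 c cs).2 Bs) => /= /(ler_wpM2l (normr_ge0 s)) => /le_trans; apply.
have -> : `|s| * (e * `|s|) = e * `|s * s| :> R by rewrite mulrCA normrM.
by rewrite ger0_norm // -expr2 sqr_ge0.
Unshelve. all: by end_near. Qed.

(** The double difference is symmetric in [v] and [w], and divided by [s ^+ 2] it approximates both
    mixed derivatives. *)
Lemma derive_comm U f x v w : open U -> U x -> Ck 2 U f ->
  'D_v ('D_w f) x = 'D_w ('D_v f) x.
Proof.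
move=> oU Ux Cf; apply/eqP; rewrite -subr_eq0 -normr_le0; apply/ler_addgt0Pr => e e0.
rewrite add0r; have e2 : 0 < e / 2 by rewrite divr_gt0.
have H1 := second_difference v w oU Ux Cf e2.
have H2 := second_difference w v oU Ux Cf e2.
have [s [s0 {}H1 {}H2]] : exists s : R^o, [/\ s != 0,
    `|f (x + s *: v + s *: w) - f (x + s *: v) - f (x + s *: w) + f x
      - s ^+ 2 * 'D_v ('D_w f) x| <= e / 2 * s ^+ 2 &
    `|f (x + s *: w + s *: v) - f (x + s *: w) - f (x + s *: v) + f x
      - s ^+ 2 * 'D_w ('D_v f) x| <= e / 2 * s ^+ 2].
  have [r /= r0 rH] := (nbhs_normP _ _).1 (filterI H1 H2).
  have r2 : 0 < r / 2 by rewrite divr_gt0.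
  have /rH[] : ball_ Num.norm (0 : R^o) r (r / 2).
    rewrite /ball_/= sub0r normrN gtr0_norm//.
    by rewrite ltr_pdivrMr// ltr_pMr// ltr1n.
  by move=> K1 K2; exists (r / 2); split; [rewrite gt_eqF|exact: K1|exact: K2].
have s2 : 0 < s ^+ 2 by rewrite exprn_even_gt0.
rewrite -(ler_pM2l s2) -{1}(ger0_norm (ltW s2)) -normrM.
move: H1 H2; rewrite [x + s *: w + s *: v]addrAC.
set D := _ + f x; set D' := _ + f x => H1 H2.
have DD : D' = D by rewrite /D /D'; ring.
rewrite DD in H2.
clear DD; move: D ('D_v ('D_w f) x) ('D_w ('D_v f) x) H1 H2 => D0 A B H1 H2.
have -> : s ^+ 2 * (A - B) = (D0 - s ^+ 2 * B) - (D0 - s ^+ 2 * A).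
  by rewrite mulrBr opprB [RHS]addrC addrA subrK.
rewrite (le_trans (ler_normB _ _))// (le_trans (lerD H2 H1))//.
by rewrite -mulrDl -splitr mulrC.
Qed.

End Calculus.

Lemma cvg_sum_seq (R : numFieldType) (V : normedModType R) (T I : Type)
    (F : set_system T) {FF : Filter F} (s : seq I) (f : I -> T -> V) (a : I -> V) :
  (forall i, f i t @[t --> F] --> a i) ->
  \sum_(i <- s) f i t @[t --> F] --> \sum_(i <- s) a i.
Proof.
move=> fa; elim: s => [|i s IH].
  rewrite big_nil; rewrite (_ : (fun _ => _) = cst 0); first exact: cvg_cst.
  by apply/funext => t; rewrite big_nil.
rewrite big_cons (_ : (fun t => _) = f i + (fun t => \sum_(j <- s) f j t)).
  exact: cvgD (fa i) IH.
by apply/funext => t; rewrite big_cons.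
Qed.

(** * Chain rule along curves and derivative tests at a minimum *)

Section ChainRule.
Context {R : realType} {E : normedModType R}.
Implicit Types (U V : set E) (f g : E -> R^o) (k : nat).

(** The increment is split into one move per direction [e i]. Each move starts at a different point,
    which the uniformity of [strict_derive] allows. *)
Lemma increment_bound U f y (I : Type) (s : seq I) (e : I -> E) (T : Type)
    (F : set_system T) {FF : Filter F} (D : I -> T -> R^o) (eps : R) :
  open U -> U y -> Ck 1 U f -> (forall i, D i t @[t --> F] --> (0 : R^o)) -> 0 < eps ->
  \forall t \near F,
    `|f (y + \sum_(i <- s) D i t *: e i) - f y - \sum_(i <- s) D i t * 'D_(e i) f y|
      <= eps * \sum_(i <- s) `|D i t|.
Proof.
move=> oU Uy Cf D0 eps0; elim: s => [|i s IH].
  by apply: nearW => t; rewrite !big_nil addr0 subrr subr0 normr0 mulr0.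
have yc : y + \sum_(i <- s) D i t *: e i @[t --> F] --> y.
  have H := cvg_sum_seq (s := s) (fun j => @cvgZr_tmp _ _ _ _ _ _ _ (e j) (D0 j)).
  have Z : \sum_(i <- s) (0 : R) *: e i = 0 by rewrite big1// => j _; rewrite scale0r.
  have K0 := cvgD (@cvg_cst _ y T F FF) (H FF FF).
  rewrite Z addr0 in K0; exact: K0.
have [[A B] /= [yA B0] AB] := strict_derive (e i) oU Uy Cf eps0.
have At := yc _ yA; have Bt := D0 i _ B0.
move: IH At Bt; rewrite /nbhs/= => IH At Bt.
near=> t.
have h1 : A (y + \sum_(i <- s) D i t *: e i) by near: t.
have h2 : B (D i t) by near: t.
have h3 := AB (_, _) (conj h1 h2).
have IH2 : `|f (y + \sum_(i <- s) D i t *: e i) - f y - \sum_(i <- s) D i t * 'D_(e i) f y|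
      <= eps * \sum_(i <- s) `|D i t| by near: t.
rewrite !big_cons; move: h3 IH2 => /=.
rewrite [D i t *: e i + _]addrC [y + (_ + _)]addrA.
move: (f _) (f _) (f _) (D i t * _) (\sum_(i <- s) D i t * _) => a b c d k h3 IH2.
rewrite mulrDr (le_trans _ (lerD h3 IH2))// (le_trans _ (ler_normD _ _))//.
by rewrite le_eqVlt; apply/orP; left; apply/eqP; congr (`|_|); ring.
Unshelve. all: by end_near. Qed.

(** After division by [h] the error in [increment_bound] is a small constant times a sum of
    difference quotients, which stays bounded because the quotients converge. *)
Lemma derive_curve U f y (I : Type) (s : seq I) (e : I -> E) (D : I -> R^o -> R^o)
   (a : I -> R^o) :
  open U -> U y -> Ck 1 U f ->
  (forall i, h^-1 * D i h @[h --> (0 : R^o)^'] --> a i) ->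
  h^-1 * (f (y + \sum_(i <- s) D i h *: e i) - f y) @[h --> (0 : R^o)^'] -->
    (\sum_(i <- s) a i * 'D_(e i) f y : R^o).
Proof.
move=> oU Uy Cf Da.
have D0 i : D i h @[h --> (0 : R^o)^'] --> (0 : R^o).
  have hid : h @[h --> (0 : R^o)^'] --> (0 : R^o) by exact: cvg_within.
  have H := cvgM hid (Da i); rewrite mul0r in H.
  apply: (cvg_trans _ (H _)); apply: near_eq_cvg; near=> h.
  rewrite /= mulrA divff ?mul1r//; near: h; exact: nbhs_dnbhs_neq.
have main : h^-1 * (f (y + \sum_(i <- s) D i h *: e i) - f y) -
     \sum_(i <- s) (h^-1 * D i h) * 'D_(e i) f y @[h --> (0 : R^o)^'] --> (0 : R^o).
  have K : \sum_(i <- s) `|h^-1 * D i h| @[h --> (0 : R^o)^'] --> (\sum_(i <- s) `|a i| : R^o).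
    by apply: cvg_sum_seq => i; apply: cvg_norm; exact: Da.
  apply/cvgr0Pnorm_le => eps eps0.
  set C := \sum_(i <- s) `|a i|.
  have C0 : 0 <= C by apply: sumr_ge0 => i _; exact: normr_ge0.
  have C1 : 0 < C + 1 by rewrite ltr_wpDl.
  (* The sum of the [|h^-1 * D i h|] tends to [C], so it is eventually below [C + 1]; the [+ 1] also
     keeps the denominator positive when [C = 0]. *)
  have e' : 0 < eps / (C + 1) by rewrite divr_gt0.
  have KC : \forall h \near (0 : R^o)^', \sum_(i <- s) `|h^-1 * D i h| < C + 1.
    by apply: (cvgr_lt _ K); rewrite ltrDl.
  have B := increment_bound s e oU Uy Cf D0 e'.
  near=> h.
  have h0 : h != 0 by near: h; exact: nbhs_dnbhs_neq.
  have B1 : `|f (y + \sum_(i <- s) D i h *: e i) - f y - \sum_(i <- s) D i h * 'D_(e i) f y|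
      <= eps / (C + 1) * \sum_(i <- s) `|D i h| by near: h; exact: B.
  have K1 : \sum_(i <- s) `|h^-1 * D i h| < C + 1 by near: h; exact: KC.
  have -> : \sum_(i <- s) (h^-1 * D i h) * 'D_(e i) f y =
      h^-1 * \sum_(i <- s) D i h * 'D_(e i) f y.
    by rewrite big_distrr/=; apply: eq_bigr => i _; rewrite mulrA.
  rewrite -mulrBr normrM.
  have -> : eps = eps / (C + 1) * (C + 1) by rewrite divfK// gt_eqF.
  apply: (@le_trans _ _ (eps / (C + 1) * \sum_(i <- s) `|h^-1 * D i h|)); last first.
    by rewrite ler_wpM2l// ltW.
  have -> : \sum_(i <- s) `|h^-1 * D i h| = `|h^-1| * \sum_(i <- s) `|D i h|.
    by rewrite big_distrr/=; apply: eq_bigr => i _; rewrite normrM.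
  by rewrite mulrCA ler_wpM2l.
have S : \sum_(i <- s) (h^-1 * D i h) * 'D_(e i) f y @[h --> (0 : R^o)^'] -->
    (\sum_(i <- s) a i * 'D_(e i) f y : R^o).
  by apply: cvg_sum_seq => i; apply: cvgM; [exact: Da|exact: cvg_cst].
have H := cvgD main S; rewrite add0r in H; apply: (cvg_trans _ (H _)); apply: near_eq_cvg; near=> h.
by rewrite /= subrK.
Unshelve. all: by end_near. Qed.

Lemma derive_sum_dir U f x (I : Type) (s : seq I) (a : I -> R) (e : I -> E) :
  open U -> U x -> Ck 1 U f ->
  'D_(\sum_(i <- s) a i *: e i) f x = \sum_(i <- s) a i * 'D_(e i) f x.
Proof.
move=> oU Ux Cf.
have H : h^-1 * (f (x + \sum_(i <- s) (h * a i) *: e i) - f x) @[h --> (0 : R^o)^'] -->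
    (\sum_(i <- s) a i * 'D_(e i) f x : R^o).
  apply: (@derive_curve U f x I s e (fun i h => h * a i) a oU Ux Cf) => i.
  have H : (a i : R^o) @[h --> (0 : R^o)^'] --> (a i : R^o) by exact: cvg_cst.
  apply: (cvg_trans _ H); apply: near_eq_cvg; near=> h.
  rewrite mulrA mulVf ?mul1r//; near: h; exact: nbhs_dnbhs_neq.
apply/cvg_lim => //; apply: (cvg_trans _ H); apply: near_eq_cvg; apply: nearW => h /=.
rewrite scaler_sumr [X in _ = _ *: (f X - _)]addrC.
by under [in RHS]eq_bigr do rewrite scalerA.
Unshelve. all: by end_near. Qed.

Lemma derive_opp_dir U f x w : open U -> U x -> Ck 1 U f -> 'D_(- w) f x = - 'D_w f x.
Proof.
move=> oU Ux Cf; have := @derive_sum_dir U f x unit [:: tt] (fun=> -1) (fun=> w) oU Ux Cf.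
by rewrite !big_seq1 scaleN1r mulN1r.
Qed.

(** One-sided in [s], so that it also covers the direction [- et], along which nonnegativity is
    known only towards the past. *)
Lemma derive_ge0_dir U f x w : open U -> U x -> smooth U f -> f x = 0 ->
  (\forall s \near (0 : R^o), 0 < s -> 0 <= f (x + s *: w)) -> 0 <= 'D_w f x.
Proof.
move=> oU Ux sf fx0 f0.
have df : derivable f x w := smooth_derivable sf Ux.
rewrite leNgt; apply/negP => D0.
have e0 : 0 < - 'D_w f x / 2 by rewrite divr_gt0// oppr_gt0.
have [[A B] /= [xA B0] AB] := strict_derive w oU Ux (sf 1%N) e0.
have [r /= r0 rH] := (nbhs_normP _ _).1 (filterI B0 f0).
have r2 : 0 < r / 2 by rewrite divr_gt0.
have [Br fr] : (B `&` [set s : R^o | 0 < s -> 0 <= f (x + s *: w)]) (r / 2).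
  apply: rH; rewrite /ball_/= sub0r normrN gtr0_norm//.
  by rewrite ltr_pdivrMr// ltr_pMr// ltr1n.
have := AB (x, r / 2) (conj (nbhs_singleton xA) Br) => /=.
rewrite fx0 subr0 [`|r / 2|]gtr0_norm// => le.
have {}fr := fr r2; move: le fr; move: (f _) ('D_w f x) D0 {e0 AB} => y d d0 le y0.
have : y - r / 2 * d <= - d / 2 * (r / 2) by apply: le_trans le; exact: ler_norm.
move=> le2; have : 0 < - (r / 2 * d) by rewrite -mulrN mulr_gt0// oppr_gt0.
by nra.
Qed.

Lemma derive2_ge0_dir U f x w : open U -> U x -> smooth U f -> f x = 0 ->
  (\forall s \near (0 : R^o), 0 <= f (x + s *: w)) -> 0 <= 'D_w ('D_w f) x.
Proof.
move=> oU Ux sf fx0 f0.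
have DN : 'D_w ('D_(- w) f) x = - 'D_w ('D_w f) x.
  rewrite -deriveN; last exact: smooth_derivable (smooth_derive w sf) Ux.
  apply: near_eq_derive.
  exact: (near_open oU Ux (fun y Uy => derive_opp_dir w oU Uy (sf 1%N))).
rewrite leNgt; apply/negP => D0.
have e0 : 0 < - 'D_w ('D_w f) x / 2 by rewrite divr_gt0// oppr_gt0.
(* Opposite increments lead back to [x]: the double difference is
   [2 f(x) - f(x + s w) - f(x - s w)], which is nonpositive here. *)
have H := second_difference w (- w) oU Ux (sf 2%N) e0.
have f0' : \forall s \near (0 : R^o), 0 <= f (x + (- s) *: w).
  have c : - s @[s --> (0 : R^o)] --> - (0 : R^o) by apply: cvgN; exact: cvg_id.
  by rewrite oppr0 in c; exact: c _ f0.
have [r /= r0 rH] := (nbhs_normP _ _).1 (filterI H (filterI f0 f0')).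
have r2 : 0 < r / 2 by rewrite divr_gt0.
have [] : ([set s : R^o | `|f (x + s *: w + s *: - w) - f (x + s *: w) - f (x + s *: - w) + f x
      - s ^+ 2 * 'D_w ('D_(- w) f) x| <= - 'D_w ('D_w f) x / 2 * s ^+ 2] `&`
   ([set s : R^o | 0 <= f (x + s *: w)] `&` [set s : R^o | 0 <= f (x + (- s) *: w)])) (r / 2).
  apply: rH; rewrite /ball_/= sub0r normrN gtr0_norm//.
  by rewrite ltr_pdivrMr// ltr_pMr// ltr1n.
move=> /= le [y0 z0]; move: le y0 z0; rewrite DN scalerN addrK fx0 -scaleNr.
move: (f _) (f _) ('D_w _ x) D0 {e0 DN H} => y z d d0 le y0 z0.
have : - (0 - z - y + 0 - (r / 2) ^+ 2 * - d) <= - d / 2 * (r / 2) ^+ 2.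
  by apply: le_trans le; apply: le_trans (ler_norm _) _; rewrite normrN.
have : 0 < - d * (r / 2) ^+ 2 by rewrite mulr_gt0 ?oppr_gt0// exprn_gt0.
by nra.
Qed.

End ChainRule.

(** * Composition with a map given by its coordinates *)

Section Composition.
Context {R : realType} {E E' : normedModType R} (I : finType) (e : I -> E')
  (c : I -> E' -> R^o).
Hypothesis cE : forall y, y = \sum_i c i y *: e i.
Implicit Types (U : set E) (V : set E') (Th : E -> E') (f : E' -> R^o).

Lemma is_derive_comp_coord V Th f x w :
  open V -> V (Th x) -> Ck 1 V f ->
  (forall i, derivable (c i \o Th) x w) ->
  is_derive x w (f \o Th) (\sum_i 'D_w (c i \o Th) x * 'D_(e i) f (Th x)).
Proof.
move=> oV Vx Cf dc.
have H : h^-1 * (f (Th x + \sum_i (c i (Th (h *: w + x)) - c i (Th x)) *: e i) - f (Th x))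
    @[h --> (0 : R^o)^'] --> (\sum_i 'D_w (c i \o Th) x * 'D_(e i) f (Th x) : R^o).
  apply: (@derive_curve _ _ V f (Th x) I (index_enum I) e
    (fun i h => c i (Th (h *: w + x)) - c i (Th x))
    (fun i => 'D_w (c i \o Th) x) oV Vx Cf) => i.
  exact: dc.
have {H} : h^-1 *: ((f \o Th) (h *: w + x) - (f \o Th) x) @[h --> (0 : R^o)^'] -->
    (\sum_i 'D_w (c i \o Th) x * 'D_(e i) f (Th x) : R^o).
  apply: (cvg_trans _ H); apply: near_eq_cvg; apply: nearW => h /=.
  rewrite [RHS]/GRing.scale/=; congr (_ * (f _ - _)).
  rewrite {1}(cE (Th x)) -big_split/= [RHS]cE; apply: eq_bigr => i _.
  by rewrite -scalerDl addrC subrK.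
move=> H; split; first by apply/cvg_ex; eexists; exact: H.
exact/cvg_lim.
Qed.

Lemma continuous_coord_maps Th x :
  (forall i, {for x, continuous (c i \o Th)}) -> {for x, continuous Th}.
Proof.
move=> cc; rewrite /prop_for /continuous_at [Th x]cE.
have H : (\sum_(i <- index_enum I) c i (Th y) *: e i) @[y --> x] -->
    \sum_(i <- index_enum I) c i (Th x) *: e i.
  by apply: cvg_sum_seq => i; apply: cvgZr_tmp; exact: cc.
apply: (cvg_trans _ H); apply: near_eq_cvg; apply: nearW => y.
by rewrite -cE.
Qed.

(** Induction on [k]: a derivative of [f \o Th] is a sum of products of derivatives of the
    coordinates of [Th] with the functions ['D_(e i) f \o Th], and ['D_(e i) f] has one order of
    smoothness less. *)
Lemma Ck_comp k U V Th f : open U -> open V -> (forall x, U x -> V (Th x)) ->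
  (forall i, smooth U (c i \o Th)) -> Ck k V f -> Ck k U (f \o Th).
Proof.
move=> oU oV UV sc.
have cTh x : U x -> {for x, continuous Th}.
  move=> Ux; apply: continuous_coord_maps => i; exact: smooth_continuous (sc i) Ux.
elim: k f => [|k IH] f.
  move=> Cf; split=> // x Ux; apply: continuous_comp; first exact: cTh.
  by apply: Ck_continuous Cf _; exact: UV.
move=> Cf; split.
  move=> x Ux; apply: continuous_comp; first exact: cTh.
  by apply: Ck_continuous Cf _; exact: UV.
have C1 : Ck 1 V f by move: Cf => [cf df]; split=> // w; have [? /Ck_continuous h] := df w.
move=> w; have dw x : U x -> is_derive x w (f \o Th)
    (\sum_i 'D_w (c i \o Th) x * 'D_(e i) f (Th x)).
  move=> Ux; apply: (is_derive_comp_coord oV (UV _ Ux) C1) => i.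
  exact: smooth_derivable (sc i) Ux.
split=> [x /dw[]//|].
have Cd i : Ck k V ('D_(e i) f) by move: Cf => [_ /(_ (e i))[]].
suff H (s : seq I) : Ck k U (fun x => \sum_(i <- s) 'D_w (c i \o Th) x * 'D_(e i) f (Th x)).
  by apply: (Ck_ext oU) (H (index_enum I)) => x /dw[_ ->].
elim: s => [|i s IHs].
  apply: (Ck_ext oU) (Ck_cst k U 0) => x _; by rewrite big_nil.
have Ci : Ck k U ('D_w (c i \o Th)) by apply: (smooth_derive w (sc i)).
apply: (Ck_ext oU) (Ck_add oU (Ck_mul oU Ci (IH _ (Cd i))) IHs) => x _.
by rewrite big_cons.
Qed.

End Composition.

(** * Derivations *)

(** Only additivity and the Leibniz rule are kept, so that long differential identities become
    identities for [ring]. *)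
Record derivation (S : comNzRingType) := Derivation {
  dfun :> S -> S;
  dfunB : zmod_morphism dfun;
  dfunM : forall x y, dfun (x * y) = dfun x * y + x * dfun y }.

HB.instance Definition _ (S : comNzRingType) (d : derivation S) :=
  GRing.isZmodMorphism.Build S S (dfun d) (dfunB d).

Section Derivations.
Context {S : comNzRingType}.
Implicit Types (d : derivation S) (x y : S).

Lemma drvD d x y : d (x + y) = d x + d y. Proof. exact: raddfD. Qed.
Lemma drvB d x y : d (x - y) = d x - d y. Proof. exact: raddfB. Qed.
Lemma drvN d x : d (- x) = - d x. Proof. exact: raddfN. Qed.
Lemma drv0 d : d 0 = 0. Proof. exact: raddf0. Qed.
Lemma drv_sumE I (s : seq I) d (F : I -> S) :
  d (\sum_(i <- s) F i) = \sum_(i <- s) d (F i).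
Proof. exact: raddf_sum. Qed.

Lemma dfun1 d : d 1 = 0.
Proof.
by have := dfunM d 1 1; rewrite !mulr1 mul1r => /eqP; rewrite -subr_eq0 opprD addrA subrr sub0r oppr_eq0 => /eqP.
Qed.

Fact dscaleB (s : S) d : zmod_morphism (fun x => s * d x).
Proof. by move=> x y; rewrite raddfB mulrBr. Qed.

Fact dscaleM (s : S) d x y : s * d (x * y) = s * d x * y + x * (s * d y).
Proof. by rewrite dfunM; ring. Qed.

Definition drv_scale (s : S) d := Derivation (dscaleB s d) (dscaleM s d).

Fact daddB d d' : zmod_morphism (fun x => d x + d' x).
Proof. by move=> x y; rewrite !raddfB/= opprD addrACA. Qed.

Fact daddM d d' x y : d (x * y) + d' (x * y) = (d x + d' x) * y + x * (d y + d' y).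
Proof. by rewrite !dfunM; ring. Qed.

Definition drv_add d d' := Derivation (daddB d d') (daddM d d').

Fact dsumB n (d : 'I_n -> derivation S) : zmod_morphism (fun x => \sum_i d i x).
Proof. by move=> x y; rewrite -sumrB; apply: eq_bigr => i _; rewrite raddfB. Qed.

Fact dsumM n (d : 'I_n -> derivation S) x y :
  \sum_i d i (x * y) = (\sum_i d i x) * y + x * (\sum_i d i y).
Proof.
by rewrite mulr_suml mulr_sumr -big_split/=; apply: eq_bigr => i _; rewrite dfunM.
Qed.

Definition drv_sum n (d : 'I_n -> derivation S) := Derivation (dsumB d) (dsumM d).

End Derivations.

(** * Complex-valued smooth functions *)

Section SmoothC.
Context {R : realType} {E : normedModType R}.
Implicit Types (U : set E) (f g : E -> R[i]) (p : E).

Lemma ReM (x y : R[i]) : complex.Re (x * y) =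
  complex.Re x * complex.Re y - complex.Im x * complex.Im y.
Proof. by case: x y => [a b] [c d]. Qed.

Lemma ImM (x y : R[i]) : complex.Im (x * y) =
  complex.Re x * complex.Im y + complex.Im x * complex.Re y.
Proof. by case: x y => [a b] [c d]. Qed.

Lemma complex_ext (x y : R[i]) : complex.Re x = complex.Re y ->
  complex.Im x = complex.Im y -> x = y.
Proof. by case: x y => [a b] [c d] /= -> ->. Qed.

Lemma smoothC_ext U f g : open U -> (forall p, U p -> f p = g p) ->
  smoothC U f -> smoothC U g.
Proof.
move=> oU fg [sr si].
by split; [apply: (smooth_ext oU) sr|apply: (smooth_ext oU) si] => p /fg ->.
Qed.

Lemma smoothC_cst U (c : R[i]) : smoothC U (cst c).
Proof. by split; exact: smooth_cst. Qed.

Lemma ReD (x y : R[i]) : complex.Re (x + y) = complex.Re x + complex.Re y.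
Proof. by case: x y => [a b] [c d]. Qed.

Lemma ImD (x y : R[i]) : complex.Im (x + y) = complex.Im x + complex.Im y.
Proof. by case: x y => [a b] [c d]. Qed.

Lemma ReN (x : R[i]) : complex.Re (- x) = - complex.Re x.
Proof. by case: x. Qed.

Lemma ImN (x : R[i]) : complex.Im (- x) = - complex.Im x.
Proof. by case: x. Qed.

Lemma Re_conj (x : R[i]) : complex.Re (x^*) = complex.Re x.
Proof. by case: x. Qed.

Lemma Im_conj (x : R[i]) : complex.Im (x^*) = - complex.Im x.
Proof. by case: x. Qed.

Lemma smoothC_add U f g : open U -> smoothC U f -> smoothC U g ->
  smoothC U (fun p => f p + g p).
Proof.
move=> oU [sr si] [tr ti]; split.
  by apply: (smooth_ext oU) (smooth_add oU sr tr) => p _; rewrite ReD.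
by apply: (smooth_ext oU) (smooth_add oU si ti) => p _; rewrite ImD.
Qed.

Lemma smoothC_opp U f : open U -> smoothC U f -> smoothC U (fun p => - f p).
Proof.
move=> oU [sr si]; split.
  by apply: (smooth_ext oU) (smooth_opp oU sr) => p _; rewrite ReN.
by apply: (smooth_ext oU) (smooth_opp oU si) => p _; rewrite ImN.
Qed.

Lemma smoothC_mul U f g : open U -> smoothC U f -> smoothC U g ->
  smoothC U (fun p => f p * g p).
Proof.
move=> oU [sr si] [tr ti]; split.
  apply: (smooth_ext oU) (smooth_add oU (smooth_mul oU sr tr)
    (smooth_opp oU (smooth_mul oU si ti))) => p _.
  by rewrite ReM.
apply: (smooth_ext oU) (smooth_add oU (smooth_mul oU sr ti) (smooth_mul oU si tr)) => p _.
by rewrite ImM.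
Qed.

Lemma smoothC_conj U f : open U -> smoothC U f -> smoothC U (fun p => Num.conj (f p)).
Proof.
move=> oU [sr si]; split.
  by apply: (smooth_ext oU) sr => p _; rewrite Re_conj.
by apply: (smooth_ext oU) (smooth_opp oU si) => p _; rewrite Im_conj.
Qed.

Lemma smoothC_real U (f : E -> R^o) : smooth U f -> smoothC U (fun p => (f p)%:C).
Proof. by move=> sf; split=> //; exact: smooth_cst. Qed.

Lemma smoothC_inv U f : open U -> (forall p, U p -> f p != 0) -> smoothC U f ->
  smoothC U (fun p => (f p)^-1).
Proof.
move=> oU f0 [sr si].
pose N : E -> R^o := (fun p => complex.Re (f p)) * (fun p => complex.Re (f p)) +
   (fun p => complex.Im (f p)) * (fun p => complex.Im (f p)).
have sN : smooth U N by apply: (smooth_add oU); apply: (smooth_mul oU).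
have N0 p : U p -> N p != 0.
  move=> /f0; rewrite eq_complex/= negb_and => ab.
  rewrite -[N p]/(complex.Re (f p) * complex.Re (f p) + complex.Im (f p) * complex.Im (f p)).
  move: ab; move: (complex.Re _) (complex.Im _) => a b ab.
  have -> : a * a + b * b = a ^+ 2 + b ^+ 2 by rewrite !expr2.
  by rewrite paddr_eq0 ?sqr_ge0// !sqrf_eq0 negb_and.
have sV := smooth_inv oU N0 sN.
have NE p : N p = complex.Re (f p) ^+ 2 + complex.Im (f p) ^+ 2 by rewrite !expr2.
have RV p : complex.Re (f p)^-1 = complex.Re (f p) * (N p)^-1.
  by rewrite NE; case: (f p).
have IV p : complex.Im (f p)^-1 = - (complex.Im (f p) * (N p)^-1).
  by rewrite NE; case: (f p).
split.
  by apply: (smooth_ext oU) (smooth_mul oU sr sV) => p _; rewrite RV.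
by apply: (smooth_ext oU) (smooth_opp oU (smooth_mul oU si sV)) => p _; rewrite IV.
Qed.

Definition cderiv (w : E) f p : R[i] :=
  ('D_w (fun x => complex.Re (f x) : R^o) p) +i*
  ('D_w (fun x => complex.Im (f x) : R^o) p).

Lemma smoothC_cderiv U f w : smoothC U f -> smoothC U (cderiv w f).
Proof. by move=> [sr si]; split; exact: smooth_derive. Qed.

Lemma cderiv_ext U f g w p : open U -> U p -> (forall p, U p -> f p = g p) ->
  cderiv w f p = cderiv w g p.
Proof.
move=> oU Up fg; congr (_ +i* _); apply: near_eq_derive;
  by apply: near_open oU Up _ => q /fg ->.
Qed.

Lemma cderiv_sub U f g w p : open U -> U p -> smoothC U f -> smoothC U g ->
  cderiv w (fun p => f p - g p) p = cderiv w f p - cderiv w g p.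
Proof.
move=> oU Up [sr si] [tr ti]; apply: complex_ext.
  rewrite ReD ReN -[RHS]deriveB; [|exact: smooth_derivable sr Up|exact: smooth_derivable tr Up].
  by congr (derive _ p w); apply/funext => q; rewrite ReD ReN.
rewrite ImD ImN -[RHS]deriveB; [|exact: smooth_derivable si Up|exact: smooth_derivable ti Up].
by congr (derive _ p w); apply/funext => q; rewrite ImD ImN.
Qed.

Lemma cderiv_mul U f g w p : open U -> U p -> smoothC U f -> smoothC U g ->
  cderiv w (fun p => f p * g p) p = cderiv w f p * g p + f p * cderiv w g p.
Proof.
move=> oU Up [sr si] [tr ti].
have dr : derivable (fun x => complex.Re (f x) : R^o) p w := smooth_derivable sr Up.
have di : derivable (fun x => complex.Im (f x) : R^o) p w := smooth_derivable si Up.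
have er : derivable (fun x => complex.Re (g x) : R^o) p w := smooth_derivable tr Up.
have ei : derivable (fun x => complex.Im (g x) : R^o) p w := smooth_derivable ti Up.
apply: complex_ext.
  transitivity ('D_w ((fun x => complex.Re (f x) : R^o) * (fun x => complex.Re (g x) : R^o)
     - (fun x => complex.Im (f x) : R^o) * (fun x => complex.Im (g x) : R^o)) p).
    by rewrite /cderiv; congr (derive _ p w); apply/funext => q; rewrite ReM.
  rewrite (deriveB (derivableM dr er) (derivableM di ei)) (deriveM dr er) (deriveM di ei).
  rewrite /cderiv; case: (f p) (g p) => [a b] [c d] /=.
  rewrite [_ *: _]mulrC; rewrite /GRing.scale/=.
  by move: (derive _ _ _) (derive _ _ _) (derive _ _ _) (derive _ _ _) => k l m o; ring.
transitivity ('D_w ((fun x => complex.Re (f x) : R^o) * (fun x => complex.Im (g x) : R^o)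
     + (fun x => complex.Im (f x) : R^o) * (fun x => complex.Re (g x) : R^o)) p).
  by rewrite /cderiv; congr (derive _ p w); apply/funext => q; rewrite ImM.
rewrite (deriveD (derivableM dr ei) (derivableM di er)) (deriveM dr ei) (deriveM di er).
rewrite /cderiv; case: (f p) (g p) => [a b] [c d] /=.
rewrite /GRing.scale/=.
by move: (derive _ _ _) (derive _ _ _) (derive _ _ _) (derive _ _ _) => k l m o; ring.
Qed.

Lemma cderiv_conj U f w p : open U -> U p -> smoothC U f ->
  cderiv w (fun p => Num.conj (f p)) p = Num.conj (cderiv w f p).
Proof.
move=> oU Up [sr si]; apply: complex_ext.
  by rewrite Re_conj; congr (derive _ p w); apply/funext => q; rewrite Re_conj.
rewrite Im_conj -[RHS]deriveN; last exact: smooth_derivable si Up.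
by congr (derive _ p w); apply/funext => q; rewrite Im_conj.
Qed.

Lemma cderiv_cst c w p : cderiv w (cst c) p = 0.
Proof. by apply: complex_ext => /=; rewrite derive_cst. Qed.

Lemma cderiv_comm U f v w p : open U -> U p -> smoothC U f ->
  cderiv v (cderiv w f) p = cderiv w (cderiv v f) p.
Proof.
by move=> oU Up [sr si]; apply: complex_ext; apply: derive_comm oU Up _; [exact: sr|exact: si].
Qed.

End SmoothC.

(** * The ring of smooth functions on an open set *)

(* The base point makes the ring of smooth functions nontrivial. *)
Record domain (R : realType) (E : normedModType R) := Domain {
  dset :> E -> Prop;
  dset_open : open (dset : set E);
  dpt : E;
  dpt_in : dset dpt }.

Section SmoothFunctions.
Context {R : realType} {E : normedModType R}.
Implicit Types W : domain E.

(* The value 0 outside [W] makes equality of elements extensional on [W]. *)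
Record smf W := Smf {
  sval_fun :> E -> R[i];
  smf_smooth : smoothC (dset W) sval_fun;
  smf_out : forall p, ~ W p -> sval_fun p = 0 }.

Lemma smfP W (f g : smf W) : (forall p, W p -> f p = g p) -> f = g.
Proof.
case: f g => [f sf f0] [g sg g0] /= fg.
have e : f = g.
  by apply/funext => p; have [/fg//|Wp] := pselect (W p); rewrite f0// g0.
by subst g; congr Smf; exact: Prop_irrelevance.
Qed.

Definition cutoff W (f : E -> R[i]) p := if `[< W p >] then f p else 0.

Lemma cutoffE W f p : W p -> cutoff W f p = f p.
Proof. by rewrite /cutoff => /asboolT ->. Qed.

Lemma cutoff_out W f p : ~ W p -> cutoff W f p = 0.
Proof. by rewrite /cutoff => /asboolF ->. Qed.

Lemma cutoff_smooth W f : smoothC (dset W) f -> smoothC (dset W) (cutoff W f).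
Proof. by move=> sf; apply: (smoothC_ext (@dset_open _ _ W)) sf => p Wp; rewrite cutoffE. Qed.

Definition mkS W f (sf : smoothC (dset W) f) : smf W :=
  Smf (cutoff_smooth sf) (fun p => @cutoff_out W f p).

Lemma mkSE W f (sf : smoothC (dset W) f) p : W p -> mkS sf p = f p.
Proof. exact: cutoffE. Qed.

HB.instance Definition _ W := gen_eqMixin (smf W).
HB.instance Definition _ W := gen_choiceMixin (smf W).

End SmoothFunctions.

(* The operations are locked: conversion would otherwise unfold the difference
   quotients hidden in them. *)
HB.lock Definition sconst (R : realType) (E : normedModType R) (W : domain E) (c : R[i]) : smf W :=
  mkS (smoothC_cst (dset W) c).
HB.lock Definition sopp (R : realType) (E : normedModType R) (W : domain E) (f : smf W) : smf W :=
  mkS (smoothC_opp (@dset_open _ _ W) (smf_smooth f)).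
HB.lock Definition sadd (R : realType) (E : normedModType R) (W : domain E) (f g : smf W) : smf W :=
  mkS (smoothC_add (@dset_open _ _ W) (smf_smooth f) (smf_smooth g)).
HB.lock Definition smul (R : realType) (E : normedModType R) (W : domain E) (f g : smf W) : smf W :=
  mkS (smoothC_mul (@dset_open _ _ W) (smf_smooth f) (smf_smooth g)).
HB.lock Definition sconj (R : realType) (E : normedModType R) (W : domain E) (f : smf W) : smf W :=
  mkS (smoothC_conj (@dset_open _ _ W) (smf_smooth f)).
HB.lock Definition sder_fun (R : realType) (E : normedModType R) (W : domain E) (w : E) (f : smf W) : smf W :=
  mkS (smoothC_cderiv w (smf_smooth f)).
Arguments sconst {R E W} c.
Arguments sopp {R E W} f.
Arguments sadd {R E W} f g.
Arguments smul {R E W} f g.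
Arguments sconj {R E W} f.
Arguments sder_fun {R E W} w f.

Section SmoothRing.
Context {R : realType} {E : normedModType R}.
Implicit Types W : domain E.

Section Ring.
Context {W : domain E}.
Implicit Types f g k : smf W.
Let oW := @dset_open _ _ W.

Lemma sconstE c p : W p -> (sconst c : smf W) p = c.
Proof. by move=> Wp; rewrite sconst.unlock mkSE. Qed.
Lemma soppE f p : W p -> sopp f p = - f p.
Proof. by move=> Wp; rewrite sopp.unlock mkSE. Qed.
Lemma saddE f g p : W p -> sadd f g p = f p + g p.
Proof. by move=> Wp; rewrite sadd.unlock mkSE. Qed.
Lemma smulE f g p : W p -> smul f g p = f p * g p.
Proof. by move=> Wp; rewrite smul.unlock mkSE. Qed.

Fact saddA : associative (@sadd R E W).
Proof. by move=> f g k; apply: smfP => p Wp; rewrite !saddE// addrA. Qed.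
Fact saddC : commutative (@sadd R E W).
Proof. by move=> f g; apply: smfP => p Wp; rewrite !saddE// addrC. Qed.
Fact sadd0 : left_id (sconst 0) (@sadd R E W).
Proof. by move=> f; apply: smfP => p Wp; rewrite !saddE// sconstE// add0r. Qed.
Fact saddN : left_inverse (sconst 0) (@sopp R E W) sadd.
Proof. by move=> f; apply: smfP => p Wp; rewrite !saddE// soppE// sconstE// addNr. Qed.
Fact smulA : associative (@smul R E W).
Proof. by move=> f g k; apply: smfP => p Wp; rewrite !smulE// mulrA. Qed.
Fact smulC : commutative (@smul R E W).
Proof. by move=> f g; apply: smfP => p Wp; rewrite !smulE// mulrC. Qed.
Fact smul1 : left_id (sconst 1) (@smul R E W).
Proof. by move=> f; apply: smfP => p Wp; rewrite !smulE// sconstE// mul1r. Qed.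
Fact smulD : left_distributive (@smul R E W) (@sadd R E W).
Proof. by move=> f g k; apply: smfP => p Wp; rewrite !(smulE, saddE)// mulrDl. Qed.
Fact sone_neq0 : sconst 1 != sconst 0 :> smf W.
Proof.
apply/eqP => /(congr1 (fun f : smf W => f (dpt W))).
by rewrite !sconstE//; [move/eqP; rewrite oner_eq0|exact: dpt_in|exact: dpt_in].
Qed.

End Ring.

HB.instance Definition _ W := GRing.isZmodule.Build (smf W)
  (@saddA W) (@saddC W) (@sadd0 W) (@saddN W).
HB.instance Definition _ W := GRing.Zmodule_isComNzRing.Build (smf W)
  (@smulA W) (@smulC W) (@smul1 W) (@smulD W) (@sone_neq0 W).

Section Eval.
Context {W : domain E} (p : E) (Wp : W p).

(* The redex records [Wp], which the morphism instances below depend on. *)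
Definition ev (f : smf W) : R[i] := (fun _ : W p => f p) Wp.

Fact ev_is_additive : zmod_morphism ev.
Proof.
move=> f g; transitivity (f p + (- g) p); first exact: (saddE f (- g) Wp).
by congr (_ + _); exact: (soppE g Wp).
Qed.
Fact ev_is_multiplicative : monoid_morphism ev.
Proof. by split=> [|f g]; [exact: sconstE|exact: smulE]. Qed.
HB.instance Definition _ := GRing.isZmodMorphism.Build (smf W) R[i] ev ev_is_additive.
HB.instance Definition _ := GRing.isMonoidMorphism.Build (smf W) R[i] ev ev_is_multiplicative.

End Eval.
Arguments ev : simpl never.

Section Operations.
Context {W : domain E}.
Implicit Types f g k : smf W.
Let oW := @dset_open _ _ W.

Lemma evP f g : (forall p (Wp : W p), ev Wp f = ev Wp g) -> f = g.
Proof. by move=> fg; apply: smfP => p Wp; exact: fg Wp. Qed.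

Lemma ev_mkS p (Wp : W p) h (sh : smoothC (dset W) h) : ev Wp (mkS sh) = h p.
Proof. exact: mkSE. Qed.

Lemma ev_sconst p (Wp : W p) c : ev Wp (sconst c) = c.
Proof. exact: sconstE. Qed.

Lemma evM p (Wp : W p) f g : ev Wp (f * g) = ev Wp f * ev Wp g.
Proof. exact: rmorphM. Qed.

Lemma evD p (Wp : W p) f g : ev Wp (f + g) = ev Wp f + ev Wp g.
Proof. exact: rmorphD. Qed.

Lemma evB p (Wp : W p) f g : ev Wp (f - g) = ev Wp f - ev Wp g.
Proof. exact: rmorphB. Qed.

Lemma evN p (Wp : W p) f : ev Wp (- f) = - ev Wp f.
Proof. exact: rmorphN. Qed.

Lemma ev0 p (Wp : W p) : ev Wp 0 = 0.
Proof. exact: rmorph0. Qed.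

Lemma ev1 p (Wp : W p) : ev Wp 1 = 1.
Proof. exact: rmorph1. Qed.

Lemma ev_sum p (Wp : W p) I (s : seq I) (F : I -> smf W) :
  ev Wp (\sum_(i <- s) F i) = \sum_(i <- s) ev Wp (F i).
Proof. exact: raddf_sum. Qed.

Fact sconst_is_additive : zmod_morphism (@sconst R E W).
Proof. by move=> x y; apply: evP => p Wp; rewrite evB !ev_sconst. Qed.
Fact sconst_is_multiplicative : monoid_morphism (@sconst R E W).
Proof.
split=> [//|x y]; apply: evP => p Wp.
by rewrite evM !ev_sconst.
Qed.
HB.instance Definition _ :=
  GRing.isZmodMorphism.Build R[i] (smf W) (@sconst R E W) sconst_is_additive.
HB.instance Definition _ :=
  GRing.isMonoidMorphism.Build R[i] (smf W) (@sconst R E W) sconst_is_multiplicative.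

Lemma ev_sconj p (Wp : W p) f : ev Wp (sconj f) = Num.conj (ev Wp f).
Proof. by rewrite sconj.unlock; exact: mkSE. Qed.

Fact sconj_is_additive : zmod_morphism (@sconj R E W).
Proof. by move=> f g; apply: evP => p Wp; rewrite evB !ev_sconj evB rmorphB. Qed.
Fact sconj_is_multiplicative : monoid_morphism (@sconj R E W).
Proof.
split=> [|f g]; apply: evP => p Wp; first by rewrite ev_sconj ev1 rmorph1.
by rewrite evM !ev_sconj evM rmorphM.
Qed.
HB.instance Definition _ :=
  GRing.isZmodMorphism.Build (smf W) (smf W) (@sconj R E W) sconj_is_additive.
HB.instance Definition _ :=
  GRing.isMonoidMorphism.Build (smf W) (smf W) (@sconj R E W) sconj_is_multiplicative.

Lemma sconjK : involutive (@sconj R E W).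
Proof. by move=> f; apply: evP => p Wp; rewrite !ev_sconj conjCK. Qed.

Lemma sconj_const c : sconj (sconst c) = sconst (Num.conj c) :> smf W.
Proof. by apply: evP => p Wp; rewrite ev_sconj !ev_sconst. Qed.

Lemma ev_sder p (Wp : W p) w f : ev Wp (sder_fun w f) = cderiv w f p.
Proof. by rewrite sder_fun.unlock; exact: mkSE. Qed.

Fact sderB w : zmod_morphism (@sder_fun R E W w).
Proof.
move=> f g; apply: evP => p Wp; rewrite evB !ev_sder.
rewrite -(cderiv_sub _ oW Wp (smf_smooth f) (smf_smooth g)).
apply: (cderiv_ext _ oW Wp) => q Wq.
by rewrite -[LHS]/(ev Wq (f - g)) evB.
Qed.

Fact sderM w f g : sder_fun w (f * g) = sder_fun w f * g + f * sder_fun w g.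
Proof.
apply: evP => p Wp; rewrite evD !evM !ev_sder.
rewrite -(cderiv_mul _ oW Wp (smf_smooth f) (smf_smooth g)).
apply: (cderiv_ext _ oW Wp) => q Wq.
by rewrite -[LHS]/(ev Wq (f * g)) evM.
Qed.

Definition sder w : derivation (smf W) := Derivation (sderB w) (sderM w).

Lemma sder_const w c : sder w (sconst c) = 0.
Proof.
apply: evP => p Wp; rewrite ev_sder ev0 -(cderiv_cst c w p).
by apply: (cderiv_ext _ oW Wp) => q Wq; exact: (ev_sconst Wq).
Qed.

Lemma sder_conj w f : sder w (sconj f) = sconj (sder w f).
Proof.
apply: evP => p Wp; rewrite ev_sconj !ev_sder -(cderiv_conj _ oW Wp (smf_smooth f)).
by apply: (cderiv_ext _ oW Wp) => q Wq; exact: (ev_sconj Wq).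
Qed.

Lemma sder_comm v w f : sder v (sder w f) = sder w (sder v f).
Proof.
apply: evP => p Wp; rewrite [LHS](ev_sder Wp) [RHS](ev_sder Wp).
transitivity (cderiv v (cderiv w f) p).
  by apply: (cderiv_ext _ oW Wp) => q Wq; exact: (ev_sder Wq w f).
rewrite (cderiv_comm _ _ oW Wp (smf_smooth f)).
by apply: (cderiv_ext _ oW Wp) => q Wq; exact: (esym (ev_sder Wq v f)).
Qed.

(** This is the source of [1 / u], of [psi], of the inverse metric and of inverse Jacobians;
    afterwards each of them is known through its defining equation. *)
Lemma sinv_exists f : (forall p (Wp : W p), ev Wp f != 0) -> exists g, g * f = 1.
Proof.
move=> f0; have sV := smoothC_inv oW (fun p Wp => f0 p Wp) (smf_smooth f).
by exists (mkS sV); apply: evP => p Wp; rewrite evM ev1 ev_mkS mulVf// (f0 p Wp).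
Qed.

End Operations.
End SmoothRing.
Arguments ev {R E W p} Wp f.

(** * The evolution identity *)

Section CoreIdentity.
Context {S : comNzRingType} {C : comNzRingType} (ev : {rmorphism S -> C}) {n : nat}.
Variables (dz dzb : 'I_n -> derivation S) (dt D Db : derivation S).
Hypothesis comm_DDb : forall x, D (Db x) = Db (D x).
Hypothesis comm_Dz : forall k x, dz k (D x) = D (dz k x).
Hypothesis comm_Dzb : forall k x, dzb k (D x) = D (dzb k x).
Hypothesis comm_Dbz : forall k x, dz k (Db x) = Db (dz k x).
Hypothesis comm_Dbzb : forall k x, dzb k (Db x) = Db (dzb k x).
Hypothesis comm_tD : forall x, dt (D x) = D (dt x).
Hypothesis comm_tDb : forall x, dt (Db x) = Db (dt x).
Variables (G Y : 'I_n -> 'I_n -> S).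
Hypothesis YG : forall i j, \sum_m Y i m * G m j = (i == j)%:R.
Hypothesis evG : forall i j, ev (G i j) = (i == j)%:R.
Hypothesis evDG : forall i j, ev (D (G i j)) = 0.
Hypothesis evDbG : forall i j, ev (Db (G i j)) = 0.

(** [Y] is the matrix inverse of [G], so [Y l k] is the component [g^{k lbar}]; hence the transposed
    order of the indices. *)
Definition metric_trace (X : 'I_n -> 'I_n -> S) := \sum_k \sum_l Y l k * X k l.

Lemma sum_delta_r (F : 'I_n -> C) j : \sum_m F m * (m == j)%:R = F j.
Proof.
rewrite (bigD1 j)//= eqxx mulr1 big1 ?addr0// => i /negbTE ->.
by rewrite mulr0.
Qed.

Lemma sum_delta_l (F : 'I_n -> C) j : \sum_m (j == m)%:R * F m = F j.
Proof.
rewrite (bigD1 j)//= eqxx mul1r big1 ?addr0// => i; rewrite eq_sym => /negbTE ->.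
by rewrite mul0r.
Qed.

Lemma ev_inverse i j : ev (Y i j) = (i == j)%:R.
Proof.
have := congr1 ev (YG i j); rewrite raddf_sum/=.
by under eq_bigr do rewrite rmorphM/= evG; rewrite sum_delta_r => ->; rewrite rmorph_nat.
Qed.

Lemma dfun_nat (d : derivation S) m : d m%:R = 0.
Proof. by rewrite raddfMn/= dfun1 mul0rn. Qed.

Lemma ev_deriv_inverse (d : derivation S) i j :
  (forall i j, ev (d (G i j)) = 0) -> ev (d (Y i j)) = 0.
Proof.
move=> evdG; have := congr1 (fun x => ev (d x)) (YG i j).
rewrite dfun_nat rmorph0 raddf_sum raddf_sum/=.
under eq_bigr do rewrite dfunM rmorphD !rmorphM/= evG evdG mulr0 addr0.
by rewrite sum_delta_r.
Qed.

Lemma ev_deriv2_inverse i j : ev (D (Db (Y i j))) = - ev (D (Db (G i j))).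
Proof.
have := congr1 (fun x => ev (D (Db x))) (YG i j).
rewrite dfun_nat !raddf0 !raddf_sum/=.
under eq_bigr do rewrite dfunM raddfD/= !dfunM !rmorphD !rmorphM/= evG evDG evDbG
  ev_inverse !mulr0 !addr0 add0r.
by rewrite big_split/= sum_delta_r sum_delta_l => /eqP; rewrite addr_eq0 => /eqP.
Qed.

Lemma ev_trace X : ev (metric_trace X) = \sum_k ev (X k k).
Proof.
rewrite raddf_sum; apply: eq_bigr => k _; rewrite raddf_sum/=.
rewrite -[RHS](sum_delta_r (fun l => ev (X k l))); apply: eq_bigr => l _.
by rewrite rmorphM/= ev_inverse mulrC.
Qed.

Lemma ev_deriv_trace (d : derivation S) X : (forall i j, ev (d (G i j)) = 0) ->
  ev (d (metric_trace X)) = \sum_k ev (d (X k k)).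
Proof.
move=> evdG; rewrite !raddf_sum; apply: eq_bigr => k _; rewrite !raddf_sum/=.
rewrite -[RHS](sum_delta_r (fun l => ev (d (X k l)))); apply: eq_bigr => l _.
by rewrite dfunM rmorphD !rmorphM/= ev_inverse ev_deriv_inverse// mul0r add0r mulrC.
Qed.

(** This is where curvature enters. With [G = delta] and [dG = 0] at the point, the only correction
    to the flat trace comes from the second derivatives of [Y], which are minus those of [G]. *)
Lemma ev_deriv2_trace X : ev (D (Db (metric_trace X))) =
  \sum_k ev (D (Db (X k k))) - \sum_k \sum_l ev (D (Db (G l k))) * ev (X k l).
Proof.
rewrite 3!raddf_sum -sumrB; apply: eq_bigr => k _; rewrite 3!raddf_sum/=.
rewrite -[X in X - _](sum_delta_r (fun l => ev (D (Db (X k l))))) -sumrB.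
apply: eq_bigr => l _.
rewrite dfunM raddfD/= !dfunM !rmorphD !rmorphM/= ev_inverse !ev_deriv_inverse//.
rewrite ev_deriv2_inverse; ring.
Qed.

Variables (a f h l psi chi GV : S).
Hypothesis dta : D a = 0.
Hypothesis dba : Db a = 0.
Hypothesis psiE : psi * (1 - h * h) = 1.
Hypothesis Dl : h * D l = D h.
Hypothesis Dbl : h * Db l = Db h.
Hypothesis zchi : forall k, dz k chi = 0.
Hypothesis zbchi : forall k, dzb k chi = 0.
Hypothesis tGV : dt GV = 0.
Hypothesis evzGV : forall k, ev (dz k GV) = 0.
Hypothesis evzbGV : forall k, ev (dzb k GV) = 0.

(** For [u = exp f] and [v = u h], [Xf] is [u_{k lbar} / u], and [v_{k lbar} / u] is
    [h * Xf + Xh]. *)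
Definition Xf k l := dz k (dzb l f) + dz k f * dzb l f.
Definition Xh k l := dz k (dzb l h) + dz k f * dzb l h + dz k h * dzb l f.

Hypothesis heat_f : dt f = metric_trace Xf + a * f.
Hypothesis heat_h : dt h = metric_trace Xh + a * (h * l).

Lemma deriv_psi (d : derivation S) : d psi = 2 * h * psi ^+ 2 * d h.
Proof.
have := congr1 (fun x => psi * d x) psiE.
rewrite dfun1 mulr0 dfunM drvD drvN dfun1 dfunM => e.
have -> : d psi = psi * (1 - h * h) * d psi by rewrite psiE mul1r.
have -> : psi * (1 - h * h) * d psi = psi * (d psi * (1 - h * h) + psi * (0 - (d h * h + h * d h)))
  + 2 * h * psi ^+ 2 * d h by ring.
by rewrite e add0r.
Qed.

Definition Q := D (Db f) + chi * GV - psi * (D h * Db h).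

(* The four squares come from completing the Hessian products; the gradient
   terms cancel because [psi'' = 2 psi^2 + 2 psi'^2 / psi]. *)
Definition square_terms k :=
  (D (dz k f) - psi * (D h * dz k h)) * (Db (dzb k f) - psi * (Db h * dzb k h)) +
  (D (dzb k f) - psi * (D h * dzb k h)) * (Db (dz k f) - psi * (Db h * dz k h)) +
  psi * ((D (dz k h) + 2 * h * psi * (D h * dz k h)) *
         (Db (dzb k h) + 2 * h * psi * (Db h * dzb k h))) +
  psi * ((D (dzb k h) + 2 * h * psi * (D h * dzb k h)) *
         (Db (dz k h) + 2 * h * psi * (Db h * dz k h))).

Lemma ev_square_terms k : ev (square_terms k) =
  (ev (D (dz k f)) - ev psi * (ev (D h) * ev (dz k h))) *
    (ev (Db (dzb k f)) - ev psi * (ev (Db h) * ev (dzb k h))) +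
  (ev (D (dzb k f)) - ev psi * (ev (D h) * ev (dzb k h))) *
    (ev (Db (dz k f)) - ev psi * (ev (Db h) * ev (dz k h))) +
  ev psi * ((ev (D (dz k h)) + 2 * ev h * ev psi * (ev (D h) * ev (dz k h))) *
    (ev (Db (dzb k h)) + 2 * ev h * ev psi * (ev (Db h) * ev (dzb k h)))) +
  ev psi * ((ev (D (dzb k h)) + 2 * ev h * ev psi * (ev (D h) * ev (dzb k h))) *
    (ev (Db (dz k h)) + 2 * ev h * ev psi * (ev (Db h) * ev (dz k h)))).
Proof.
by rewrite /square_terms !(rmorphD, rmorphB, rmorphM)/= ?rmorph1; ring.
Qed.

(* [Q = N(V, Vbar)] at a point where [g = delta] and [dg = 0]; [D] and [Db] are
   the derivatives along [V] and [Vbar] with constant coefficients. *)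
Lemma evolution_identity :
  ev (dt Q) = \sum_k (ev (dz k (dzb k Q)) + ev (dz k f) * ev (dzb k Q)
                       + ev (dzb k f) * ev (dz k Q))
    - \sum_k \sum_l ev (D (Db (G l k))) * ev (Xf k l)
    - ev chi * \sum_k ev (dz k (dzb k GV))
    + ev (dt chi * GV) + ev (a * D (Db f))
    - ev (2 * a * psi * (D h * Db h) * (1 + psi * l))
    + \sum_k ev (square_terms k).
Proof.
have ef : ev (D (Db (dt f))) = \sum_k ev (D (Db (Xf k k)))
    - \sum_k \sum_l ev (D (Db (G l k))) * ev (Xf k l) + ev (a * D (Db f)).
  rewrite heat_f !drvD !rmorphD/= ev_deriv2_trace; congr (_ + _).
  by rewrite dfunM dba mul0r add0r dfunM dta mul0r add0r.
have eh : ev (dt h) = \sum_k ev (Xh k k) + ev (a * (h * l)).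
  by rewrite heat_h rmorphD/= ev_trace.
have eDh : ev (D (dt h)) = \sum_k ev (D (Xh k k)) + ev (a * (D h * (1 + l))).
  rewrite heat_h !drvD !rmorphD/= ev_deriv_trace//; congr (_ + _).
  by rewrite dfunM dta mul0r add0r dfunM Dl; congr (ev _); ring.
have eDbh : ev (Db (dt h)) = \sum_k ev (Db (Xh k k)) + ev (a * (Db h * (1 + l))).
  rewrite heat_h !drvD !rmorphD/= ev_deriv_trace//; congr (_ + _).
  by rewrite dfunM dba mul0r add0r dfunM Dbl; congr (ev _); ring.
have dtQ : ev (dt Q) = ev (D (Db (dt f))) + ev (dt chi * GV)
    - ev psi * (ev (D (dt h)) * ev (Db h) + ev (D h) * ev (Db (dt h)))
    - ev (2 * h * psi ^+ 2 * (D h * Db h)) * ev (dt h).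
  rewrite /Q !drvD drvN !dfunM tGV mulr0 addr0 comm_tD !comm_tDb comm_tD.
  by rewrite deriv_psi; rewrite !(rmorphB, rmorphD, rmorphM)/=; ring.
rewrite dtQ ef eh eDh eDbh.
(* All traces are now sums over [k], and the two sides agree summand by summand: [T1] comes from the
   time derivative, [T2] from the space operator and the squares. *)
pose T1 k := ev (D (Db (Xf k k))) - ev psi * (ev (D (Xh k k)) * ev (Db h) + ev (D h) * ev (Db (Xh k k)))
    - ev (2 * h * psi ^+ 2 * (D h * Db h)) * ev (Xh k k).
pose T2 k := ev (dz k (dzb k Q)) + ev (dz k f) * ev (dzb k Q) + ev (dzb k f) * ev (dz k Q)
   - ev chi * ev (dz k (dzb k GV)) + ev (square_terms k).
have key k : T1 k = T2 k.
  rewrite /T1 /T2 /Xf /Xh /square_terms.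
  have zbQ : dzb k Q = D (Db (dzb k f)) + chi * dzb k GV
      - (2 * h * psi ^+ 2 * dzb k h * (D h * Db h)
         + psi * (D (dzb k h) * Db h + D h * Db (dzb k h))).
    by rewrite /Q !drvD drvN !dfunM zbchi mul0r add0r deriv_psi !comm_Dzb !comm_Dbzb.
  have zQ : dz k Q = D (Db (dz k f)) + chi * dz k GV
      - (2 * h * psi ^+ 2 * dz k h * (D h * Db h)
         + psi * (D (dz k h) * Db h + D h * Db (dz k h))).
    by rewrite /Q !drvD drvN !dfunM zchi mul0r add0r deriv_psi !comm_Dz !comm_Dbz.
  (* The coefficient [2 psi^2 + 8 h^2 psi^3] is the second derivative of [psi] with respect to
     [h]. *)
  have zzbQ : ev (dz k (dzb k Q)) = ev (D (Db (dz k (dzb k f)))) + ev chi * ev (dz k (dzb k GV))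
     - ev ((2 * dz k h * psi ^+ 2 + 8 * h * h * psi ^+ 3 * dz k h) * dzb k h * (D h * Db h)
       + 2 * h * psi ^+ 2 * dz k (dzb k h) * (D h * Db h)
       + 2 * h * psi ^+ 2 * dzb k h * (D (dz k h) * Db h + D h * Db (dz k h))
       + 2 * h * psi ^+ 2 * dz k h * (D (dzb k h) * Db h + D h * Db (dzb k h))
       + psi * (D (dz k (dzb k h)) * Db h + D (dzb k h) * Db (dz k h)
              + D (dz k h) * Db (dzb k h) + D h * Db (dz k (dzb k h)))).
    rewrite zbQ -!rmorphM -rmorphD -rmorphB; congr (ev _).
    rewrite !drvD drvN !drvD !dfunM !drvD !dfunM zchi !comm_Dz !comm_Dbz !deriv_psi ?dfun_nat ?dfun1.
    ring.
  rewrite zzbQ zbQ zQ.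
  rewrite !drvD !dfunM !drvD !dfunM.
  rewrite !(rmorphB, rmorphD, rmorphM, rmorphXn)/= evzGV evzbGV ?rmorph_nat ?rmorph1.
  ring.
(* Since [psi * (h * h) = psi - 1], the contributions [1 + l] and [psi h^2 l] of the logarithmic
   source add up to [1 + psi l]. *)
have K : ev (a * D (Db f)) - ev psi * (ev (a * (D h * (1 + l))) * ev (Db h) +
    ev (D h) * ev (a * (Db h * (1 + l)))) - ev (2 * h * psi ^+ 2 * (D h * Db h)) * ev (a * (h * l)) =
    ev (a * D (Db f)) - ev (2 * a * psi * (D h * Db h) * (1 + psi * l)).
  rewrite -!(rmorphM, rmorphD, rmorphB)/=; congr (ev _).
  have -> : 1 + psi * l = 1 + l + (psi * (h * h)) * l.
    have -> : psi * (h * h) = psi - psi * (1 - h * h) by ring.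
    by rewrite psiE; ring.
  ring.
have S1 : \sum_k T1 k = \sum_k ev (D (Db (Xf k k))) - ev psi * ((\sum_k ev (D (Xh k k))) * ev (Db h)
     + ev (D h) * \sum_k ev (Db (Xh k k)))
    - ev (2 * h * psi ^+ 2 * (D h * Db h)) * \sum_k ev (Xh k k).
  by rewrite mulr_suml !mulr_sumr -big_split/= mulr_sumr -!sumrB.
have S2 : \sum_k T2 k = \sum_k (ev (dz k (dzb k Q)) + ev (dz k f) * ev (dzb k Q)
      + ev (dzb k f) * ev (dz k Q)) - ev chi * \sum_k ev (dz k (dzb k GV))
    + \sum_k ev (square_terms k).
  by rewrite mulr_sumr -sumrB -big_split.
have SE : \sum_k T1 k = \sum_k T2 k by apply: eq_bigr => k _; exact: key.
set M := \sum_k \sum_l _.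
transitivity (\sum_k T1 k - M + ev (dt chi * GV) +
  (ev (a * D (Db f)) - ev psi * (ev (a * (D h * (1 + l))) * ev (Db h) +
    ev (D h) * ev (a * (Db h * (1 + l)))) - ev (2 * h * psi ^+ 2 * (D h * Db h)) * ev (a * (h * l)))).
  by rewrite S1; ring.
by rewrite K SE S2; ring.
Qed.

End CoreIdentity.

(** * Hermitian forms *)

Section HermitianForms.
Context {R : realType} {n : nat}.
Local Notation C := R[i].
Implicit Types (S : 'M[C]_n) (u v w : 'rV[C]_n).

Definition psd S := forall v, 0 <= hform S v v.

Lemma hformE S v w : hform S v w = \sum_i v 0 i * \sum_j S i j * (w 0 j)^*.
Proof.
apply: eq_bigr => i _; rewrite mulr_sumr; apply: eq_bigr => j _.
by rewrite [_ * v 0 i]mulrC mulrA.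
Qed.

Lemma hformDl S u v w : hform S (u + v) w = hform S u w + hform S v w.
Proof.
rewrite /hform -big_split/=; apply: eq_bigr => i _.
by rewrite -big_split/=; apply: eq_bigr => j _; rewrite mxE; ring.
Qed.

Lemma hformDr S u v w : hform S w (u + v) = hform S w u + hform S w v.
Proof.
rewrite /hform -big_split/=; apply: eq_bigr => i _.
by rewrite -big_split/=; apply: eq_bigr => j _; rewrite mxE rmorphD/=; ring.
Qed.

Lemma hformZl S (a : C) v w : hform S (a *: v) w = a * hform S v w.
Proof.
rewrite /hform mulr_sumr; apply: eq_bigr => i _.
by rewrite mulr_sumr; apply: eq_bigr => j _; rewrite mxE; ring.
Qed.

Lemma hformZr S (a : C) v w : hform S v (a *: w) = a^* * hform S v w.
Proof.
rewrite /hform mulr_sumr; apply: eq_bigr => i _.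
by rewrite mulr_sumr; apply: eq_bigr => j _; rewrite mxE rmorphM/=; ring.
Qed.

Lemma hform_add S S' v w : hform (S + S') v w = hform S v w + hform S' v w.
Proof.
rewrite /hform -big_split/=; apply: eq_bigr => i _.
by rewrite -big_split/=; apply: eq_bigr => j _; rewrite mxE; ring.
Qed.

Lemma hform_scale (a : C) S v w : hform (a *: S) v w = a * hform S v w.
Proof.
rewrite /hform mulr_sumr; apply: eq_bigr => i _.
by rewrite mulr_sumr; apply: eq_bigr => j _; rewrite mxE; ring.
Qed.

Lemma hform_delta S i j : hform S (delta_mx 0 i) (delta_mx 0 j) = S i j.
Proof.
rewrite /hform (bigD1 i)//= [X in _ + X]big1 ?addr0; last first.
  move=> k ki; rewrite big1// => l _.
  by rewrite [delta_mx 0 i 0 k]mxE (negbTE ki) andbF mulr0 mul0r.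
rewrite (bigD1 j)//= big1 ?addr0; last first.
  by move=> k ki; rewrite [delta_mx 0 j 0 k]mxE (negbTE ki) andbF rmorph0 mulr0.
by rewrite !mxE !eqxx mulr1 rmorph1 mulr1.
Qed.

Lemma posdef_psd S : posdef S -> psd S.
Proof.
move=> pS v; have [->|/pS/ltW//] := eqVneq v 0.
by rewrite /hform big1// => i _; rewrite big1// => j _; rewrite mxE mulr0 mul0r.
Qed.

(** Polarisation: [S(a v + w, a v + w)] is real for [a = 1] and for [a = i], and these two
    conditions determine the conjugate of [S(v, w)]. *)
Lemma psd_hform_conj S v w : psd S -> hform S w v = (hform S v w)^*.
Proof.
move=> pS.
have re (a : C) : (a * hform S v w + a^* * hform S w v)^* =
    a * hform S v w + a^* * hform S w v.
  apply: CrealP.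
  have -> : a * hform S v w + a^* * hform S w v =
    hform S (a *: v + w) (a *: v + w) - hform S (a *: v) (a *: v) - hform S w w.
    by rewrite !hformDl !hformDr !hformZl !hformZr; ring.
  by rewrite !realB// ger0_real// pS.
have [I [I0 cI]] : exists I : C, I != 0 /\ I^* = - I.
  exists (0 +i* 1); split; first by rewrite eq_complex/= oner_eq0 andbF.
  by apply: complex_ext; rewrite /= ?oppr0.
move: (re 1) (re I); rewrite !mul1r rmorph1 !mul1r cI.
set x := hform S v w; set y := hform S w v => e2 e1.
rewrite !rmorphD/= in e2; rewrite !rmorphD/= !rmorphM/= !rmorphN/= cI in e1.
have {}e1 : y^* - x^* = x - y.
  apply: (mulfI I0); transitivity (- I * x^* + - - I * y^*); first by ring.
  by rewrite e1; ring.
have : 2 * y = 2 * x^*.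
  have -> : 2 * y = (x + y) - (x - y) by ring.
  by rewrite -e1 -e2; ring.
by apply: mulfI; rewrite pnatr_eq0.
Qed.

Lemma psd_hermitian S i j : psd S -> S j i = (S i j)^*.
Proof. by move=> pS; rewrite -!hform_delta psd_hform_conj. Qed.

Lemma hform_conj S v w : (forall i j, S j i = (S i j)^*) -> hform S w v = (hform S v w)^*.
Proof.
move=> hS; rewrite /hform exchange_big rmorph_sum; apply: eq_bigr => i _.
rewrite rmorph_sum; apply: eq_bigr => j _.
by rewrite !rmorphM/= conjCK hS; ring.
Qed.

(** Spectral theorem, with the square roots of the eigenvalues absorbed into [B]. It writes the form
    as a sum of rank-one forms, which is how a curvature contraction with [N] gets its sign. *)
Lemma psd_decomposition S : psd S ->
  exists B : 'M[C]_n, forall i j, S i j = \sum_m B i m * (B j m)^*.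
Proof.
move=> pS; have hS : S \is hermsymmx.
  apply/is_hermitianmxP; rewrite expr0 scale1r; apply/matrixP => i j.
  by rewrite !mxE (psd_hermitian j i pS).
have /orthomx_spectralP := hermitian_normalmx hS.
set P := spectralmx S; set d := spectral_diag S => SE.
have uP : P \is unitarymx by exact: spectral_unitarymx.
have SE' i j : S i j = \sum_m (P m i)^* * d 0 m * P m j.
  rewrite SE invmx_unitary// mxE; apply: eq_bigr => m _; congr (_ * _).
  by rewrite mul_mx_diag !mxE.
have PP i j : \sum_k P i k * (P j k)^* = (i == j)%:R.
  have /unitarymxP/matrixP/(_ i j) := uP; rewrite !mxE => <-.
  by apply: eq_bigr => k _; rewrite !mxE.
(* The eigenvalue [d 0 m] is the value of the form at row [m] of the unitary matrix [P]. *)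
have d0 m : 0 <= d 0 m.
  have col i : \sum_j S i j * (row m P 0 j)^* = (P m i)^* * d 0 m.
    under eq_bigr => j _ do rewrite SE' mulr_suml mxE.
    rewrite exchange_big/=.
    under eq_bigr => k _.
      rewrite (_ : \sum_j _ = (P k i)^* * d 0 k * \sum_j P k j * (P m j)^*); last first.
        by rewrite mulr_sumr; apply: eq_bigr => j _; ring.
      rewrite PP.
      over.
    rewrite (bigD1 m)//= big1 ?addr0 ?eqxx ?mulr1// => k km.
    by rewrite (negbTE km) mulr0.
  have := pS (row m P); rewrite hformE.
  under eq_bigr => i _ do rewrite col mxE mulrA.
  by rewrite -mulr_suml PP eqxx mul1r.
exists (\matrix_(i, m) ((P m i)^* * sqrtC (d 0 m))) => i j.
rewrite SE'; apply: eq_bigr => m _; rewrite !mxE rmorphM/= conjCK.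
have sr : (sqrtC (d 0 m))^* = sqrtC (d 0 m).
  by apply/CrealP/ger0_real; rewrite sqrtC_ge0.
by rewrite sr -{1}[d 0 m]sqrtCK expr2; ring.
Qed.

Lemma hform_decomposition S (B : 'M[C]_n) v w :
  (forall i j, S i j = \sum_m B i m * (B j m)^*) ->
  hform S v w = \sum_m (\sum_i B i m * v 0 i) * (\sum_j B j m * w 0 j)^*.
Proof.
move=> SB; rewrite /hform.
under eq_bigr => i _ do under eq_bigr => j _ do rewrite SB -mulrA mulr_suml.
under eq_bigr => i _ do rewrite exchange_big/=.
rewrite exchange_big/=; apply: eq_bigr => m _.
rewrite mulr_suml; apply: eq_bigr => i _.
rewrite rmorph_sum mulr_sumr; apply: eq_bigr => j _.
by rewrite rmorphM/=; ring.
Qed.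

(** [S(v, v)] is a sum of squared moduli of the entries of [v B], so its vanishing kills every
    entry, and with them [S(v, w)] for all [w]. *)
Lemma psd_null S v w : psd S -> hform S v v = 0 -> hform S v w = 0.
Proof.
move=> pS; have [B SB] := psd_decomposition pS.
rewrite !(hform_decomposition _ _ SB) => /eqP.
rewrite psumr_eq0; last by move=> m _; exact: mul_conjC_ge0.
move=> /allP B0; rewrite big1// => m _.
have := B0 m (mem_index_enum _); rewrite mul_conjC_eq0 => /eqP ->.
by rewrite mul0r.
Qed.

Lemma hform_mulmx S v w : hform S v w = \sum_j (v *m S) 0 j * (w 0 j)^*.
Proof.
rewrite /hform exchange_big/=; apply: eq_bigr => j _.
by rewrite mxE mulr_suml; apply: eq_bigr => i _; ring.
Qed.

Lemma posdef_unit S : posdef S -> S \in unitmx.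
Proof.
move=> pS; rewrite -row_free_unit -kermx_eq0; apply/rowV0P => v /sub_kermxP vS.
apply/eqP; apply: contraT => /pS; rewrite hform_mulmx vS.
by rewrite big1 ?ltxx// => j _; rewrite mxE mul0r.
Qed.

Lemma posdef_decomposition S : posdef S ->
  exists2 B : 'M[C]_n, B \in unitmx & forall i j, S i j = \sum_m B i m * (B j m)^*.
Proof.
move=> pS; have [B SB] := psd_decomposition (posdef_psd pS); exists B => //.
have : S = B *m (\matrix_(i, j) (B j i)^*).
  by apply/matrixP => i j; rewrite SB mxE; apply: eq_bigr => m _; rewrite !mxE.
by move=> SE; have := posdef_unit pS; rewrite SE unitmx_mul => /andP[].
Qed.

(** The inverse transpose of the factor [B] of [S] is a unitary frame for [S]; it becomes the linear
    part of the normal chart. *)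
Lemma posdef_frame S : posdef S -> exists2 A : 'M[C]_n, A \in unitmx &
  forall k l, \sum_p \sum_q S p q * A p k * (A q l)^* = (k == l)%:R.
Proof.
move=> pS; have [B uB SB] := posdef_decomposition pS.
exists ((invmx B)^T); first by rewrite unitmx_tr unitmx_inv.
move=> k l.
have BB m j : \sum_i B i m * (invmx B) j i = (j == m)%:R.
  have := congr1 (fun X : 'M[C]_n => X j m) (mulVmx uB); rewrite !mxE => <-.
  by apply: eq_bigr => i _; rewrite mulrC.
have := hform_decomposition (row k (invmx B)) (row l (invmx B)) SB.
rewrite /hform; under eq_bigr => i _ do under eq_bigr => j _ do rewrite !mxE.
under [RHS]eq_bigr => m _ do under eq_bigr => i _ do rewrite mxE.
under [RHS]eq_bigr => m _.
  rewrite BB; under [X in _ * X^*]eq_bigr => j _ do rewrite mxE.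
  rewrite BB; over.
move=> e; transitivity (\sum_i \sum_j S i j * invmx B k i * (invmx B l j)^*).
  by apply: eq_bigr => i _; apply: eq_bigr => j _; rewrite !mxE.
rewrite e (bigD1 k)//= eqxx mul1r big1 ?addr0; last first.
  by move=> m /negbTE; rewrite eq_sym => ->; rewrite mul0r.
by rewrite rmorph_nat eq_sym.
Qed.

Lemma hform_real S v : (forall i j, S j i = (S i j)^*) -> hform S v v \is Num.real.
Proof. by move=> hS; apply/CrealP; rewrite -hform_conj. Qed.

(** Put [r^2 = S(v, v)]. Every entry of [v B] is at most [r], so every entry of [v] is at most
    [r kap], where [kap] sums the moduli of the entries of [B^-1]. A perturbation of size [e] then
    changes the form by at most [n^2 e kap^2 r^2]. *)
Lemma posdef_open S : posdef S -> exists2 e : R, 0 < e &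
  forall S', (forall i j, S' j i = (S' i j)^*) ->
    (forall i j, `|S' i j - S i j| <= e%:C) -> posdef S'.
Proof.
move=> pS; have [B uB SB] := posdef_decomposition pS.
set kap : C := \sum_m \sum_i `|invmx B m i|.
have kap0 : 0 <= kap by apply: sumr_ge0 => m _; apply: sumr_ge0.
pose k : R := complex.Re kap.
have kE : kap = k%:C.
  by apply: complex_ext => //=; apply/eqP; move: kap0; rewrite lecE => /andP[/eqP->].
pose N : R := (n * n)%:R.
(* This value makes [N * k ^+ 2 * e] strictly less than 1, also when [k] is zero. *)
exists ((N * k ^+ 2 + 1)^-1).
  by rewrite invr_gt0 ltr_wpDl// mulr_ge0 ?ler0n ?sqr_ge0.
set e := (N * k ^+ 2 + 1)^-1.
move=> S' hS' S'S v v0.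
have M0 := pS v v0; set M := hform S v v in M0 *.
have ME : M = \sum_m `|(v *m B) 0 m| ^+ 2.
  rewrite /M (hform_decomposition _ _ SB); apply: eq_bigr => m _.
  rewrite normCK [(v *m B) 0 m]mxE.
  by congr (_ * _^*); apply: eq_bigr => i _; rewrite mulrC.
pose r := sqrtC M.
have r0 : 0 <= r by rewrite sqrtC_ge0 ltW.
have wr m : `|(v *m B) 0 m| <= r.
  rewrite -(@ler_pXn2r _ 2)// ?nnegrE// sqrtCK ME (bigD1 m)//= lerDl.
  by apply: sumr_ge0 => i _; rewrite exprn_ge0.
have vr i : `|v 0 i| <= r * kap.
  have -> : v 0 i = \sum_m (v *m B) 0 m * invmx B m i.
    by rewrite -[v in LHS](mulmxK uB) mxE.
  apply: le_trans (ler_norm_sum _ _ _) _.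
  rewrite /kap mulr_sumr; apply: ler_sum => m _; rewrite normrM.
  apply: ler_pM => //.
  by rewrite (bigD1 i)//= lerDl; apply: sumr_ge0.
have e0 : 0 <= e%:C :> C by rewrite ler0c invr_ge0 ltW// ltr_wpDl// mulr_ge0 ?ler0n ?sqr_ge0.
have EM : `|hform (S' - S) v v| < M.
  apply: (@le_lt_trans _ _ (\sum_(i < n) \sum_(j < n) e%:C * (r * kap) * (r * kap))).
    apply: le_trans (ler_norm_sum _ _ _) _; apply: ler_sum => i _.
    apply: le_trans (ler_norm_sum _ _ _) _; apply: ler_sum => j _.
    rewrite !normrM norm_conjC; apply: ler_pM; rewrite ?mulr_ge0//.
    apply: ler_pM => //; have := S'S i j.
    by rewrite !mxE.
  rewrite !sumr_const !card_ord -mulrnA.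
  have -> : e%:C * (r * kap) * (r * kap) = (e * k ^+ 2)%:C * M.
    rewrite -[M]sqrtCK -/r kE rmorphM rmorphXn/=; ring.
  rewrite -mulr_natl mulrA -[X in _ < X]mul1r ltr_pM2r//.
  rewrite -(rmorph_nat (real_complex R)) -rmorphM -(rmorph1 (real_complex R)) ltcR.
  rewrite -/N mulrCA mulrC ltr_pdivrMr ?mul1r ?ltrDl//.
  by rewrite ltr_wpDl// mulr_ge0 ?ler0n ?sqr_ge0.
have rE : hform (S' - S) v v \is Num.real.
  by apply: hform_real => i j; rewrite !mxE hS' (psd_hermitian i j (posdef_psd pS)) rmorphB.
have -> : S' = S + (S' - S) by rewrite addrC subrK.
rewrite hform_add -/M; move: EM; rewrite real_ltr_norml// => /andP[+ _].
by rewrite ltrNl -subr_gt0 opprK.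
Qed.

End HermitianForms.

(** * Wirtinger operators on space-time *)

Definition spacetime (R : realType) n : normedModType R := (Cn R n * R^o)%type.

Section ComplexCoordinates.
Context {S : comNzRingType} (a b x y : S).
Hypothesis a2 : a + a = 1.
Hypothesis b2 : b * b = -1.

Lemma half_sum : x = a * (x + - b * y) + a * (x + b * y).
Proof. by rewrite -[LHS]mul1r -a2; ring. Qed.

Lemma half_diff : y = b * (a * (x + - b * y) - a * (x + b * y)).
Proof.
transitivity (- (b * b) * (a + a) * y); first by rewrite b2 a2 opprK !mul1r.
by ring.
Qed.

End ComplexCoordinates.

Section Spacetime.
Context {R : realType} {n : nat}.
Local Notation E := (spacetime R n).
Implicit Types (W : domain E) (k l : 'I_n).

Definition ex k : E := ((delta_mx 0 k, 0), 0).
Definition ey k : E := ((0, delta_mx 0 k), 0).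
Definition et : E := (0, 1).

Definition imagC : R[i] := 0 +i* 1.

End Spacetime.

HB.lock Definition dzs (R : realType) (n : nat) (W : domain (spacetime R n)) (k : 'I_n) :
    derivation (smf W) :=
  drv_scale (sconst 2^-1) (drv_add (sder (ex k)) (drv_scale (sconst (- imagC)) (sder (ey k)))).
HB.lock Definition dzbs (R : realType) (n : nat) (W : domain (spacetime R n)) (k : 'I_n) :
    derivation (smf W) :=
  drv_scale (sconst 2^-1) (drv_add (sder (ex k)) (drv_scale (sconst imagC) (sder (ey k)))).
HB.lock Definition dts (R : realType) (n : nat) (W : domain (spacetime R n)) :
    derivation (smf W) := sder (@et R n).
HB.lock Definition dvec (R : realType) (n : nat) (W : domain (spacetime R n))
    (V : 'rV[R[i]]_n) : derivation (smf W) :=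
  drv_sum (fun k => drv_scale (sconst (V 0 k)) (dzs W k)).
HB.lock Definition dvecb (R : realType) (n : nat) (W : domain (spacetime R n))
    (V : 'rV[R[i]]_n) : derivation (smf W) :=
  drv_sum (fun k => drv_scale (sconst (V 0 k)^*) (dzbs W k)).
Arguments dzs {R n W} k.
Arguments dzbs {R n W} k.
Arguments dts {R n W}.
Arguments dvec {R n W} V.
Arguments dvecb {R n W} V.

Section Wirtinger.
Context {R : realType} {n : nat}.
Local Notation E := (spacetime R n).
Implicit Types (k l : 'I_n).

Section Operators.
Context {W : domain E}.
Implicit Types f g : smf W.

Lemma dzsE k f : dzs k f = sconst 2^-1 * (sder (ex k) f + sconst (- imagC) * sder (ey k) f).
Proof. by rewrite dzs.unlock. Qed.
Lemma dzbsE k f : dzbs k f = sconst 2^-1 * (sder (ex k) f + sconst imagC * sder (ey k) f).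
Proof. by rewrite dzbs.unlock. Qed.

Lemma dtsE f : dts f = sder et f.
Proof. by rewrite dts.unlock. Qed.

Definition commuting (d d' : derivation (smf W)) := forall f, d (d' f) = d' (d f).
Definition kills_const (d : derivation (smf W)) := forall c, d (sconst c) = 0.

Lemma kills_sder w : kills_const (sder w). Proof. by move=> c; exact: sder_const. Qed.

Lemma kills_drv_add d d' : kills_const d -> kills_const d' -> kills_const (drv_add d d').
Proof. by move=> kd kd' c; rewrite /= kd kd' addr0. Qed.

Lemma kills_drv_scale s d : kills_const d -> kills_const (drv_scale s d).
Proof. by move=> kd c; rewrite /= kd mulr0. Qed.

Lemma kills_drv_sum m (d : 'I_m -> derivation (smf W)) :
  (forall i, kills_const (d i)) -> kills_const (drv_sum d).
Proof. by move=> kd c; rewrite /= big1// => i _; exact: kd. Qed.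

Lemma kills_dzs k : kills_const (dzs k).
Proof.
by rewrite dzs.unlock; apply/kills_drv_scale/kills_drv_add/kills_drv_scale; exact: kills_sder.
Qed.
Lemma kills_dzbs k : kills_const (dzbs k).
Proof.
by rewrite dzbs.unlock; apply/kills_drv_scale/kills_drv_add/kills_drv_scale; exact: kills_sder.
Qed.
Lemma kills_dts : kills_const (@dts R n W).
Proof. by rewrite dts.unlock; exact: kills_sder. Qed.
Lemma kills_dvec V : kills_const (dvec V).
Proof. by rewrite dvec.unlock; apply: kills_drv_sum => i; apply: kills_drv_scale; exact: kills_dzs. Qed.
Lemma kills_dvecb V : kills_const (dvecb V).
Proof. by rewrite dvecb.unlock; apply: kills_drv_sum => i; apply: kills_drv_scale; exact: kills_dzbs. Qed.

Lemma commuting_sym d d' : commuting d d' -> commuting d' d.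
Proof. by move=> c f; rewrite c. Qed.

Lemma commuting_sder v w : commuting (sder v) (sder w).
Proof. by move=> f; exact: sder_comm. Qed.

Lemma commuting_drv_add d d1 d2 : commuting d d1 -> commuting d d2 ->
  commuting d (drv_add d1 d2).
Proof. by move=> c1 c2 f; rewrite /= -c1 -c2; exact: raddfD. Qed.

Lemma commuting_drv_scale d d1 c : kills_const d -> commuting d d1 ->
  commuting d (drv_scale (sconst c) d1).
Proof. by move=> kd c1 f; rewrite /= dfunM kd mul0r add0r c1. Qed.

Lemma commuting_drv_sum m d (d1 : 'I_m -> derivation (smf W)) :
  (forall i, commuting d (d1 i)) -> commuting d (drv_sum d1).
Proof.
by move=> c1 f; rewrite /= raddf_sum; apply: eq_bigr => i _; exact: c1.
Qed.

Lemma commuting_dzs d k : kills_const d -> (forall w, commuting d (sder w)) ->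
  commuting d (dzs k).
Proof.
move=> kd cd; rewrite dzs.unlock; apply: commuting_drv_scale => //.
by apply: commuting_drv_add => //; exact: commuting_drv_scale.
Qed.

Lemma commuting_dzbs d k : kills_const d -> (forall w, commuting d (sder w)) ->
  commuting d (dzbs k).
Proof.
move=> kd cd; rewrite dzbs.unlock; apply: commuting_drv_scale => //.
by apply: commuting_drv_add => //; exact: commuting_drv_scale.
Qed.

Lemma commuting_sder_dzs w k : commuting (sder w) (dzs k).
Proof. by apply: commuting_dzs => [|w']; [exact: kills_sder|exact: commuting_sder]. Qed.

Lemma commuting_sder_dzbs w k : commuting (sder w) (dzbs k).
Proof. by apply: commuting_dzbs => [|w']; [exact: kills_sder|exact: commuting_sder]. Qed.

Lemma commuting_dvec d V : kills_const d -> (forall k, commuting d (dzs k)) ->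
  commuting d (dvec V).
Proof.
by move=> kd cd; rewrite dvec.unlock; apply: commuting_drv_sum => k; exact: commuting_drv_scale.
Qed.

Lemma commuting_dvecb d V : kills_const d -> (forall k, commuting d (dzbs k)) ->
  commuting d (dvecb V).
Proof.
by move=> kd cd; rewrite dvecb.unlock; apply: commuting_drv_sum => k; exact: commuting_drv_scale.
Qed.

Lemma comm_dzs_dzs k l : commuting (dzs k) (dzs l).
Proof.
apply: commuting_dzs => [|w]; first exact: kills_dzs.
exact/commuting_sym/commuting_sder_dzs.
Qed.

Lemma comm_dzs_dzbs k l : commuting (dzs k) (dzbs l).
Proof.
apply: commuting_dzbs => [|w]; first exact: kills_dzs.
exact/commuting_sym/commuting_sder_dzs.
Qed.

Lemma comm_dzbs_dzbs k l : commuting (dzbs k) (dzbs l).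
Proof.
apply: commuting_dzbs => [|w]; first exact: kills_dzbs.
exact/commuting_sym/commuting_sder_dzbs.
Qed.

Lemma comm_dzs_dvec k V : commuting (dzs k) (dvec V).
Proof. by apply: commuting_dvec => [|l]; [exact: kills_dzs|exact: comm_dzs_dzs]. Qed.
Lemma comm_dzbs_dvec k V : commuting (dzbs k) (dvec V).
Proof.
by apply: commuting_dvec => [|l]; [exact: kills_dzbs|exact/commuting_sym/comm_dzs_dzbs].
Qed.
Lemma comm_dzs_dvecb k V : commuting (dzs k) (dvecb V).
Proof. by apply: commuting_dvecb => [|l]; [exact: kills_dzs|exact: comm_dzs_dzbs]. Qed.
Lemma comm_dzbs_dvecb k V : commuting (dzbs k) (dvecb V).
Proof. by apply: commuting_dvecb => [|l]; [exact: kills_dzbs|exact: comm_dzbs_dzbs]. Qed.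
Lemma comm_dts_dvec V : commuting (@dts R n W) (dvec V).
Proof. by apply: commuting_dvec => [|l]; [exact: kills_dts|by rewrite dts.unlock; exact: commuting_sder_dzs]. Qed.
Lemma comm_dts_dvecb V : commuting (@dts R n W) (dvecb V).
Proof. by apply: commuting_dvecb => [|l]; [exact: kills_dts|by rewrite dts.unlock; exact: commuting_sder_dzbs]. Qed.

Lemma conj_imagC : (imagC^*)%R = - imagC :> R[i].
Proof. by apply: complex_ext => /=; rewrite ?oppr0. Qed.

Lemma conj_half : ((2^-1)^*)%R = 2^-1 :> R[i].
Proof. by rewrite fmorphV rmorph_nat. Qed.

Lemma dzbs_conj k f : dzbs k (sconj f) = sconj (dzs k f).
Proof.
rewrite dzsE dzbsE !sder_conj rmorphM rmorphD rmorphM/= !sconj_const.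
by rewrite conj_half rmorphN/= conj_imagC opprK.
Qed.

Lemma dzs_conj k f : dzs k (sconj f) = sconj (dzbs k f).
Proof. by rewrite -[f in RHS]sconjK dzbs_conj sconjK. Qed.

Lemma dts_conj f : dts (sconj f) = sconj (dts f).
Proof. by rewrite !dtsE sder_conj. Qed.

Lemma sconst_half : sconst 2^-1 + sconst 2^-1 = 1 :> smf W.
Proof.
rewrite -rmorphD/= -(rmorph1 (@sconst R E W)); congr sconst.
by rewrite -[LHS]mulr2n -[LHS]mulr_natl mulfV// pnatr_eq0.
Qed.

Lemma sconst_imagC : sconst imagC * sconst imagC = -1 :> smf W.
Proof.
rewrite -rmorphM -(rmorph1 (@sconst R E W)) -rmorphN; congr sconst.
by apply: complex_ext => /=; ring.
Qed.

Lemma sder_ex k f : sder (ex k) f = dzs k f + dzbs k f.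
Proof.
rewrite dzsE dzbsE rmorphN/=.
exact: (half_sum _ _ _ sconst_half).
Qed.

Lemma sder_ey k f : sder (ey k) f = sconst imagC * (dzs k f - dzbs k f).
Proof.
rewrite dzsE dzbsE rmorphN/=.
exact: (half_diff _ _ sconst_half sconst_imagC).
Qed.

Lemma dvecE V f : dvec V f = \sum_k sconst (V 0 k) * dzs k f.
Proof. by rewrite dvec.unlock. Qed.
Lemma dvecbE V f : dvecb V f = \sum_k sconst (V 0 k)^* * dzbs k f.
Proof. by rewrite dvecb.unlock. Qed.

Lemma dvecb_conj V f : dvecb V (sconj f) = sconj (dvec V f).
Proof.
rewrite dvecE dvecbE rmorph_sum; apply: eq_bigr => k _.
by rewrite dzbs_conj [RHS]rmorphM [X in _ = X * _]sconj_const.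
Qed.

End Operators.
End Wirtinger.

(** * Holomorphic changes of coordinates *)

Section Coordinates.
Context {R : realType} {n : nat}.
Local Notation E := (spacetime R n).

Definition coord_index := ('I_n + 'I_n + unit)%type.

Definition coord_vec (i : coord_index) : E :=
  match i with inl (inl k) => ex k | inl (inr k) => ey k | inr _ => et end.

Definition coord_fun (i : coord_index) (y : E) : R^o :=
  match i with inl (inl k) => y.1.1 0 k | inl (inr k) => y.1.2 0 k | inr _ => y.2 end.

Lemma fst_sum (A B : nmodType) (I : Type) (s : seq I) (F : I -> A * B) :
  (\sum_(i <- s) F i).1 = \sum_(i <- s) (F i).1.
Proof. by elim: s => [|i s IH]; rewrite ?big_nil// !big_cons -IH. Qed.

Lemma snd_sum (A B : nmodType) (I : Type) (s : seq I) (F : I -> A * B) :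
  (\sum_(i <- s) F i).2 = \sum_(i <- s) (F i).2.
Proof. by elim: s => [|i s IH]; rewrite ?big_nil// !big_cons -IH. Qed.

Lemma coord_sum_split (V : nmodType) (F : coord_index -> V) :
  \sum_i F i = \sum_k (F (inl (inl k)) + F (inl (inr k))) + F (inr tt).
Proof.
rewrite !big_sumType/= big_split/=; congr (_ + _).
by rewrite (bigD1 tt)//= big1 ?addr0// => -[].
Qed.

Lemma coord_sum (y : E) : y = \sum_i coord_fun i y *: coord_vec i.
Proof.
rewrite coord_sum_split/=.
have rowE (w : 'rV[R]_n) : w = \sum_k w 0 k *: delta_mx 0 k by exact: row_sum_delta.
case: y => [[a b] t]; congr ((_, _), _) => /=.
- rewrite fst_sum fst_sum/= scaler0 addr0 [LHS]rowE.
  by apply: eq_bigr => k _; rewrite scaler0 addr0.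
- rewrite fst_sum snd_sum/= scaler0 addr0 [LHS]rowE.
  by apply: eq_bigr => k _; rewrite scaler0 add0r.
rewrite snd_sum/= big1 ?add0r; last by move=> k _; rewrite !scaler0 addr0.
by rewrite [RHS]mulr1.
Qed.

Definition coord_linear_axiom (i : coord_index) : linear (coord_fun i).
Proof. by case: i => [[k|k]|u] a x y; rewrite /coord_fun/= ?mxE. Qed.

Lemma continuous_coord i : continuous (coord_fun i).
Proof.
case: i => [[k|k]|u] y /=.
- apply: (@continuous_comp _ _ _ (fun y : E => y.1.1) (fun w : 'rV[R]_n => w 0 k)).
    by apply: (@continuous_comp _ _ _ (fun y : E => y.1) fst); apply: cvg_fst.
  exact: coord_continuous.
- apply: (@continuous_comp _ _ _ (fun y : E => y.1.2) (fun w : 'rV[R]_n => w 0 k)).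
    by apply: (@continuous_comp _ _ _ (fun y : E => y.1) snd); [apply: cvg_fst|apply: cvg_snd].
  exact: coord_continuous.
exact: cvg_snd.
Qed.

Lemma smooth_coord U i : smooth U (coord_fun i).
Proof.
pose f : {linear E -> R^o} := HB.pack (coord_fun i)
  (GRing.isLinear.Build R E R^o _ (coord_fun i) (@coord_linear_axiom i)).
exact: (@smooth_linear R E U f (@continuous_coord i)).
Qed.

End Coordinates.

(** * Pullback along maps that keep the time coordinate *)

Section Pullback.
Context {R : realType} {n : nat}.
Local Notation E := (spacetime R n).
Variables (W W' : domain E) (P : 'I_n -> smf W').

Definition hmap (p : E) : E :=
  ((\row_k complex.Re (P k p), \row_k complex.Im (P k p)), p.2).

Hypothesis hmapW : forall p, W' p -> W (hmap p).

Lemma smooth_coord_hmap i : smooth W' (coord_fun i \o hmap).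
Proof.
have oW := dset_open W'.
case: i => [[k|k]|u].
- apply: (smooth_ext oW) (smf_smooth (P k)).1 => p _.
  by rewrite /= mxE.
- apply: (smooth_ext oW) (smf_smooth (P k)).2 => p _.
  by rewrite /= mxE.
by apply: (smooth_ext oW) (@smooth_coord R n W' (inr tt)) => p _.
Qed.

Lemma smoothC_hmap (f : smf W) : smoothC W' (f \o hmap).
Proof.
have [sr si] := smf_smooth f.
split=> k.
  exact: (@Ck_comp R E E coord_index coord_vec coord_fun coord_sum k W' W hmap
    (fun x => complex.Re (f x)) (dset_open W') (dset_open W) hmapW smooth_coord_hmap (sr k)).
exact: (@Ck_comp R E E coord_index coord_vec coord_fun coord_sum k W' W hmap
  (fun x => complex.Im (f x)) (dset_open W') (dset_open W) hmapW smooth_coord_hmap (si k)).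
Qed.

(** Going through an opaque witness keeps conversion from unfolding [pull], as with the locked ring
    operations. *)
Fact pull_subproof (f : smf W) : {r : smf W' | r = mkS (smoothC_hmap f)}.
Proof. by eexists. Qed.
Definition pull (f : smf W) : smf W' := sval (pull_subproof f).

Lemma ev_pull p (Wp : W' p) f : ev Wp (pull f) = ev (hmapW Wp) f.
Proof. by rewrite /pull (svalP (pull_subproof _)); exact: mkSE. Qed.

Fact pull_is_additive : zmod_morphism pull.
Proof.
move=> f g; apply: evP => p Wp; rewrite [LHS]ev_pull [LHS]rmorphB [RHS]rmorphB.
by congr (_ - _); rewrite [RHS]ev_pull.
Qed.
Fact pull_is_multiplicative : monoid_morphism pull.
Proof.
split=> [|f g]; apply: evP => p Wp; first by rewrite [LHS]ev_pull !rmorph1.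
rewrite [LHS]ev_pull [LHS]rmorphM [RHS]rmorphM.
by congr (_ * _); rewrite [RHS]ev_pull.
Qed.
HB.instance Definition _ := GRing.isZmodMorphism.Build (smf W) (smf W') pull pull_is_additive.
HB.instance Definition _ := GRing.isMonoidMorphism.Build (smf W) (smf W') pull pull_is_multiplicative.

Lemma pull_conj f : pull (sconj f) = sconj (pull f).
Proof. by apply: evP => p Wp; rewrite [LHS]ev_pull ev_sconj [RHS]ev_sconj [in RHS]ev_pull. Qed.

Lemma pull_const c : pull (sconst c) = sconst c.
Proof. by apply: evP => p Wp; rewrite [LHS]ev_pull ev_sconst [RHS]ev_sconst. Qed.

Lemma cderiv_hmap w p (Wp : W' p) (f : smf W) :
  cderiv w (f \o hmap) p =
  \sum_(i : coord_index) ('D_w (coord_fun i \o hmap) p)%:C * cderiv (coord_vec i) f (hmap p).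
Proof.
have Wh := hmapW Wp.
have dc i : derivable (coord_fun i \o hmap) p w.
  exact: smooth_derivable (smooth_coord_hmap i) Wp.
have [sr si] := smf_smooth f.
have [_ r2] := @is_derive_comp_coord R E E _ _ _ coord_sum _ hmap _ p w (dset_open W) Wh (sr 1%N) dc.
have [_ i2] := @is_derive_comp_coord R E E _ _ _ coord_sum _ hmap _ p w (dset_open W) Wh (si 1%N) dc.
apply: complex_ext.
  rewrite [LHS]r2 (raddf_sum (@complex.Re R : Rcomplex R -> R))/=.
  by apply: eq_bigr => i _; rewrite mul0r subr0.
rewrite [LHS]i2 (raddf_sum (@complex.Im R : Rcomplex R -> R))/=.
by apply: eq_bigr => i _; rewrite mul0r addr0.
Qed.

Lemma sder_pull (w : E) (f : smf W) : sder w (pull f) =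
  \sum_k (sder w (P k) * pull (dzs k f) + sder w (sconj (P k)) * pull (dzbs k f))
  + sconst (w.2 : R)%:C * pull (dts f).
Proof.
apply: evP => p Wp; rewrite [LHS](ev_sder Wp).
transitivity (cderiv w (f \o hmap) p).
  by apply: (cderiv_ext _ (dset_open W') Wp) => q Wq; exact: (ev_pull Wq f).
rewrite (cderiv_hmap w Wp f) coord_sum_split evD; congr (_ + _); last first.
  rewrite evM ev_sconst ev_pull dtsE ev_sder; congr (_%:C * _).
  pose g : {linear E -> R^o} := HB.pack (@coord_fun R n (inr tt))
    (GRing.isLinear.Build R E R^o _ _ (@coord_linear_axiom R n (inr tt))).
  have dg : differentiable g p by apply: linear_differentiable; exact: continuous_coord.
  rewrite -[LHS]/('D_w g p) deriveE// diff_lin//; exact: continuous_coord.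
rewrite ev_sum; apply: eq_bigr => k _.
rewrite evD !evM !ev_pull sder_conj ev_sconj.
have xE : cderiv (ex k) f (hmap p) = ev (hmapW Wp) (dzs k f) + ev (hmapW Wp) (dzbs k f).
  by rewrite -evD -sder_ex; exact/esym/ev_sder.
have yE : cderiv (ey k) f (hmap p) =
    imagC * (ev (hmapW Wp) (dzs k f) - ev (hmapW Wp) (dzbs k f)).
  by rewrite -evB -(ev_sconst (hmapW Wp) imagC) -evM -sder_ey; exact/esym/ev_sder.
rewrite /coord_vec xE yE; move: (ev _ (dzs k f)) (ev _ (dzbs k f)) => A B.
have rE : 'D_w (@coord_fun R n (inl (inl k)) \o hmap) p = complex.Re (ev Wp (sder w (P k))).
  rewrite (ev_sder Wp) /=; congr (derive _ p w).
  by apply/funext => q; rewrite /= mxE.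
have iE : 'D_w (@coord_fun R n (inl (inr k)) \o hmap) p = complex.Im (ev Wp (sder w (P k))).
  rewrite (ev_sder Wp) /=; congr (derive _ p w).
  by apply/funext => q; rewrite /= mxE.
rewrite rE iE; move: (ev Wp (sder w (P k))) => z.
(* Here [z] is the derivative of [P k]; the claim is [Re z (A + B) + i Im z (A - B) = z A + zbar
   B]. *)
transitivity ((complex.Re z)%:C * (A + B) + imagC * (complex.Im z)%:C * (A - B)); first by ring.
have -> : z^* = (complex.Re z)%:C - imagC * (complex.Im z)%:C.
  by case: z => x y; apply: complex_ext => /=; ring.
have {3}-> : z = (complex.Re z)%:C + imagC * (complex.Im z)%:C.
  by case: z => x y; apply: complex_ext => /=; ring.
by ring.
Qed.

Hypothesis holP : forall k l, dzbs l (P k) = 0.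
Hypothesis stP : forall k, dts (P k) = 0.

Lemma dts_pull (f : smf W) : dts (pull f) = pull (dts f).
Proof.
rewrite dtsE sder_pull big1 ?add0r; last first.
  move=> k _; have := stP k; rewrite dtsE => e.
  by rewrite sder_conj e rmorph0 !mul0r addr0.
by rewrite rmorph1 mul1r.
Qed.

Lemma wirtinger_sum (S : comNzRingType) (h i : S) (d1 d2 : S) (F1 F2 : 'I_n -> S) :
  d1 = \sum_k F1 k -> d2 = \sum_k F2 k ->
  h * (d1 + i * d2) = \sum_k h * (F1 k + i * F2 k).
Proof. by move=> -> ->; rewrite mulr_sumr -big_split/= mulr_sumr. Qed.

Lemma wirtinger_term (S : comNzRingType) (h i a1 a2 b1 b2 A B : S) :
  h * (a1 * A + b1 * B + i * (a2 * A + b2 * B)) =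
  h * (a1 + i * a2) * A + h * (b1 + i * b2) * B.
Proof. by ring. Qed.

Lemma sder_pull_space (w : E) (f : smf W) : w.2 = 0 -> sder w (pull f) =
  \sum_k (sder w (P k) * pull (dzs k f) + sder w (sconj (P k)) * pull (dzbs k f)).
Proof. by move=> w0; rewrite sder_pull w0 rmorph0 mul0r addr0. Qed.

Lemma dzs_pull l (f : smf W) : dzs l (pull f) = \sum_k dzs l (P k) * pull (dzs k f).
Proof.
rewrite dzsE (wirtinger_sum _ _ (@sder_pull_space (ex l) f erefl) (@sder_pull_space (ey l) f erefl)).
apply: eq_bigr => k _; rewrite wirtinger_term -!dzsE dzs_conj holP.
by rewrite rmorph0 mul0r addr0.
Qed.

Lemma dzbs_pull l (f : smf W) : dzbs l (pull f) = \sum_k sconj (dzs l (P k)) * pull (dzbs k f).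
Proof.
rewrite dzbsE (wirtinger_sum _ _ (@sder_pull_space (ex l) f erefl) (@sder_pull_space (ey l) f erefl)).
apply: eq_bigr => k _; rewrite wirtinger_term -!dzbsE dzbs_conj holP.
by rewrite mul0r add0r.
Qed.

End Pullback.

(** * The null vector in normal coordinates *)

Lemma contract_term (S : comNzRingType) (c1 c2 A g x y chi psi : S) :
  c1 * c2 * (A + chi * g - psi * (x * y)) =
  c1 * c2 * A + (chi * (c1 * c2 * g) - psi * (c1 * x * (c2 * y))).
Proof. by ring. Qed.

Lemma sum_delta_r_sym (S : pzRingType) n (F : 'I_n -> S) k :
  \sum_m F m * (k == m)%:R = F k.
Proof.
rewrite (bigD1 k)//= eqxx mulr1 big1 ?addr0// => m; rewrite eq_sym => /negbTE ->.
by rewrite mulr0.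
Qed.

Section NormalCoordinates.
Context {R : realType} {n : nat}.
Local Notation C := R[i].
Local Notation E := (spacetime R n).
Context {W : domain E} {p : E} (Wp : W p).
Local Notation S := (smf W).
Variables (f h l psi chi : S) (G Y : 'I_n -> 'I_n -> S) (a : R) (V : 'rV[C]_n).

Definition tensorN i j : S :=
  dzs i (dzbs j f) + chi * G i j - psi * (dzs i h * dzbs j h).

Definition hcontract (N : 'I_n -> 'I_n -> S) : S :=
  \sum_i \sum_j (sconst (V 0 i) * sconst (V 0 j)^*) * N i j.

Lemma drv_sconst_mul (d : derivation S) c x : kills_const d ->
  d (sconst c * x) = sconst c * d x.
Proof. by move=> kd; rewrite dfunM kd mul0r add0r. Qed.

Lemma drv_contract (d : derivation S) N : kills_const d ->
  d (hcontract N) = hcontract (fun i j => d (N i j)).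
Proof.
move=> kd; rewrite /hcontract drv_sumE; apply: eq_bigr => i _.
rewrite drv_sumE; apply: eq_bigr => j _.
by rewrite dfunM -rmorphM kd mul0r add0r.
Qed.

Lemma ev_contract q (Wq : W q) N : ev Wq (hcontract N) =
  hform (\matrix_(i, j) ev Wq (N i j)) V V.
Proof.
rewrite /hcontract ev_sum; apply: eq_bigr => i _; rewrite ev_sum; apply: eq_bigr => j _.
by rewrite !evM !ev_sconst mxE; ring.
Qed.

Lemma dvec_dvecb x : dvec V (dvecb V x) = hcontract (fun i j => dzs i (dzbs j x)).
Proof.
rewrite dvecE; apply: eq_bigr => i _; rewrite dvecbE drv_sumE mulr_sumr.
apply: eq_bigr => j _; rewrite -mulrA; congr (_ * _).
by rewrite drv_sconst_mul//; exact: kills_dzs.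
Qed.

Lemma contractN : hcontract tensorN =
  Q (dvec V) (dvecb V) f h psi chi (hcontract G).
Proof.
rewrite /Q dvec_dvecb /hcontract dvecE dvecbE.
transitivity (\sum_i (\sum_j sconst (V 0 i) * sconst (V 0 j)^* * dzs i (dzbs j f)
  + (chi * \sum_j sconst (V 0 i) * sconst (V 0 j)^* * G i j
  - psi * ((sconst (V 0 i) * dzs i h) * \sum_j sconst (V 0 j)^* * dzbs j h)))).
  apply: eq_bigr => i _; rewrite !mulr_sumr -sumrB -big_split; apply: eq_bigr => j _.
  exact: contract_term.
rewrite big_split sumrB -!mulr_sumr -mulr_suml; exact: addrA.
Qed.

Hypothesis V0 : V != 0.
Hypotheses (fR : sconj f = f) (hR : sconj h = h) (psiR : sconj psi = psi)
  (chiR : sconj chi = chi) (GR : forall i j, sconj (G i j) = G j i).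
Hypothesis YG : forall i j, \sum_m Y i m * G m j = (i == j)%:R.
Hypothesis evG : forall i j, ev Wp (G i j) = (i == j)%:R.
Hypothesis evzG : forall k i j, ev Wp (dzs k (G i j)) = 0.
Hypothesis kahlerG : forall k i j, dzs k (G i j) = dzs i (G k j).
Hypothesis tG : forall i j, dts (G i j) = 0.
Hypothesis psiE : psi * (1 - h * h) = 1.
Hypothesis zl : forall k, h * dzs k l = dzs k h.
Hypothesis zbl : forall k, h * dzbs k l = dzbs k h.
Hypothesis zchi : forall k, dzs k chi = 0.
Hypothesis zbchi : forall k, dzbs k chi = 0.
Hypothesis heat_f : dts f = metric_trace Y (Xf dzs dzbs f) + sconst a%:C * f.
Hypothesis heat_h : dts h = metric_trace Y (Xh dzs dzbs f h) + sconst a%:C * (h * l).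

Let D := @dvec R n W V.
Let Db := @dvecb R n W V.

Lemma evzbG k i j : ev Wp (dzbs k (G i j)) = 0.
Proof. by rewrite -GR dzbs_conj ev_sconj evzG rmorph0. Qed.

Lemma kahlerbG k i j : dzbs k (G i j) = dzbs j (G i k).
Proof. by rewrite -GR dzbs_conj kahlerG -dzbs_conj GR. Qed.

Lemma evDG i j : ev Wp (D (G i j)) = 0.
Proof. by rewrite /D dvecE ev_sum big1// => k _; rewrite evM evzG mulr0. Qed.

Lemma evDbG i j : ev Wp (Db (G i j)) = 0.
Proof. by rewrite /Db dvecbE ev_sum big1// => k _; rewrite evM evzbG mulr0. Qed.

(** The Kähler condition exchanges the differentiation indices with the tensor indices. It makes the
    Laplacian of [g(V, Vbar)] a curvature sum, which cancels the one produced by the [chi g] part of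
    [N]. *)
Lemma contract_ddbG k : dzs k (dzbs k (hcontract G)) = D (Db (G k k)).
Proof.
rewrite /D /Db dvec_dvecb (drv_contract G (@kills_dzbs _ _ W k)).
rewrite (drv_contract (fun i j => dzbs k (G i j)) (@kills_dzs _ _ W k)) /hcontract.
apply: eq_bigr => i _.
apply: eq_bigr => j _.
rewrite (kahlerbG k i j).
rewrite (comm_dzs_dzbs k j (G i k)).
rewrite (kahlerG k i k).
rewrite -(comm_dzs_dzbs i j (G k k)).
by [].
Qed.

Let NM := \matrix_(i, j) ev Wp (tensorN i j).
Hypothesis NM_psd : psd NM.
Hypothesis NM_null : hform NM V V = 0.
Let q := hcontract tensorN.
Hypotheses (min_t : ev Wp (dts q) <= 0)
  (min_z : forall k, ev Wp (dzs k q) = 0) (min_zb : forall k, ev Wp (dzbs k q) = 0)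
  (min_zzb : forall k, 0 <= ev Wp (dzs k (dzbs k q))).

(** At a point with [g = delta] and [dg = 0] this is the bisectional curvature
    [R(U, Ubar, V, Vbar)], since there [R] is minus the mixed second derivative of [g]. *)
Definition curvature_form (U : 'rV[C]_n) : C :=
  - \sum_k \sum_m ev Wp (D (Db (G m k))) * (U 0 m * (U 0 k)^*).

Variables (kappa cR c1R pR lR : R).
Hypothesis kappa0 : 0 <= kappa.
Hypothesis curvature_ge : forall U : 'rV[C]_n,
  kappa%:C * ((\sum_k `|V 0 k| ^+ 2) * (\sum_k `|U 0 k| ^+ 2)
               + `|\sum_k V 0 k * (U 0 k)^*| ^+ 2) <= curvature_form U.
Hypothesis evchi : ev Wp chi = cR%:C.
Hypothesis evdtchi : ev Wp (dts chi) = c1R%:C.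
Hypothesis evpsi : ev Wp psi = pR%:C.
Hypothesis evl : ev Wp l = lR%:C.
Hypothesis p_gt0 : 0 < pR.
Hypothesis strict_supersolution : 0 < c1R + cR ^+ 2 - a * cR.
Hypothesis reaction : 0 <= kappa + a * (- 1 - 2 * (pR * lR)).

Lemma null_vector_contradiction : False.
Proof.
pose e := ev Wp.
have cz k x : sconj x = x -> e (dzbs k x) = (e (dzs k x))^*.
  by move=> xR; rewrite -[in LHS]xR dzbs_conj /e ev_sconj.
have cD x : sconj x = x -> e (Db x) = (e (D x))^*.
  by move=> xR; rewrite -[in LHS]xR /Db dvecb_conj /e ev_sconj.
have cDb x y : sconj x = y -> e (Db y) = (e (D x))^*.
  by move=> <-; rewrite /Db dvecb_conj /e ev_sconj.
have zR k x : sconj x = x -> sconj (dzs k x) = dzbs k x.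
  by move=> xR; rewrite -dzbs_conj xR.
have zbR k x : sconj x = x -> sconj (dzbs k x) = dzs k x.
  by move=> xR; rewrite -dzs_conj xR.
set s := \sum_k `|V 0 k| ^+ 2.
have s0 : 0 < s.
  have [k Vk] : exists k, V 0 k != 0.
    apply/existsP; apply: contraT; rewrite negb_exists => /forallP Vz.
    move: V0; rewrite (_ : V = 0) ?eqxx//; apply/rowP => k; rewrite mxE.
    by apply/eqP; rewrite -[_ == _]negbK Vz.
  rewrite /s (bigD1 k)//= ltr_wpDr//.
    by apply: sumr_ge0 => i _; rewrite exprn_ge0.
  by rewrite exprn_gt0// normr_gt0.
have evGV : e (hcontract G) = s.
  rewrite /e ev_contract /hform; apply: eq_bigr => i _.
  rewrite (bigD1 i)//= mxE evG eqxx mul1r normCK big1 ?addr0// => j ji.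
  by rewrite mxE evG eq_sym (negbTE ji) !mul0r.
have id : e (dts q) = \sum_k (e (dzs k (dzbs k q)) + e (dzs k f) * e (dzbs k q)
                       + e (dzbs k f) * e (dzs k q))
    - \sum_k \sum_m e (D (Db (G m k))) * e (Xf dzs dzbs f k m)
    - e chi * \sum_k e (dzs k (dzbs k (hcontract G)))
    + e (dts chi * hcontract G) + e (sconst a%:C * D (Db f))
    - e (2 * sconst a%:C * psi * (D h * Db h) * (1 + psi * l))
    + \sum_k e (square_terms dzs dzbs D Db f h psi k).
  rewrite /q contractN.
  apply: (@evolution_identity S C (ev Wp) n dzs dzbs dts D Db) => //.
  - by move=> k x; exact: comm_dzs_dvec.
  - by move=> k x; exact: comm_dzbs_dvec.
  - by move=> k x; exact: comm_dzs_dvecb.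
  - by move=> k x; exact: comm_dzbs_dvecb.
  - by move=> x; exact: comm_dts_dvec.
  - by move=> x; exact: comm_dts_dvecb.
  - exact: evDG.
  - exact: evDbG.
  - exact: kills_dvec.
  - exact: kills_dvecb.
  - by rewrite /D !dvecE mulr_sumr; apply: eq_bigr => k _; rewrite mulrCA zl.
  - by rewrite /Db !dvecbE mulr_sumr; apply: eq_bigr => k _; rewrite mulrCA zbl.
  - rewrite drv_contract; last exact: kills_dts.
    by rewrite /hcontract big1// => i _; rewrite big1// => j _; rewrite tG mulr0.
  - move=> k; rewrite drv_contract; last exact: kills_dzs.
    by rewrite [LHS]ev_contract /hform big1// => i _; rewrite big1// => j _; rewrite mxE evzG !mul0r.
  - move=> k; rewrite drv_contract; last exact: kills_dzbs.
    by rewrite [LHS]ev_contract /hform big1// => i _; rewrite big1// => j _; rewrite mxE evzbG !mul0r.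
pose x := e (D h); pose fk k := e (dzs k f); pose hk k := e (dzs k h).
have ek k : e (dzbs k f) = (fk k)^* by exact: cz.
have hkb k : e (dzbs k h) = (hk k)^* by exact: cz.
have xb : e (Db h) = x^* by exact: cD.
have NME k m : NM k m = e (dzs k (dzbs m f)) + cR%:C * (k == m)%:R
    - pR%:C * (hk k * (hk m)^*).
  by rewrite mxE /tensorN evB evD !evM evchi evG evpsi -/e hkb.
(* The definition of [N] is solved for the Hessian of [f], so that the curvature sum splits into
   parts of known sign. *)
have XfE k m : e (Xf dzs dzbs f k m) = NM k m - cR%:C * (k == m)%:R
    + pR%:C * (hk k * (hk m)^*) + fk k * (fk m)^*.
  rewrite NME /Xf /e evD evM -/e ek -/(fk k).
  by move: (e _) (_%:R) (hk k) => A B F; ring.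
(* [K] is the contraction with the curvature in the directions [V], [Vbar]. It is linear in [F], and
   on a rank-one [F] it is a value of [curvature_form]. *)
pose K (F : 'I_n -> 'I_n -> C) := - \sum_k \sum_m e (D (Db (G m k))) * F k m.
have KD F1 F2 : K (fun k m => F1 k m + F2 k m) = K F1 + K F2.
  rewrite /K -opprD; congr (- _); rewrite -big_split; apply: eq_bigr => k _.
  by rewrite -big_split; apply: eq_bigr => m _; rewrite mulrDr.
have KZ c F : K (fun k m => c * F k m) = c * K F.
  rewrite /K mulrN mulr_sumr; congr (- _); apply: eq_bigr => k _.
  by rewrite mulr_sumr; apply: eq_bigr => m _; rewrite mulrCA.
have KU (U : 'I_n -> C) : K (fun k m => U k * (U m)^*) =
    curvature_form (\row_k (U k)^*).
  rewrite /K /curvature_form; congr (- _); apply: eq_bigr => k _.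
  by apply: eq_bigr => m _; rewrite !mxE conjCK [(U m)^* * _]mulrC.
have curv0 U : 0 <= curvature_form U.
  apply: le_trans (curvature_ge U); rewrite mulr_ge0 ?ler0c// addr_ge0 ?exprn_ge0//.
  by rewrite mulr_ge0// sumr_ge0// => k _; rewrite exprn_ge0.
(* [N] is a sum of rank-one matrices, and [K] is nonnegative on each of them. *)
have KNM : 0 <= K (fun k m => NM k m).
  have [B NB] := psd_decomposition NM_psd.
  have -> : K (fun k m => NM k m) = \sum_r curvature_form (\row_k (B k r)^*).
    rewrite -(eq_bigr _ (fun r _ => KU (B^~ r))) /K sumrN; congr (- _).
    rewrite [RHS]exchange_big; apply: eq_bigr => k _.
    rewrite [RHS]exchange_big; apply: eq_bigr => m _.
    by rewrite NB mulr_sumr.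
  by apply: sumr_ge0 => r _; exact: curv0.
(* The lower curvature bound is taken at the vector with entries [conj h_k], whose pairing with [V]
   is [h_V]; the term [|V|^2 |U|^2] of the bound is dropped. *)
have Khh : kappa%:C * (x * x^*) <= K (fun k m => hk k * (hk m)^*).
  rewrite KU; apply: le_trans (curvature_ge _); rewrite ler_wpM2l ?ler0c//.
  rewrite -normCK ler_wpDl//.
    by rewrite mulr_ge0// sumr_ge0// => k _; rewrite exprn_ge0.
  rewrite le_eqVlt; apply/orP; left; apply/eqP; congr (`|_| ^+ 2).
  rewrite /x /D dvecE /e ev_sum; apply: eq_bigr => k _.
  by rewrite evM ev_sconst mxE conjCK.
have Kff : 0 <= K (fun k m => fk k * (fk m)^*) by rewrite KU.
(* The [- chi delta] part of [Xf] cancels against [chi] times the Laplacian of [g(V, Vbar)], by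
   [contract_ddbG]. *)
have curvE : - \sum_k \sum_m e (D (Db (G m k))) * e (Xf dzs dzbs f k m)
    - e chi * \sum_k e (dzs k (dzbs k (hcontract G))) =
    K (fun k m => NM k m) + pR%:C * K (fun k m => hk k * (hk m)^*)
    + K (fun k m => fk k * (fk m)^*).
  rewrite -KZ -!KD.
  have -> : - \sum_k \sum_m e (D (Db (G m k))) * e (Xf dzs dzbs f k m) =
    K (fun k m => (NM k m + pR%:C * (hk k * (hk m)^*) + fk k * (fk m)^*)
       + (- cR%:C) * (k == m)%:R).
    rewrite /K; congr (- _); apply: eq_bigr => k _; apply: eq_bigr => m _.
    by rewrite XfE; congr (_ * _); ring.
  rewrite KD KZ -addrA -[RHS]addr0; congr (_ + _).
  have -> : K (fun k m => (k == m)%:R) = - \sum_k e (D (Db (G k k))).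
    by congr (- _); apply: eq_bigr => k _; rewrite sum_delta_r_sym.
  under [X in _ - _ * X]eq_bigr => k _ do rewrite contract_ddbG.
  by rewrite [e chi]evchi mulrNN subrr.
(* This is [N(V, e_k) = 0], which follows from [N(V, Vbar) = 0] because [N] is nonnegative. *)
have Dz k : e (D (dzbs k f)) - pR%:C * (x * (hk k)^*) = - cR%:C * V 0 k.
  have := psd_null (delta_mx 0 k) NM_psd NM_null.
  rewrite hform_mulmx (bigD1 k)//= big1 ?addr0; last first.
    by move=> j jk; rewrite [delta_mx _ _ _ _]mxE (negbTE jk) andbF rmorph0 mulr0.
  rewrite [delta_mx _ _ _ _]mxE !eqxx rmorph1 mulr1 mxE => N0.
  have -> : e (D (dzbs k f)) = \sum_i V 0 i * NM i k
     + \sum_i (pR%:C * (V 0 i * hk i * (hk k)^*) - cR%:C * V 0 i * (i == k)%:R).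
    rewrite /D dvecE /e ev_sum -big_split; apply: eq_bigr => i _ /=.
    by rewrite evM ev_sconst NME -/e; move: (_%:R) => d; ring.
  rewrite N0 add0r sumrB sum_delta_r.
  have -> : \sum_i pR%:C * (V 0 i * hk i * (hk k)^*) = pR%:C * (x * (hk k)^*).
    rewrite -mulr_sumr -mulr_suml; congr (_ * (_ * _)).
    by rewrite /x /D dvecE /e ev_sum; apply: eq_bigr => i _; rewrite evM ev_sconst.
  by ring.
have hreal : (e h)^* = e h by rewrite /e -ev_sconj hR.
(* By [Dz] the second of the four products is exactly [chi^2 |V_k|^2]; the others are squared moduli
   because all data are real. *)
have sqE k : e (square_terms dzs dzbs D Db f h psi k) =
    `|e (D (dzs k f)) - pR%:C * (x * hk k)| ^+ 2
  + cR%:C ^+ 2 * `|V 0 k| ^+ 2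
  + pR%:C * `|e (D (dzs k h)) + 2 * e h * pR%:C * (x * hk k)| ^+ 2
  + pR%:C * `|e (D (dzbs k h)) + 2 * e h * pR%:C * (x * (hk k)^*)| ^+ 2.
  have cp (r : R) : (r%:C)^* = r%:C :> C by apply: complex_ext; rewrite /= ?oppr0.
  have c2 : (2 : C)^* = 2 by rewrite rmorph_nat.
  have DDb1 : e (Db (dzbs k f)) = (e (D (dzs k f)))^* by apply: cDb; rewrite zR.
  have DDb2 : e (Db (dzs k f)) = (e (D (dzbs k f)))^* by apply: cDb; rewrite zbR.
  have DDb3 : e (Db (dzbs k h)) = (e (D (dzs k h)))^* by apply: cDb; rewrite zR.
  have DDb4 : e (Db (dzs k h)) = (e (D (dzbs k h)))^* by apply: cDb; rewrite zbR.
  transitivity ((e (D (dzs k f)) - pR%:C * (x * hk k)) * ((e (D (dzs k f)))^* - pR%:C * (x^* * (hk k)^*))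
    + (e (D (dzbs k f)) - pR%:C * (x * (hk k)^*)) * ((e (D (dzbs k f)))^* - pR%:C * (x^* * hk k))
    + pR%:C * ((e (D (dzs k h)) + 2 * e h * pR%:C * (x * hk k))
       * ((e (D (dzs k h)))^* + 2 * e h * pR%:C * (x^* * (hk k)^*)))
    + pR%:C * ((e (D (dzbs k h)) + 2 * e h * pR%:C * (x * (hk k)^*))
       * ((e (D (dzbs k h)))^* + 2 * e h * pR%:C * (x^* * hk k)))).
    rewrite -DDb1 -DDb2 -DDb3 -DDb4 -xb -!hkb -evpsi.
    exact: (@ev_square_terms S C (ev Wp) n dzs dzbs D Db f h psi k).
  rewrite Dz.
  have -> : (e (D (dzbs k f)))^* - pR%:C * (x^* * hk k) = (- cR%:C * V 0 k)^*.
    by rewrite -Dz rmorphB !rmorphM/= conjCK cp.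
  rewrite !normCK; move: (e (D _)) (e (D _)) (e (D _)) => z1 z2 z3.
  rewrite !(rmorphD, rmorphB, rmorphM, rmorphN)/= !cp ?rmorph1 hreal conjCK; ring.
have evDDbf : e (D (Db f)) = pR%:C * (x * x^*) - cR%:C * s.
  have : e q = 0 by rewrite /q /e ev_contract.
  rewrite /q contractN /Q /e !(evB, evD, evM) evchi evpsi -/e evGV xb -/x => q0.
  by apply/eqP; rewrite -subr_eq0; apply/eqP; rewrite -q0; ring.
(* The grouping gives each summand a sign. [kappa psi |h_V|^2] is taken out of the curvature part
   and joined to the source terms [a psi |h_V|^2 - 2 a psi |h_V|^2 (1 + psi l)], which yields the
   factor in [reaction]. *)
have final : e (dts q) = \sum_k e (dzs k (dzbs k q))
    + (K (fun k m => NM k m) + K (fun k m => fk k * (fk m)^*))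
    + pR%:C * (K (fun k m => hk k * (hk m)^*) - kappa%:C * (x * x^*))
    + (c1R + cR ^+ 2 - a * cR)%:C * s
    + pR%:C * (kappa + a * (- 1 - 2 * (pR * lR)))%:C * (x * x^*)
    + (\sum_k `|e (D (dzs k f)) - pR%:C * (x * hk k)| ^+ 2
      + pR%:C * \sum_k `|e (D (dzs k h)) + 2 * e h * pR%:C * (x * hk k)| ^+ 2
      + pR%:C * \sum_k `|e (D (dzbs k h)) + 2 * e h * pR%:C * (x * (hk k)^*)| ^+ 2).
  rewrite id.
  under eq_bigr => k _ do rewrite [e (dzbs k q)]min_zb [e (dzs k q)]min_z !mulr0 !addr0.
  under [X in _ + X = _]eq_bigr => k _ do rewrite sqE.
  rewrite !big_split/= -!mulr_sumr -/s.
  have -> : e (dts chi * hcontract G) = c1R%:C * s by rewrite /e evM evdtchi -/e evGV.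
  have -> : e (sconst a%:C * D (Db f)) = a%:C * (pR%:C * (x * x^*) - cR%:C * s).
    by rewrite /e evM ev_sconst -/e evDDbf.
  have -> : e (2 * sconst a%:C * psi * (D h * Db h) * (1 + psi * l)) =
      2 * a%:C * pR%:C * (x * x^*) * (1 + pR%:C * lR%:C).
    by rewrite /e !(evM, evD) ev_sconst evpsi evl ev1 -/e xb.
  have -> (z1 z2 z3 z4 z5 z6 z7 : C) :
    z1 - z3 - z7 + z4 + z5 - z6 + z2 = z1 + (- z3 - z7) + (z4 + z5 - z6 + z2) by ring.
  rewrite curvE !(rmorphD, rmorphB, rmorphM, rmorphXn, rmorphN, rmorph1)/=.
  by ring.
have pC : 0 < pR%:C :> C by rewrite ltcR.
suff e0 : 0 < e (dts q) by have := lt_le_trans e0 min_t; rewrite ltxx.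
have sq0 (F : 'I_n -> C) : 0 <= \sum_k `|F k| ^+ 2.
  by apply: sumr_ge0 => k _; rewrite exprn_ge0.
rewrite final ltr_wpDr//.
  by rewrite addr_ge0 ?addr_ge0 ?sq0// mulr_ge0 ?sq0// ltW.
rewrite ltr_wpDr//.
  by rewrite mulr_ge0 ?mul_conjC_ge0// mulr_ge0 ?ler0c// ltW.
rewrite ltr_wpDl//; last by rewrite mulr_gt0// ltcR.
rewrite addr_ge0//; last by rewrite mulr_ge0 ?subr_ge0// ltW.
by rewrite addr_ge0 ?addr_ge0//; apply: sumr_ge0 => k _; exact: min_zzb.
Qed.

End NormalCoordinates.

(** * Tensors under holomorphic pullback *)

Section PullbackTensor.
Context {R : realType} {n : nat}.
Local Notation C := R[i].
Local Notation E := (spacetime R n).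
Context {W W' : domain E} (P : 'I_n -> smf W').
Hypothesis hmapW : forall q, W' q -> W (hmap P q).
Hypothesis holP : forall k l, dzbs l (P k) = 0.
Hypothesis stP : forall k, dts (P k) = 0.
Local Notation pl := (pull hmapW).

Definition jac p k : smf W' := dzs k (P p).
Definition jacb p k : smf W' := sconj (jac p k).

Lemma jac_hol l p k : dzbs l (jac p k) = 0.
Proof. by rewrite /jac -comm_dzs_dzbs holP drv0. Qed.

Lemma jacb_hol l p k : dzs l (jacb p k) = 0.
Proof. by rewrite /jacb dzs_conj jac_hol rmorph0. Qed.

Lemma jac_static p k : dts (jac p k) = 0.
Proof. by rewrite /jac dtsE commuting_sder_dzs -dtsE stP drv0. Qed.

Lemma jacb_static p k : dts (jacb p k) = 0.
Proof. by rewrite /jacb dts_conj jac_static rmorph0. Qed.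

Definition pulltensor (X : 'I_n -> 'I_n -> smf W) k l : smf W' :=
  \sum_p \sum_q jac p k * pl (X p q) * jacb q l.

(** No second derivatives of the map appear: the conjugate Jacobian is antiholomorphic, so [dzs k]
    annihilates it. *)
Lemma hess_pull k l f : dzs k (dzbs l (pl f)) =
  pulltensor (fun p q => dzs p (dzbs q f)) k l.
Proof.
rewrite (dzbs_pull hmapW holP) drv_sumE /pulltensor exchange_big/=; apply: eq_bigr => q _.
rewrite dfunM -/(jac q l) -/(jacb q l) jacb_hol mul0r add0r (dzs_pull hmapW holP).
rewrite mulr_sumr; apply: eq_bigr => p _.
by rewrite [LHS]mulrC.
Qed.

Lemma grad_pull k l f f' : dzs k (pl f) * dzbs l (pl f') =
  pulltensor (fun p q => dzs p f * dzbs q f') k l.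
Proof.
rewrite (dzbs_pull hmapW holP) (dzs_pull hmapW holP) mulr_suml; apply: eq_bigr => p _.
rewrite mulr_sumr; apply: eq_bigr => q _.
rewrite rmorphM/= -/(jac p k) -/(jac q l) -/(jacb q l).
by rewrite -!mulrA; congr (_ * (_ * _)); rewrite mulrC.
Qed.

Lemma pulltensorD X X' k l :
  pulltensor (fun p q => X p q + X' p q) k l = pulltensor X k l + pulltensor X' k l.
Proof.
rewrite /pulltensor -big_split; apply: eq_bigr => p _; rewrite -big_split.
by apply: eq_bigr => q _; rewrite rmorphD/= mulrDr mulrDl.
Qed.

Lemma pulltensorZ c X k l :
  pulltensor (fun p q => c * X p q) k l = pl c * pulltensor X k l.
Proof.
rewrite /pulltensor mulr_sumr; apply: eq_bigr => p _; rewrite mulr_sumr.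
by apply: eq_bigr => q _; rewrite rmorphM/= mulrCA !mulrA.
Qed.

Lemma pulltensorN X k l :
  pulltensor (fun p q => - X p q) k l = - pulltensor X k l.
Proof.
rewrite /pulltensor -sumrN; apply: eq_bigr => p _; rewrite -sumrN.
by apply: eq_bigr => q _; rewrite rmorphN/= mulrN mulNr.
Qed.

Lemma tensorN_pull f h psi chi G k l :
  tensorN (pl f) (pl h) (pl psi) (pl chi) (pulltensor G) k l =
  pulltensor (tensorN f h psi chi G) k l.
Proof.
by rewrite /tensorN hess_pull grad_pull pulltensorD pulltensorD pulltensorN !pulltensorZ.
Qed.

Lemma Xf_pull f k l : Xf dzs dzbs (pl f) k l = pulltensor (Xf dzs dzbs f) k l.
Proof. by rewrite /Xf hess_pull grad_pull -pulltensorD. Qed.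

Lemma Xh_pull f h k l : Xh dzs dzbs (pl f) (pl h) k l = pulltensor (Xh dzs dzbs f h) k l.
Proof. by rewrite /Xh hess_pull !grad_pull -!pulltensorD. Qed.

Definition jacmx q (Wq : W' q) : 'M[C]_n := \matrix_(p, k) ev Wq (jac p k).

Lemma ev_pulltensor q (Wq : W' q) X v w :
  hform (\matrix_(k, l) ev Wq (pulltensor X k l)) v w =
  hform (\matrix_(p, r) ev (hmapW Wq) (X p r))
    (v *m (jacmx Wq)^T) (w *m (jacmx Wq)^T).
Proof.
pose X0 := \matrix_(p, r) ev (hmapW Wq) (X p r).
transitivity (\sum_k \sum_l \sum_p \sum_r
    (jacmx Wq p k * v 0 k) * X0 p r * (jacmx Wq r l * w 0 l)^*).
  apply: eq_bigr => k _; apply: eq_bigr => l _.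
  rewrite mxE /pulltensor ev_sum !mulr_suml; apply: eq_bigr => p _.
  rewrite ev_sum !mulr_suml; apply: eq_bigr => r _.
  rewrite !evM ev_pull ev_sconj !mxE rmorphM/=.
  by move: (ev _ _) (ev _ _) (ev _ _) => a b c; ring.
under eq_bigr => k _ do rewrite exchange_big/=.
rewrite exchange_big/=; apply: eq_bigr => p _.
under eq_bigr => k _ do rewrite exchange_big/=.
rewrite exchange_big/=; apply: eq_bigr => r _.
rewrite [(v *m _) 0 p]mxE [(w *m _) 0 r]mxE rmorph_sum -mulrA mulr_suml mulr_sumr.
apply: eq_bigr => k _; rewrite !mulr_sumr; apply: eq_bigr => l _.
by rewrite ![_^T _ _]mxE !rmorphM/=; ring.
Qed.

Variable K : 'M[smf W']_n.
Hypothesis jacK : (\matrix_(p, k) jac p k) *m K = 1%:M.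

Let J := \matrix_(p, k) jac p k.

Lemma Kjac : K *m J = 1%:M. Proof. exact: mulmx1C jacK. Qed.

Let Jb := map_mx sconj J.
Let Kb := map_mx sconj K.

Lemma jacKb : Jb *m Kb = 1%:M.
Proof. by rewrite /Jb /Kb -map_mxM jacK map_mx1. Qed.

Lemma Kjacb : Kb *m Jb = 1%:M.
Proof. by rewrite /Jb /Kb -map_mxM Kjac map_mx1. Qed.

Lemma pulltensor_mx X : \matrix_(k, l) pulltensor X k l =
  J^T *m (\matrix_(p, q) pl (X p q)) *m Jb.
Proof.
apply/matrixP => k l; rewrite mxE /pulltensor exchange_big/= mxE.
apply: eq_bigr => q _; rewrite mxE mulr_suml; apply: eq_bigr => p _.
by rewrite !mxE.
Qed.

(** [K] is the inverse Jacobian: the inverse metric transforms with [K] where covariant tensors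
    transform with [J], so metric traces are invariant. *)
Definition pullinv (Y : 'I_n -> 'I_n -> smf W) i j : smf W' :=
  (Kb *m (\matrix_(p, q) pl (Y p q)) *m K^T) i j.

Lemma metric_trace_tr (S : comNzRingType) (Y X : 'I_n -> 'I_n -> S) :
  metric_trace Y X = \tr ((\matrix_(i, j) Y i j) *m (\matrix_(i, j) X i j)).
Proof.
rewrite /metric_trace exchange_big/=; apply: eq_bigr => l _; rewrite mxE.
by apply: eq_bigr => k _; rewrite !mxE.
Qed.

Lemma KTJT : K^T *m J^T = 1%:M.
Proof. by rewrite -trmx_mul jacK trmx1. Qed.

Lemma metric_trace_pull Y X :
  metric_trace (pullinv Y) (pulltensor X) = pl (metric_trace Y X).
Proof.
rewrite metric_trace_tr pulltensor_mx.
have -> : \matrix_(i, j) pullinv Y i j = Kb *m (\matrix_(p, q) pl (Y p q)) *m K^T.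
  by apply/matrixP => i j; rewrite mxE.
set Y' := \matrix_(p, q) _; set X' := \matrix_(p, q) _.
rewrite -!mulmxA [K^T *m _]mulmxA KTJT mul1mx mxtrace_mulC -!mulmxA jacKb mulmx1.
rewrite /metric_trace exchange_big/= rmorph_sum; apply: eq_bigr => l _.
rewrite rmorph_sum mxE; apply: eq_bigr => k _.
by rewrite !mxE rmorphM.
Qed.

Lemma pullinvK Y G : (forall i j, \sum_m Y i m * G m j = (i == j)%:R) ->
  forall i j, \sum_m pullinv Y i m * pulltensor G m j = (i == j)%:R.
Proof.
move=> YG i j.
have YG' : (\matrix_(p, q) pl (Y p q)) *m (\matrix_(p, q) pl (G p q)) = 1%:M.
  apply/matrixP => a b; rewrite !mxE.
  have := congr1 pl (YG a b); rewrite rmorph_sum rmorph_nat => <-.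
  by apply: eq_bigr => m _; rewrite !mxE rmorphM.
transitivity (((\matrix_(i, j) pullinv Y i j) *m (\matrix_(k, l) pulltensor G k l)) i j).
  by rewrite mxE; apply: eq_bigr => m _; rewrite !mxE.
rewrite pulltensor_mx.
have -> : \matrix_(i, j) pullinv Y i j = Kb *m (\matrix_(p, q) pl (Y p q)) *m K^T.
  by apply/matrixP => a b; rewrite mxE.
rewrite -!mulmxA [K^T *m _]mulmxA KTJT mul1mx [(\matrix_(p, q) pl (Y p q)) *m _]mulmxA YG' mul1mx.
by rewrite Kjacb !mxE.
Qed.

End PullbackTensor.

(** * Minimum points *)

(** With [a = 1/2] and [b = i] this is [4 d_z d_zbar = d_x^2 + d_y^2]. *)
Lemma wirtinger_laplacian (S : comNzRingType) (a b xx xy yx yy : S) :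
  b * b = -1 -> xy = yx ->
  a * (a * (xx + b * xy) + - b * (a * (yx + b * yy))) = a * a * (xx + yy).
Proof.
move=> b2 ->; have -> : a * (a * (xx + b * yx) + - b * (a * (yx + b * yy))) =
  a * a * (xx - (b * b) * yy) by ring.
by rewrite b2 mulN1r opprK.
Qed.

Section MinimumPoint.
Context {R : realType} {n : nat}.
Local Notation C := R[i].
Local Notation E := (spacetime R n).
Context {W : domain E} {p : E} (Wp : W p) (q : smf W).
Hypothesis qR : sconj q = q.
Hypothesis q0 : ev Wp q = 0.
Hypothesis q_ge0 : forall y (Wy : W y), y.2 <= p.2 -> 0 <= ev Wy q.

Let f (y : E) : R^o := complex.Re (q y).
Let oW := dset_open W.
Let sf : smooth W f := (smf_smooth q).1.

Lemma f0_min : f p = 0. Proof. by rewrite /f -[q p]/(ev Wp q) q0. Qed.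

Lemma ev_sder_real (r : smf W) y (Wy : W y) w : sconj r = r ->
  ev Wy (sder w r) = ('D_w (fun y => complex.Re (r y) : R^o) y)%:C.
Proof.
move=> rR; rewrite (ev_sder Wy); apply: complex_ext => //=.
rewrite (_ : (fun x => _) = cst 0); first exact: derive_cst.
apply/funext => x /=; have [Wx|Wx] := pselect (W x); last by rewrite (smf_out r Wx).
have := ev_sconj Wx r; rewrite rR /ev; case: (r x) => u v /= [] /eqP.
by rewrite -subr_eq0 opprK -mulr2n mulrn_eq0/= => /eqP.
Qed.

(** Nonnegativity is known only up to the time of [p]. The sign condition on [s] is automatic for
    spatial [w] and selects [s >= 0] for [w = - et]. *)
Lemma f_ge0_near (w : E) :
  \forall s \near (0 : R^o), s * (w.2 : R^o) <= 0 -> 0 <= f (p + s *: w).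
Proof.
have c : (p + s *: w) @[s --> (0 : R^o)] --> p.
  have H : (p + s *: w) @[s --> (0 : R^o)] --> p + (0 : R) *: w.
    by apply: cvgD; [exact: cvg_cst|apply: cvgZr_tmp; exact: cvg_id].
  by rewrite scale0r addr0 in H.
have nW : nbhs p (W : set E) by exact: open_nbhs_nbhs.
have : \forall s \near (0 : R^o), W (p + s *: w) by exact: c _ nW.
apply: filterS => s Ws sw.
have := q_ge0 Ws; rewrite /f -[q _]/(ev Ws q) lecE => H.
suff : (p + s *: w).2 <= p.2 by move=> /H /andP[].
by rewrite /= gerDl.
Qed.

Lemma D_space (w : E) : w.2 = 0 -> 'D_w f p = 0 /\ 0 <= 'D_w ('D_w f) p.
Proof.
move=> w0; have fN : \forall s \near (0 : R^o), 0 <= f (p + s *: w).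
  by have := f_ge0_near w; apply: filterS => s; apply; rewrite w0 mulr0.
have fN' : \forall s \near (0 : R^o), 0 <= f (p + s *: - w).
  have w0' : (- w).2 = 0 by rewrite /= w0 oppr0.
  by have := f_ge0_near (- w); apply: filterS => s; apply; rewrite w0' mulr0.
split; last by apply: (derive2_ge0_dir oW Wp sf f0_min).
apply/eqP; rewrite eq_le; apply/andP; split.
  rewrite -oppr_ge0 -(derive_opp_dir w oW Wp (sf 1%N)).
  by apply: (derive_ge0_dir oW Wp sf f0_min); apply: filterS fN' => s.
by apply: (derive_ge0_dir oW Wp sf f0_min); apply: filterS fN => s.
Qed.

Lemma D_time : 'D_et f p <= 0.
Proof.
rewrite -oppr_ge0 -(derive_opp_dir et oW Wp (sf 1%N)).
apply: (derive_ge0_dir oW Wp sf f0_min).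
have := f_ge0_near (- et); apply: filterS => s + s0; apply.
by rewrite /= mulrN1 oppr_le0 ltW.
Qed.

Lemma minimum_dts : ev Wp (dts q) <= 0.
Proof. by rewrite dtsE (ev_sder_real Wp et qR) lecE/= eqxx D_time. Qed.

Lemma minimum_dzs k : ev Wp (dzs k q) = 0.
Proof.
rewrite dzsE.
rewrite evM.
rewrite evD.
rewrite evM.
rewrite (ev_sder_real Wp (ex k) qR).
rewrite (ev_sder_real Wp (ey k) qR).
have [e1 _] := @D_space (ex k) erefl; have [e2 _] := @D_space (ey k) erefl.
by rewrite -/f e1 e2 mulr0 addr0 mulr0.
Qed.

Lemma minimum_dzbs k : ev Wp (dzbs k q) = 0.
Proof. by rewrite -qR dzbs_conj ev_sconj minimum_dzs rmorph0. Qed.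

Lemma half_nonneg (x y : R) : 0 <= x -> 0 <= y ->
  0 <= 2^-1 * 2^-1 * (x%:C + y%:C) :> C.
Proof.
move=> x0 y0; rewrite -rmorphD; apply: mulr_ge0; last by rewrite ler0c addr_ge0.
by apply: mulr_ge0; rewrite invr_ge0 ler0n.
Qed.

Lemma minimum_ddb k : 0 <= ev Wp (dzs k (dzbs k q)).
Proof.
have dR w : sconj (sder w q) = sder w q by rewrite -sder_conj qR.
have e w : ev Wp (sder w (sder w q)) = ('D_w ('D_w f) p)%:C.
  rewrite (ev_sder_real Wp w (dR w)); congr (_%:C); apply: near_eq_derive.
  apply: (near_open oW Wp) => y Wy; rewrite -[sder w q y]/(ev Wy (sder w q)).
  by rewrite (ev_sder_real Wy w qR).
rewrite dzsE dzbsE.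
rewrite (drv_sconst_mul _ _ (@kills_sder R n W (ex k))) (drv_sconst_mul _ _ (@kills_sder R n W (ey k))).
rewrite !drvD (drv_sconst_mul _ _ (@kills_sder R n W (ex k))) (drv_sconst_mul _ _ (@kills_sder R n W (ey k))).
rewrite rmorphN.
rewrite (wirtinger_laplacian _ _ _ (sconst_imagC)); last exact: sder_comm.
rewrite !evM evD !e !ev_sconst.
have [_ h1] := @D_space (ex k) erefl; have [_ h2] := @D_space (ey k) erefl.
exact: (half_nonneg h1 h2).
Qed.

End MinimumPoint.

(** * Quadratic coordinate changes *)

Section CoordinateFunctions.
Context {R : realType} {n : nat}.
Local Notation C := R[i].
Local Notation E := (spacetime R n).
Context {W : domain E}.
Implicit Types k l : 'I_n.

Lemma smoothC_coordinate k : smoothC W (fun y : E => zcoord k y.1).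
Proof. by split; [exact: (smooth_coord W (inl (inl k)))|exact: (smooth_coord W (inl (inr k)))]. Qed.

Definition zcs k : smf W := mkS (smoothC_coordinate k).

Lemma ev_zcs p (Wp : W p) k : ev Wp (zcs k) = zcoord k p.1.
Proof. exact: ev_mkS. Qed.

Lemma derive_coord_fun (i : @coord_index n) (w y : E) : 'D_w (coord_fun i) y = coord_fun i w.
Proof.
pose g : {linear E -> R^o} := HB.pack (@coord_fun R n i)
  (GRing.isLinear.Build R E R^o _ _ (@coord_linear_axiom R n i)).
have dg : differentiable g y by apply: linear_differentiable; exact: continuous_coord.
by rewrite -[LHS]/('D_w g y) deriveE// diff_lin//; exact: continuous_coord.
Qed.

Lemma sder_zcs (w : E) k : sder w (zcs k) = sconst (zcoord k w.1).
Proof.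
apply: evP => p Wp; rewrite (ev_sder Wp) (ev_sconst Wp).
transitivity (cderiv w (fun y : E => zcoord k y.1) p).
  by apply: (cderiv_ext _ (dset_open W) Wp) => q Wq; exact: (ev_zcs Wq).
by apply: complex_ext; [exact: (derive_coord_fun (inl (inl k)))|exact: (derive_coord_fun (inl (inr k)))].
Qed.

Lemma mulV2_double (x : C) : 2^-1 * (x + x) = x.
Proof. by rewrite -[x + x]mulr2n -[x *+ 2]mulr_natl mulrA mulVf ?mul1r// pnatr_eq0. Qed.

Lemma dzs_zcs l k : dzs l (zcs k) = (k == l)%:R.
Proof.
apply: evP => p Wp; rewrite dzsE evM evD evM !sder_zcs !ev_sconst rmorph_nat.
have -> : zcoord k (ex l : E).1 = (k == l)%:R :> C.
  by apply: complex_ext; rewrite /= !mxE ?eqxx/= ?rmorph_nat; case: (k == l).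
have -> : zcoord k (ey l : E).1 = imagC * (k == l)%:R :> C.
  by apply: complex_ext; rewrite /= !mxE ?eqxx/=; case: (k == l); rewrite /=; ring.
have i2 : imagC * imagC = -1 :> C by apply: complex_ext => /=; ring.
have -> : - imagC * (imagC * (k == l)%:R) = (k == l)%:R :> C.
  by rewrite mulrA mulNr i2 opprK mul1r.
exact: mulV2_double.
Qed.

Lemma dzbs_zcs l k : dzbs l (zcs k) = 0.
Proof.
apply: evP => p Wp; rewrite dzbsE evM evD evM !sder_zcs ev0 !ev_sconst.
have -> : zcoord k (ex l : E).1 = (k == l)%:R :> C.
  by apply: complex_ext; rewrite /= !mxE ?eqxx/= ?rmorph_nat; case: (k == l).
have -> : zcoord k (ey l : E).1 = imagC * (k == l)%:R :> C.
  by apply: complex_ext; rewrite /= !mxE ?eqxx/=; case: (k == l); rewrite /=; ring.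
have i2 : imagC * imagC = -1 :> C by apply: complex_ext => /=; ring.
by rewrite [imagC * _]mulrA i2 mulN1r subrr mulr0.
Qed.

Lemma dts_zcs k : dts (zcs k) = 0.
Proof.
rewrite dtsE sder_zcs -(rmorph0 (@sconst R E W)); congr sconst.
by apply: complex_ext; rewrite /= mxE.
Qed.

End CoordinateFunctions.

Section QuadraticMap.
Context {R : realType} {n : nat}.
Local Notation C := R[i].
Local Notation E := (spacetime R n).
Variables (zeta : 'I_n -> C) (A : 'M[C]_n) (c : 'I_n -> 'I_n -> 'I_n -> C).
Hypothesis c_sym : forall m k l, c m k l = c m l k.

(* [c] will be the Christoffel symbols read in the frame [A], so that the metric
   pulled back by [quadmap] is [delta] to first order at the origin. *)
Definition quadmap (W : domain E) m : smf W := sconst (zeta m)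
  + \sum_k (sconst (A m k) * zcs k - sconst (2^-1) * \sum_l sconst (c m k l) * (zcs k * zcs l)).

Lemma dzbs_quadmap W k m : dzbs k (quadmap W m) = 0.
Proof.
have kk := @kills_dzbs R n W k.
rewrite /quadmap drvD kk add0r drv_sumE big1// => i _.
rewrite drvB !(drv_sconst_mul _ _ kk) dzbs_zcs drv_sumE big1 ?mulr0 ?subrr// => l _.
by rewrite (drv_sconst_mul _ _ kk) dfunM !dzbs_zcs !(mul0r, mulr0) add0r mulr0.
Qed.

Lemma dts_quadmap W m : dts (quadmap W m) = 0.
Proof.
have kk := @kills_dts R n W.
rewrite /quadmap drvD kk add0r drv_sumE big1// => i _.
rewrite drvB !(drv_sconst_mul _ _ kk) dts_zcs drv_sumE big1 ?mulr0 ?subrr// => l _.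
by rewrite (drv_sconst_mul _ _ kk) dfunM !dts_zcs !(mul0r, mulr0) add0r mulr0.
Qed.

(** The product rule yields two sums, equal by the symmetry of [c], and the factor [1/2] in
    [quadmap] merges them. *)
Lemma dzs_quadmap W k m : dzs k (quadmap W m) =
  sconst (A m k) - \sum_l sconst (c m k l) * zcs l.
Proof.
have kk := @kills_dzs R n W k.
rewrite /quadmap drvD kk add0r drv_sumE.
transitivity (\sum_i (sconst (A m i) * (i == k)%:R - sconst 2^-1 * (\sum_l sconst (c m i l) * zcs l) * (i == k)%:R
   - sconst 2^-1 * (sconst (c m i k) * zcs i)) : smf W).
  apply: eq_bigr => i _.
  rewrite drvB !(drv_sconst_mul _ _ kk) dzs_zcs drv_sumE -addrA -opprD; congr (_ - _).
  rewrite -mulrA -mulrDr; congr (_ * _); rewrite mulr_suml.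
  rewrite -[in RHS](sum_delta_r (fun l => sconst (c m i l) * zcs i) k) -big_split.
  apply: eq_bigr => l _; rewrite (drv_sconst_mul _ _ kk) dfunM !dzs_zcs mulrDr.
  by rewrite [_%:R * _]mulrC !mulrA.
rewrite !sumrB sum_delta_r.
rewrite (sum_delta_r (fun i => sconst 2^-1 * (\sum_l sconst (c m i l) * zcs l)) k).
rewrite -mulr_sumr -addrA -opprD; congr (_ - _).
under [X in _ + _ * X = _]eq_bigr => i _ do rewrite c_sym.
by rewrite -mulrDl sconst_half mul1r.
Qed.

Lemma dzs2_quadmap W l k m : dzs l (dzs k (quadmap W m)) = - sconst (c m k l).
Proof.
have kk := @kills_dzs R n W l.
rewrite dzs_quadmap drvB kk sub0r drv_sumE; congr (- _).
rewrite -[RHS](sum_delta_r (fun i => sconst (c m k i)) l); apply: eq_bigr => i _.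
by rewrite (drv_sconst_mul _ _ kk) dzs_zcs.
Qed.

(** The domain of the chart is cut out by means of the map on [whole], and the map is then formed
    again over that domain; both versions must have the same values. *)
Lemma ev_quadmap_indep (W W' : domain E) q (Wq : W q) (Wq' : W' q) m :
  ev Wq (quadmap W m) = ev Wq' (quadmap W' m).
Proof.
rewrite /quadmap !evD !ev_sconst; congr (_ + _); rewrite !ev_sum; apply: eq_bigr => k _.
rewrite !evB !evM !ev_sconst !ev_zcs; congr (_ - _ * _); rewrite !ev_sum.
by apply: eq_bigr => l _; rewrite !evM !ev_sconst !ev_zcs.
Qed.

Lemma ev_jac_indep (W W' : domain E) q (Wq : W q) (Wq' : W' q) m k :
  ev Wq (dzs k (quadmap W m)) = ev Wq' (dzs k (quadmap W' m)).
Proof.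
rewrite !dzs_quadmap !evB !ev_sconst; congr (_ - _); rewrite !ev_sum; apply: eq_bigr => l _.
by rewrite !evM !ev_sconst !ev_zcs.
Qed.

Definition origin (t : R) : E := (0, t).

Lemma zcoord0 k : zcoord k (0 : Cn R n) = 0 :> C.
Proof. by apply: complex_ext; rewrite /= mxE. Qed.

Lemma ev_quadmap_origin (W : domain E) t (W0 : W (origin t)) m : ev W0 (quadmap W m) = zeta m.
Proof.
rewrite /quadmap evD ev_sconst ev_sum big1 ?addr0// => k _.
rewrite evB !evM !ev_sconst !ev_zcs zcoord0 mulr0 ev_sum big1 ?mulr0 ?subr0// => l _.
by rewrite !evM !ev_zcs zcoord0 mul0r mulr0.
Qed.

Lemma ev_jac_origin (W : domain E) t (W0 : W (origin t)) m k : ev W0 (dzs k (quadmap W m)) = A m k.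
Proof.
rewrite dzs_quadmap evB ev_sconst ev_sum big1 ?subr0// => l _.
by rewrite evM ev_sconst ev_zcs zcoord0 mulr0.
Qed.

Definition whole : domain E := @Domain R E setT openT 0 I.

Context {W : domain E} {p : E} (Wp : W p).
Hypothesis zetaE : forall k, zeta k = zcoord k p.1.
Hypothesis uA : A \in unitmx.

Let Pw := quadmap whole.
Let dw : smf whole := \det (\matrix_(m, k) jac Pw m k).

(** Data are only pulled back along the map, so an invertible Jacobian is what the domain has to
    guarantee; it provides the inverse matrix for [pullinv]. *)
Definition quadset : set E := [set q | W (hmap Pw q) /\ dw q != 0].

Lemma smf_continuous (V : domain E) (f : smf V) q : V q ->
  {for q, continuous (fun y => complex.Re (f y) : R^o)} /\
  {for q, continuous (fun y => complex.Im (f y) : R^o)}.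
Proof.
by move=> Vq; split; [exact: smooth_continuous (smf_smooth f).1 Vq|exact: smooth_continuous (smf_smooth f).2 Vq].
Qed.

Lemma hmap_continuous (V : domain E) (P : 'I_n -> smf V) q : V q -> {for q, continuous (hmap P)}.
Proof.
move=> Vq; apply: (continuous_coord_maps (@coord_sum R n)) => i.
exact: smooth_continuous (smooth_coord_hmap P i) Vq.
Qed.

Lemma complex_neq0 (x : C) : (x != 0) = (complex.Re x != 0) || (complex.Im x != 0).
Proof. by case: x => a b; rewrite eq_complex/= negb_and. Qed.

Lemma quadset_open : open quadset.
Proof.
rewrite openE => q [Wq dq]; apply: filterI.
  have nW : nbhs (hmap Pw q) (W : set E).
    by apply: open_nbhs_nbhs; split=> //; exact: dset_open.
  exact: (hmap_continuous (P := Pw) (I : whole q)) _ nW.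
have [cr ci] := smf_continuous dw (I : whole q).
move: dq; rewrite complex_neq0 => /orP[d0|d0].
  apply: (filterS _ (cvgr_neq0 _ cr d0)) => y; rewrite /= complex_neq0 => ->//.
apply: (filterS _ (cvgr_neq0 _ ci d0)) => y; rewrite /= complex_neq0 => ->; rewrite orbT//.
Qed.

Lemma hmap_origin : hmap Pw (origin p.2) = p.
Proof.
rewrite [RHS](_ : p = ((p.1.1, p.1.2), p.2)); last by case: (p) => [[]].
congr ((_, _), _); apply/rowP => k; rewrite mxE.
  by rewrite -[Pw k _]/(ev (I : whole (origin p.2)) (Pw k)) ev_quadmap_origin zetaE.
by rewrite -[Pw k _]/(ev (I : whole (origin p.2)) (Pw k)) ev_quadmap_origin zetaE.
Qed.

Lemma quadset_origin : quadset (origin p.2).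
Proof.
split; first by rewrite hmap_origin.
rewrite -[dw _]/(ev (I : whole (origin p.2)) dw) /dw -det_map_mx.
have -> : map_mx (ev (I : whole (origin p.2))) (\matrix_(m, k) jac Pw m k) = A.
  by apply/matrixP => m k; rewrite !mxE; exact: ev_jac_origin.
by move: uA; rewrite unitmxE unitfE.
Qed.

Definition quaddom : domain E := @Domain R E quadset quadset_open (origin p.2) quadset_origin.

Let P := quadmap quaddom.

Lemma hmap_quaddomE q : quaddom q -> hmap P q = hmap Pw q.
Proof.
move=> Wq; congr ((_, _), _); apply/rowP => k; rewrite !mxE; congr (_ _);
  exact: (ev_quadmap_indep Wq (I : whole q) k).
Qed.

Lemma hmap_quaddom q : quaddom q -> W (hmap P q).
Proof. by move=> Wq; have [+ _] := Wq; rewrite hmap_quaddomE. Qed.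

Lemma hmap_quaddom_origin : hmap P (dpt quaddom) = p.
Proof. by rewrite hmap_quaddomE; [exact: hmap_origin|exact: dpt_in]. Qed.

Lemma quadmap_jac_inverse : exists K : 'M[smf quaddom]_n,
  (\matrix_(m, k) jac P m k) *m K = 1%:M.
Proof.
set J := \matrix_(m, k) _.
have [|d dJ] := @sinv_exists R E quaddom (\det J).
  move=> q Wq; rewrite -det_map_mx; have [_] := Wq.
  rewrite -[dw _]/(ev (I : whole q) dw) /dw -det_map_mx.
  congr (_ != 0); congr (\det _); apply/matrixP => m k; rewrite !mxE.
  exact: ev_jac_indep.
exists (d *: \adj J); rewrite -scalemxAr mul_mx_adj scale_scalar_mx.
by rewrite dJ.
Qed.

End QuadraticMap.

(** * The null vector in arbitrary coordinates *)

Lemma mulr_rearrange (S : comNzRingType) (a b x y z : S) :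
  a * b * (x * y * z) = (a * x) * (y * (b * z)).
Proof. by ring. Qed.

Lemma mulr_rearrange2 (S : comNzRingType) (z x dbg ddbg g xb dg zb : S) :
  z * (dbg * xb + g * zb) + x * ((ddbg * xb + dbg * 0) + (dg * zb + g * 0)) =
  (z * (dbg * xb) + x * (ddbg * xb)) + (z * g + x * dg) * zb.
Proof. by ring. Qed.

Lemma mulr_swap13 (S : comNzRingType) (a x b : S) : a * x * b = b * x * a.
Proof. by ring. Qed.

Section NullVector.
Context {R : realType} {n : nat}.
Local Notation C := R[i].
Local Notation E := (spacetime R n).
Context {W : domain E} {p : E} (Wp : W p).
Local Notation S := (smf W).
Variables (f h l psi chi : S) (G Y : 'I_n -> 'I_n -> S) (a : R).

Definition sgamma (m i k : 'I_n) : S := \sum_q Y q m * dzs k (G i q).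

Definition scurv (i j k l : 'I_n) : S := - \sum_m G m j * dzbs l (sgamma m i k).

Definition sbisect (v w : 'rV[C]_n) : C := \sum_i \sum_j \sum_k \sum_l
  ev Wp (scurv i j k l) * v 0 i * (v 0 j)^* * w 0 k * (w 0 l)^*.

Definition sbisect_model (v w : 'rV[C]_n) : C := \sum_i \sum_j \sum_k \sum_l
  (ev Wp (G i j) * ev Wp (G k l) + ev Wp (G i l) * ev Wp (G k j)) *
    v 0 i * (v 0 j)^* * w 0 k * (w 0 l)^*.

Hypotheses (fR : sconj f = f) (hR : sconj h = h) (psiR : sconj psi = psi)
  (chiR : sconj chi = chi) (GR : forall i j, sconj (G i j) = G j i).
Hypothesis YG : forall i j, \sum_m Y i m * G m j = (i == j)%:R.
Hypothesis Gpos : posdef (\matrix_(i, j) ev Wp (G i j)).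
Hypothesis kahlerG : forall k i j, dzs k (G i j) = dzs i (G k j).
Hypothesis tG : forall i j, dts (G i j) = 0.
Hypothesis psiE : psi * (1 - h * h) = 1.
Hypothesis zl : forall k, h * dzs k l = dzs k h.
Hypothesis zbl : forall k, h * dzbs k l = dzbs k h.
Hypothesis zchi : forall k, dzs k chi = 0.
Hypothesis zbchi : forall k, dzbs k chi = 0.
Hypothesis heat_f : dts f = metric_trace Y (Xf dzs dzbs f) + sconst a%:C * f.
Hypothesis heat_h : dts h = metric_trace Y (Xh dzs dzbs f h) + sconst a%:C * (h * l).

Lemma sgamma_lower i k q : \sum_m sgamma m i k * G m q = dzs k (G i q).
Proof.
rewrite /sgamma; under eq_bigr => m _ do rewrite mulr_suml.
rewrite exchange_big/= -[RHS](sum_delta_r (fun r => dzs k (G i r)) q).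
apply: eq_bigr => r _; rewrite -YG mulr_sumr; apply: eq_bigr => m _.
by rewrite mulrAC mulrC.
Qed.

Lemma sgamma_sym m i k : sgamma m i k = sgamma m k i.
Proof. by apply: eq_bigr => q _; rewrite kahlerG. Qed.

(** Differentiating [sgamma_lower] trades the derivative of the Christoffel symbol for second
    derivatives of the metric. *)
Lemma scurvE i j k r : scurv i j k r =
  \sum_m sgamma m i k * dzbs r (G m j) - dzbs r (dzs k (G i j)).
Proof.
rewrite -sgamma_lower drv_sumE.
under [X in _ - X]eq_bigr => m _ do rewrite dfunM.
by rewrite big_split opprD addrA addrAC subrr add0r; congr (- _); apply: eq_bigr => m _; rewrite mulrC.
Qed.

Lemma sbisect_modelE v w : sbisect_model v w =
  hform (\matrix_(i, j) ev Wp (G i j)) v v * hform (\matrix_(i, j) ev Wp (G i j)) w w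
  + `|hform (\matrix_(i, j) ev Wp (G i j)) v w| ^+ 2.
Proof.
set g := \matrix_(i, j) _.
have gR i j : g j i = (g i j)^* by rewrite !mxE -ev_sconj GR.
rewrite normCK -(hform_conj _ _ gR) /sbisect_model.
transitivity ((\sum_i \sum_j \sum_k \sum_l (g i j * v 0 i * (v 0 j)^*) * (g k l * w 0 k * (w 0 l)^*))
 + \sum_i \sum_j \sum_k \sum_l (g i l * v 0 i * (w 0 l)^*) * (g k j * w 0 k * (v 0 j)^*)).
  rewrite -big_split; apply: eq_bigr => i _; rewrite -big_split; apply: eq_bigr => j _.
  rewrite -big_split; apply: eq_bigr => k _; rewrite -big_split; apply: eq_bigr => r _.
  rewrite /= ![g _ _]mxE; move: (ev _ _) (ev _ _) (ev _ _) (ev _ _) => *; ring.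
congr (_ + _).
  rewrite /hform mulr_suml; apply: eq_bigr => i _; rewrite mulr_suml; apply: eq_bigr => j _.
  by rewrite mulr_sumr; apply: eq_bigr => k _; rewrite mulr_sumr.
rewrite /hform mulr_suml; apply: eq_bigr => i _.
rewrite exchange_big/= mulr_sumr [RHS](eq_bigr _ (fun k _ => mulr_suml _ _ _ _)).
rewrite [RHS](eq_bigr (fun k => \sum_j (\sum_r g i r * v 0 i * (w 0 r)^*) * (g k j * w 0 k * (v 0 j)^*))); last first.
  move=> k _; rewrite -mulr_suml.
  by rewrite mulr_sumr.
apply: eq_bigr => k _; apply: eq_bigr => j _.
by rewrite mulr_suml.
Qed.

(** * The metric and its curvature in a normal chart *)

Section NormalChart.
Context {W' : domain E} (P : 'I_n -> smf W').
Hypothesis hmapW : forall q, W' q -> W (hmap P q).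
Hypothesis holP : forall k r, dzbs r (P k) = 0.
Hypothesis stP : forall k, dts (P k) = 0.
Context {q0 : E} (W0 : W' q0).
Hypothesis hq0 : hmap P q0 = p.
Variable A : 'M[C]_n.
Hypothesis evA : forall m k, ev W0 (jac P m k) = A m k.
Hypothesis evdA : forall m k r, ev W0 (dzs r (jac P m k)) =
  - \sum_u \sum_v ev Wp (sgamma m u v) * A u k * A v r.
Hypothesis frame : forall k r,
  \sum_u \sum_v ev Wp (G u v) * A u k * (A v r)^* = (k == r)%:R.
Local Notation pl := (pull hmapW).
Local Notation G' := (pulltensor hmapW G).

Lemma ev_point (q q' : E) (Wq : W q) (Wq' : W q') (x : S) : q = q' -> ev Wq x = ev Wq' x.
Proof. by move=> e; rewrite /ev e. Qed.

Lemma ev_pl x : ev W0 (pl x) = ev Wp x.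
Proof. by rewrite ev_pull; exact: ev_point. Qed.

Lemma ev_pullG k r : ev W0 (G' k r) = (k == r)%:R.
Proof.
rewrite -frame /pulltensor ev_sum; apply: eq_bigr => u _; rewrite ev_sum.
apply: eq_bigr => v _; rewrite !evM ev_sconj !evA ev_pl.
by rewrite [A u k * _]mulrC.
Qed.

Lemma gamma_lower_ev (x w : 'I_n -> C) q :
  \sum_m (\sum_u \sum_v ev Wp (sgamma m u v) * x u * w v) * ev Wp (G m q) =
  \sum_u \sum_v x u * w v * ev Wp (dzs v (G u q)).
Proof.
under eq_bigr => m _ do rewrite mulr_suml.
rewrite exchange_big/=; apply: eq_bigr => u _.
under eq_bigr => m _ do rewrite mulr_suml.
rewrite exchange_big/=; apply: eq_bigr => v _.
rewrite -sgamma_lower ev_sum mulr_sumr; apply: eq_bigr => m _.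
by rewrite evM; ring.
Qed.

(** The derivative of the Jacobian contributes minus the Christoffel symbols, which after lowering
    the index cancel the derivative of [G] itself. *)
Lemma ev_dzs_pullG r i j : ev W0 (dzs r (G' i j)) = 0.
Proof.
have e : ev W0 (dzs r (G' i j)) = \sum_q (\sum_m
    (ev W0 (dzs r (jac P m i)) * ev Wp (G m q)
     + A m i * \sum_v A v r * ev Wp (dzs v (G m q)))) * (A q j)^*.
  rewrite /pulltensor exchange_big/= drv_sumE ev_sum; apply: eq_bigr => q _.
  rewrite drv_sumE ev_sum mulr_suml; apply: eq_bigr => m _.
  rewrite dfunM (jacb_hol holP) mulr0 addr0 evM ev_sconj evA; congr (_ * _).
  rewrite dfunM evD !evM evA ev_pl; congr (_ + _ * _).
  rewrite (dzs_pull hmapW holP) ev_sum; apply: eq_bigr => v _.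
  by rewrite evM ev_pl -[dzs r (P v)]/(jac P v r) evA.
rewrite e big1// => q _; rewrite big_split/=.
under eq_bigr => m _ do rewrite evdA mulNr.
rewrite sumrN (gamma_lower_ev (fun u => A u i) (fun v => A v r)).
rewrite addrC -sumrB big1 ?mul0r// => u _; rewrite mulr_sumr -sumrB big1// => v _.
by rewrite mulrA subrr.
Qed.

Lemma dvec_pl V x : dvec V (pl x) = \sum_r dvec V (P r) * pl (dzs r x).
Proof.
rewrite dvecE; under eq_bigr => k _ do rewrite (dzs_pull hmapW holP) mulr_sumr.
rewrite exchange_big/=; apply: eq_bigr => r _; rewrite dvecE mulr_suml.
by apply: eq_bigr => k _; rewrite mulrA.
Qed.

Lemma dvecb_pl V x : dvecb V (pl x) = \sum_r sconj (dvec V (P r)) * pl (dzbs r x).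
Proof.
rewrite dvecbE; under eq_bigr => k _ do rewrite (dzbs_pull hmapW holP) mulr_sumr.
rewrite exchange_big/=; apply: eq_bigr => r _; rewrite dvecE rmorph_sum mulr_suml.
apply: eq_bigr => k _; rewrite mulrA; congr (_ * _).
by rewrite [RHS]rmorphM [X in _ = X * _]sconj_const.
Qed.

Lemma ev_dvecP V m : ev W0 (dvec V (P m)) = (V *m A^T) 0 m.
Proof.
rewrite dvecE ev_sum mxE; apply: eq_bigr => k _.
by rewrite evM ev_sconst -[dzs k (P m)]/(jac P m k) evA mxE.
Qed.

Lemma ev_dvec2P U V m : ev W0 (dvec V (dvec U (P m))) =
  - \sum_u \sum_v ev Wp (sgamma m u v) * (U *m A^T) 0 u * (V *m A^T) 0 v.
Proof.
rewrite dvecE ev_sum.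
transitivity (\sum_r \sum_k V 0 r * U 0 k * ev W0 (dzs r (jac P m k))).
  apply: eq_bigr => r _; rewrite evM ev_sconst dvecE drv_sumE ev_sum mulr_sumr.
  apply: eq_bigr => k _; rewrite (drv_sconst_mul _ _ (@kills_dzs R n W' r)) evM ev_sconst.
  by rewrite mulrA.
transitivity (- \sum_r \sum_k \sum_u \sum_v
    ev Wp (sgamma m u v) * (U 0 k * A u k) * (V 0 r * A v r)).
  rewrite -sumrN; apply: eq_bigr => r _; rewrite -sumrN; apply: eq_bigr => k _.
  rewrite evdA mulrN; congr (- _); rewrite mulr_sumr; apply: eq_bigr => u _.
  by rewrite mulr_sumr; apply: eq_bigr => v _; ring.
congr (- _); under eq_bigr => r _ do rewrite exchange_big/=.
rewrite exchange_big/=; apply: eq_bigr => u _.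
under eq_bigr => r _ do (under eq_bigr => k _ do idtac; rewrite exchange_big/=).
rewrite exchange_big/=; apply: eq_bigr => v _.
rewrite ![(_ *m _) 0 _]mxE mulr_sumr; apply: eq_bigr => r _.
rewrite mulr_sumr mulr_suml; apply: eq_bigr => k _.
by rewrite ![A^T _ _]mxE.
Qed.

Lemma dvecb_hol V (x : smf W') : (forall k, dzbs k x = 0) -> dvecb V x = 0.
Proof. by move=> hx; rewrite dvecbE big1// => k _; rewrite hx mulr0. Qed.

Lemma dvec_antihol V (x : smf W') : (forall k, dzbs k x = 0) -> dvec V (sconj x) = 0.
Proof. by move=> hx; rewrite dvecE big1// => k _; rewrite dzs_conj hx rmorph0 mulr0. Qed.

Lemma dvec_holo U m k : dzbs k (dvec U (P m)) = 0.
Proof. by rewrite comm_dzbs_dvec holP drv0. Qed.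

Lemma dvec2_holo U V m k : dzbs k (dvec V (dvec U (P m))) = 0.
Proof. by rewrite comm_dzbs_dvec dvec_holo drv0. Qed.

Lemma exchange_big22 (T : nmodType) (F : 'I_n -> 'I_n -> 'I_n -> 'I_n -> T) :
  \sum_i \sum_j \sum_k \sum_m F i j k m = \sum_k \sum_m \sum_i \sum_j F i j k m.
Proof.
under eq_bigr => i _ do rewrite exchange_big/=.
rewrite exchange_big/=; apply: eq_bigr => k _.
under eq_bigr => i _ do rewrite exchange_big/=.
by rewrite exchange_big.
Qed.

Lemma contract_pull U : hcontract U G' =
  \sum_u \sum_v dvec U (P u) * (pl (G u v) * sconj (dvec U (P v))).
Proof.
rewrite /hcontract /pulltensor.
transitivity (\sum_i \sum_j \sum_u \sum_v (sconst (U 0 i) * jac P u i) *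
    (pl (G u v) * (sconst (U 0 j)^* * jacb P v j)) : smf W').
  apply: eq_bigr => i _; apply: eq_bigr => j _; rewrite mulr_sumr; apply: eq_bigr => u _.
  rewrite mulr_sumr; apply: eq_bigr => v _.
  exact: mulr_rearrange.
rewrite exchange_big22; apply: eq_bigr => u _; apply: eq_bigr => v _.
rewrite dvecE mulr_suml; apply: eq_bigr => i _; rewrite -!mulr_sumr; congr (_ * (_ * _)).
rewrite dvecE rmorph_sum; apply: eq_bigr => j _.
by rewrite [RHS]rmorphM [X in _ = X * _]sconj_const.
Qed.

(** With [X = d_U P] and [Z = d_V X], both holomorphic, the mixed derivative of the pulled-back
    [g(U, Ubar)] is expanded by Leibniz. What survives is [d dbar g - Gamma dbar g], that is, minus
    the curvature by [scurvE]. *)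
Lemma curvature_pull U V :
  curvature_form W0 G' V U = sbisect (U *m A^T) (V *m A^T).
Proof.
pose X m := dvec U (P m); pose Z m := dvec V (X m).
set x := U *m A^T; set w := V *m A^T.
have -> : curvature_form W0 G' V U = - ev W0 (dvec V (dvecb V (hcontract U G'))).
  rewrite (drv_contract _ _ (@kills_dvecb R n W' V)) (drv_contract _ _ (@kills_dvec R n W' V)).
  rewrite ev_contract /curvature_form /hform exchange_big/=; congr (- _).
  by apply: eq_bigr => i _; apply: eq_bigr => j _; rewrite mxE mulrA.
have dbX m : dvecb V (X m) = 0 by apply: dvecb_hol => k; exact: dvec_holo.
have dXb m : dvec V (sconj (X m)) = 0 by apply: dvec_antihol => k; exact: dvec_holo.
have dZb m : dvec V (sconj (Z m)) = 0 by apply: dvec_antihol => k; exact: dvec2_holo.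
have e1 : dvec V (dvecb V (hcontract U G')) =
    \sum_u \sum_v ((Z u * (dvecb V (pl (G u v)) * sconj (X v)) + X u * (dvec V (dvecb V (pl (G u v))) * sconj (X v)))
      + (Z u * pl (G u v) + X u * dvec V (pl (G u v))) * sconj (Z v)).
  rewrite contract_pull drv_sumE drv_sumE; apply: eq_bigr => u _.
  rewrite drv_sumE drv_sumE; apply: eq_bigr => v _.
  have eb : dvecb V (X u * (pl (G u v) * sconj (X v))) =
      X u * (dvecb V (pl (G u v)) * sconj (X v) + pl (G u v) * sconj (Z v)).
    by rewrite dfunM dbX mul0r add0r dfunM dvecb_conj.
  rewrite [dvecb V _]eb dfunM drvD [dvec V (_ * sconj (X v))]dfunM [dvec V (_ * sconj (Z v))]dfunM dXb dZb.
  exact: mulr_rearrange2.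
have evX m : ev W0 (X m) = x 0 m by exact: ev_dvecP.
have evZ m : ev W0 (Z m) = - \sum_u \sum_v ev Wp (sgamma m u v) * x 0 u * w 0 v.
  exact: ev_dvec2P.
have evD1 y : ev W0 (dvec V (pl y)) = \sum_r w 0 r * ev Wp (dzs r y).
  by rewrite dvec_pl ev_sum; apply: eq_bigr => r _; rewrite evM ev_dvecP ev_pl.
have evDb1 y : ev W0 (dvecb V (pl y)) = \sum_r (w 0 r)^* * ev Wp (dzbs r y).
  by rewrite dvecb_pl ev_sum; apply: eq_bigr => r _; rewrite evM ev_sconj ev_dvecP ev_pl.
have evDDb y : ev W0 (dvec V (dvecb V (pl y))) =
    \sum_s \sum_r w 0 s * (w 0 r)^* * ev Wp (dzbs r (dzs s y)).
  rewrite dvecb_pl drv_sumE ev_sum exchange_big/=; apply: eq_bigr => r _.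
  rewrite dfunM (dvec_antihol V (dvec_holo V r)) mul0r add0r evM ev_sconj ev_dvecP evD1.
  by rewrite mulr_sumr; apply: eq_bigr => s _; rewrite comm_dzs_dzbs mulrCA mulrA.
rewrite e1 ev_sum.
under eq_bigr => u _ do rewrite ev_sum.
rewrite exchange_big/=.
under eq_bigr => v _ do (under eq_bigr => u _ do rewrite evD [X in _ + X]evM; rewrite big_split/= -mulr_suml).
(* The coefficient of [conj Z_v] is a first derivative of the pulled-back metric, hence zero for the
   same reason as in [ev_dzs_pullG]. *)
have null v : \sum_u ev W0 (Z u * pl (G u v) + X u * dvec V (pl (G u v))) = 0.
  under eq_bigr => u _ do rewrite evD !evM evZ evX ev_pl evD1 mulNr.
  rewrite big_split/= sumrN (gamma_lower_ev (x 0) (w 0)) addrC -sumrB big1// => u _.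
  by rewrite mulr_sumr -sumrB big1// => s _; rewrite mulrA subrr.
under eq_bigr => v _ do rewrite null mul0r addr0.
rewrite /sbisect -sumrN exchange_big/=; apply: eq_bigr => v _.
rewrite -sumrN.
transitivity (\sum_u ((\sum_i \sum_k ev Wp (sgamma u i k) * x 0 i * w 0 k) *
     ((\sum_r (w 0 r)^* * ev Wp (dzbs r (G u v))) * (x 0 v)^*)) -
   \sum_u x 0 u * ((\sum_s \sum_r w 0 s * (w 0 r)^* * ev Wp (dzbs r (dzs s (G u v)))) * (x 0 v)^*)).
  rewrite -sumrB; apply: eq_bigr => u _.
  by rewrite evD !evM ev_sconj evZ !evX evDb1 evDDb opprD mulNr opprK.
have -> : \sum_u ((\sum_i \sum_k ev Wp (sgamma u i k) * x 0 i * w 0 k) *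
     ((\sum_r (w 0 r)^* * ev Wp (dzbs r (G u v))) * (x 0 v)^*)) =
   \sum_i \sum_k \sum_r \sum_u (ev Wp (sgamma u i k) * ev Wp (dzbs r (G u v))) * x 0 i * (x 0 v)^* * w 0 k * (w 0 r)^*.
  under [RHS]eq_bigr => i _ do (under eq_bigr => k _ do rewrite exchange_big/=; rewrite exchange_big/=).
  rewrite exchange_big/=; apply: eq_bigr => u _; rewrite mulr_suml; apply: eq_bigr => i _.
  rewrite mulr_suml; apply: eq_bigr => k _; rewrite mulr_suml mulr_sumr; apply: eq_bigr => r _.
  by ring.
rewrite -sumrB; apply: eq_bigr => i _; rewrite mulr_suml mulr_sumr -sumrB.
apply: eq_bigr => k _; rewrite mulr_suml mulr_sumr -sumrB; apply: eq_bigr => r _.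
rewrite scurvE evB ev_sum !mulrBl !mulr_suml; congr (_ - _).
  by apply: eq_bigr => u _; rewrite evM.
by ring.
Qed.

End NormalChart.

Lemma sconj_hcontract (W1 : domain E) V (N : 'I_n -> 'I_n -> smf W1) :
  (forall i j, sconj (N i j) = N j i) -> sconj (hcontract V N) = hcontract V N.
Proof.
move=> NR; rewrite /hcontract [RHS]exchange_big/= rmorph_sum; apply: eq_bigr => i _.
rewrite rmorph_sum; apply: eq_bigr => j _.
rewrite [LHS]rmorphM [X in _ * X = _]NR [X in X * _ = _]rmorphM.
rewrite [X in X * _ * _ = _]sconj_const [X in _ * X * _ = _]sconj_const conjCK.
by rewrite [X in X * _ = _]mulrC.
Qed.

Lemma sconj_tensorN (W1 : domain E) (f1 h1 psi1 chi1 : smf W1) G1 :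
  sconj f1 = f1 -> sconj h1 = h1 -> sconj psi1 = psi1 -> sconj chi1 = chi1 ->
  (forall i j, sconj (G1 i j) = G1 j i) ->
  forall i j, sconj (tensorN f1 h1 psi1 chi1 G1 i j) = tensorN f1 h1 psi1 chi1 G1 j i.
Proof.
move=> fr hr pr cr gr i j; rewrite /tensorN.
have e1 : sconj (dzs i (dzbs j f1)) = dzs j (dzbs i f1).
  by rewrite -dzbs_conj -dzs_conj fr comm_dzs_dzbs.
have e2 : sconj (chi1 * G1 i j) = chi1 * G1 j i by rewrite [LHS]rmorphM [X in X * _ = _]cr [X in _ * X = _]gr.
have e3 : sconj (dzs i h1 * dzbs j h1) = dzs j h1 * dzbs i h1.
  rewrite [LHS]rmorphM -[X in X * _ = _]dzbs_conj -[X in _ * X = _]dzs_conj hr; exact: mulrC.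
have e4 : sconj (psi1 * (dzs i h1 * dzbs j h1)) = psi1 * (dzs j h1 * dzbs i h1).
  by rewrite [LHS]rmorphM [X in X * _ = _]pr [X in _ * X = _]e3.
by rewrite [LHS]rmorphB [X in _ - X = _]e4 [X in X - _ = _]rmorphD [X in X + _ - _ = _]e1 [X in _ + X - _ = _]e2.
Qed.

(** * The data of the null vector argument under pullback *)

Section PulledGeometry.
Context {W' : domain E} (P : 'I_n -> smf W').
Hypothesis hmapW : forall q, W' q -> W (hmap P q).
Hypothesis holP : forall k r, dzbs r (P k) = 0.
Hypothesis stP : forall k, dts (P k) = 0.
Local Notation pl := (pull hmapW).
Local Notation G' := (pulltensor hmapW G).

Lemma sconj_pullG i j : sconj (G' i j) = G' j i.
Proof.
rewrite /pulltensor [RHS]exchange_big/= rmorph_sum; apply: eq_bigr => u _.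
rewrite rmorph_sum; apply: eq_bigr => v _.
rewrite [LHS]rmorphM [X in X * _ = _]rmorphM -[X in _ * X * _ = _]pull_conj GR /jacb.
rewrite [X in _ * X = _]sconjK.
exact: mulr_swap13.
Qed.

(** Two separate symmetries: second derivatives of the map commute, and in the remaining sum the
    Kähler condition on [G] allows renaming the summation indices. *)
Lemma kahler_pullG k i j : dzs k (G' i j) = dzs i (G' k j).
Proof.
have e r s : dzs r (G' s j) = \sum_u \sum_v (dzs r (jac P u s) * pl (G u v) * jacb P v j
    + \sum_m jac P u s * jac P m r * pl (dzs m (G u v)) * jacb P v j).
  rewrite /pulltensor drv_sumE; apply: eq_bigr => u _; rewrite drv_sumE; apply: eq_bigr => v _.
  rewrite dfunM (jacb_hol holP) mulr0 addr0 dfunM mulrDl; congr (_ + _).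
  rewrite (dzs_pull hmapW holP) mulr_sumr mulr_suml; apply: eq_bigr => m _.
  by rewrite mulrA.
rewrite !e.
under eq_bigr => u _ do rewrite big_split/=.
under [RHS]eq_bigr => u _ do rewrite big_split/=.
rewrite !big_split/=; congr (_ + _).
  apply: eq_bigr => u _; apply: eq_bigr => v _; congr (_ * _ * _).
  exact: comm_dzs_dzs.
under eq_bigr => u _ do rewrite exchange_big/=.
rewrite exchange_big/=; apply: eq_bigr => u _.
rewrite [RHS]exchange_big/=; apply: eq_bigr => m _; apply: eq_bigr => v _.
by rewrite kahlerG; congr (_ * _ * _); exact: mulrC.
Qed.

Lemma static_pullG i j : dts (G' i j) = 0.
Proof.
rewrite /pulltensor drv_sumE big1// => u _; rewrite drv_sumE big1// => v _.
rewrite !dfunM (jac_static stP) (jacb_static stP) (dts_pull hmapW stP) tG rmorph0.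
by rewrite mul0r mulr0 addr0 mul0r mulr0 addr0.
Qed.

Lemma gradlog_pull k : pl h * dzs k (pl l) = dzs k (pl h).
Proof.
rewrite !(dzs_pull hmapW holP) mulr_sumr; apply: eq_bigr => r _.
by rewrite mulrCA -[pl h * _]rmorphM zl.
Qed.

Lemma gradlogb_pull k : pl h * dzbs k (pl l) = dzbs k (pl h).
Proof.
rewrite !(dzbs_pull hmapW holP) mulr_sumr; apply: eq_bigr => r _.
by rewrite mulrCA -[pl h * _]rmorphM zbl.
Qed.

Variable K : 'M[smf W']_n.
Hypothesis jacK : (\matrix_(p, k) jac P p k) *m K = 1%:M.

Lemma heat_f_pull : dts (pl f) =
  metric_trace (pullinv hmapW K Y) (Xf dzs dzbs (pl f)) + sconst a%:C * pl f.
Proof.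
rewrite (dts_pull hmapW stP) heat_f [LHS]rmorphD [X in _ + X = _]rmorphM.
rewrite [X in _ + X * _ = _]pull_const; congr (_ + _).
apply: (etrans (esym (metric_trace_pull hmapW jacK Y _))); apply: eq_bigr => k _; apply: eq_bigr => r _.
by rewrite (Xf_pull hmapW holP).
Qed.

Lemma heat_h_pull : dts (pl h) =
  metric_trace (pullinv hmapW K Y) (Xh dzs dzbs (pl f) (pl h)) + sconst a%:C * (pl h * pl l).
Proof.
rewrite (dts_pull hmapW stP) heat_h [LHS]rmorphD [X in _ + X = _]rmorphM.
rewrite [X in _ + X * _ = _]pull_const [X in _ + _ * X = _]rmorphM; congr (_ + _).
apply: (etrans (esym (metric_trace_pull hmapW jacK Y _))); apply: eq_bigr => k _; apply: eq_bigr => r _.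
by rewrite (Xh_pull hmapW holP).
Qed.

Lemma hform_tensorN_pull q (Wq : W' q) v w :
  hform (\matrix_(i, j) ev Wq (tensorN (pl f) (pl h) (pl psi) (pl chi) G' i j)) v w =
  hform (\matrix_(i, j) ev (hmapW Wq) (tensorN f h psi chi G i j))
    (v *m (jacmx P Wq)^T) (w *m (jacmx P Wq)^T).
Proof.
rewrite -ev_pulltensor; congr (hform _ _ _); apply/matrixP => i j; rewrite !mxE.
by rewrite (tensorN_pull hmapW holP).
Qed.

End PulledGeometry.

Variable V : 'rV[C]_n.
Hypothesis V0 : V != 0.
Hypothesis N_psd : forall y (Wy : W y), y.2 <= p.2 ->
  psd (\matrix_(i, j) ev Wy (tensorN f h psi chi G i j)).
Hypothesis N_null : hform (\matrix_(i, j) ev Wp (tensorN f h psi chi G i j)) V V = 0.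
Variables (kappa cR c1R pR lR : R).
Hypothesis kappa0 : 0 <= kappa.
Hypothesis curvature_ge : forall v w, kappa%:C * sbisect_model v w <= sbisect v w.
Hypothesis evchi : ev Wp chi = cR%:C.
Hypothesis evdtchi : ev Wp (dts chi) = c1R%:C.
Hypothesis evpsi : ev Wp psi = pR%:C.
Hypothesis evl : ev Wp l = lR%:C.
Hypothesis p_gt0 : 0 < pR.
Hypothesis strict_supersolution : 0 < c1R + cR ^+ 2 - a * cR.
Hypothesis reaction : 0 <= kappa + a * (- 1 - 2 * (pR * lR)).

(** Everything is moved to the quadratic chart. There [q], the contraction of [N'] with the constant
    vector [V'], is nonnegative up to the time of the base point and zero at it, which supplies the
    derivative conditions of [null_vector_contradiction]. *)
Lemma null_vector_chart : False.
Proof.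
have [A uA frame0] := posdef_frame Gpos.
have frame k r : \sum_u \sum_v ev Wp (G u v) * A u k * (A v r)^* = (k == r)%:R.
  rewrite -frame0; apply: eq_bigr => u _; apply: eq_bigr => v _; by rewrite mxE.
pose c m k r := \sum_u \sum_v ev Wp (sgamma m u v) * A u k * A v r.
have c_sym m k r : c m k r = c m r k.
  rewrite /c exchange_big/=; apply: eq_bigr => u _; apply: eq_bigr => v _.
  by rewrite sgamma_sym mulrAC.
pose zeta k := zcoord k p.1.
pose D := @quaddom R n zeta A c c_sym W p Wp (fun k => erefl) uA.
pose P := quadmap zeta A c D.
pose hW : forall q, D q -> W (hmap P q) := @hmap_quaddom R n zeta A c c_sym W p Wp (fun k => erefl) uA.
have hol k r : dzbs r (P k) = 0 by exact: dzbs_quadmap.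
have st k : dts (P k) = 0 by exact: dts_quadmap.
have hq0 : hmap P (dpt D) = p by exact: hmap_quaddom_origin.
have [K jacK] := @quadmap_jac_inverse R n zeta A c c_sym W p Wp (fun k => erefl) uA.
pose W0 : D (dpt D) := dpt_in D.
have evA m k : ev W0 (jac P m k) = A m k by exact: (@ev_jac_origin R n zeta A c c_sym D p.2 W0).
have evdA m k r : ev W0 (dzs r (jac P m k)) = - c m k r.
  by rewrite [dzs r _](@dzs2_quadmap R n zeta A c c_sym) evN ev_sconst.
(* The Jacobian at the base point is [A], so this is the vector that it sends to [V]. *)
pose V' := V *m (invmx A)^T.
have V'A : V' *m A^T = V by rewrite /V' -mulmxA -trmx_mul mulmxV// trmx1 mulmx1.
pose pl := pull hW; pose G' := pulltensor hW G.
pose N' i j := tensorN (pl f) (pl h) (pl psi) (pl chi) G' i j.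
have plR x : sconj x = x -> sconj (pl x) = pl x by move=> xR; rewrite -pull_conj xR.
have jacA : jacmx P W0 = A by apply/matrixP => i j; rewrite mxE evA.
have pt x : ev (hW _ W0) x = ev Wp x by exact: ev_point.
have NM v w : hform (\matrix_(i, j) ev W0 (N' i j)) v w =
    hform (\matrix_(i, j) ev Wp (tensorN f h psi chi G i j)) (v *m A^T) (w *m A^T).
  rewrite (hform_tensorN_pull hW hol) jacA; congr (hform _ _ _).
  by apply/matrixP => i j; rewrite !mxE pt.
have null : hform (\matrix_(i, j) ev W0 (N' i j)) V' V' = 0 by rewrite NM V'A.
pose q := hcontract V' N'.
have qR : sconj q = q.
  apply: sconj_hcontract => i j; apply: sconj_tensorN; try exact: plR.
  exact: sconj_pullG.
have q0 : ev W0 q = 0 by rewrite ev_contract.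
have q_ge0 y (Wy : D y) : y.2 <= (dpt D).2 -> 0 <= ev Wy q.
  by move=> yt; rewrite ev_contract (hform_tensorN_pull hW hol); apply: N_psd.
have gA v w : hform (\matrix_(i, j) ev Wp (G i j)) (v *m A^T) (w *m A^T) =
    \sum_k v 0 k * (w 0 k)^*.
  rewrite -jacA.
  transitivity (hform (\matrix_(i, j) ev W0 (G' i j)) v w).
    rewrite ev_pulltensor; congr (hform _ _ _); apply/matrixP => i j; by rewrite !mxE pt.
  rewrite /hform; apply: eq_bigr => i _; rewrite (bigD1 i)//= big1 => [|j ji].
    by rewrite mxE (ev_pullG hW hq0 evA frame) eqxx mul1r addr0.
  by rewrite mxE (ev_pullG hW hq0 evA frame) eq_sym (negbTE ji) !mul0r.
apply: (@null_vector_contradiction R n D (dpt D) W0 (pl f) (pl h) (pl l) (pl psi) (pl chi) G'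
  (pullinv hW K Y) a V' _ _ _ _ _ _ _ _ _ _ _ _ _ _ _ _ _ null _ _ _ _ kappa cR c1R pR lR) => //.
- by apply/eqP => V'0; move: V0; rewrite -V'A V'0 mul0mx eqxx.
- exact: plR.
- exact: plR.
- exact: sconj_pullG.
- exact: (@pullinvK R n W D P hW K jacK Y G YG).
- exact: (ev_pullG hW hq0 evA frame).
- by move=> k i j; exact: (ev_dzs_pullG hW hol hq0 evA evdA).
- by move=> k i j; exact: (kahler_pullG hW hol).
- by move=> i j; exact: (static_pullG hW st).
- by rewrite -(rmorph1 pl) -[pl h * pl h]rmorphM -rmorphB -[pl psi * _]rmorphM psiE.
- exact: (gradlog_pull hW hol).
- exact: (gradlogb_pull hW hol).
- by move=> k; rewrite (dzs_pull hW hol) big1// => r _; rewrite zchi rmorph0 mulr0.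
- by move=> k; rewrite (dzbs_pull hW hol) big1// => r _; rewrite zbchi rmorph0 mulr0.
- exact: (heat_f_pull hW hol st jacK).
- exact: (heat_h_pull hW hol st jacK).
- by move=> v; rewrite NM; exact: N_psd.
- exact: (minimum_dts qR q0 q_ge0).
- by move=> k; exact: (minimum_dzs qR q0 q_ge0).
- by move=> k; exact: (minimum_dzbs qR q0 q_ge0).
- by move=> k; exact: (minimum_ddb qR q0 q_ge0).
- move=> U; rewrite (curvature_pull hW hol hq0 evA evdA).
  apply: le_trans (curvature_ge _ _); rewrite sbisect_modelE !gA.
  rewrite le_eqVlt; apply/orP; left; apply/eqP; congr (_ * (_ + _)).
    rewrite mulrC; congr (_ * _); apply: eq_bigr => k _; exact: normCK.
  rewrite -norm_conjC; congr (`|_| ^+ 2); rewrite rmorph_sum; apply: eq_bigr => k _.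
  by rewrite rmorphM/= conjCK mulrC.
- by rewrite (ev_pl hW W0 hq0).
- by rewrite (dts_pull hW st) (ev_pl hW W0 hq0).
- by rewrite (ev_pl hW W0 hq0).
- by rewrite (ev_pl hW W0 hq0).
Qed.

End NullVector.

(** * Smooth functions read in a chart *)

Section HeatAlgebra.
Context {S : comNzRingType} {n : nat} (zd zbd : 'I_n -> derivation S) (td : derivation S).
Variables (Y : 'I_n -> 'I_n -> S) (a U Ui f : S).
Hypothesis UiU : Ui * U = 1.
Hypothesis zf : forall k, U * zd k f = zd k U.
Hypothesis zbf : forall k, U * zbd k f = zbd k U.
Hypothesis tf : U * td f = td U.
Hypothesis heatU : td U = metric_trace Y (fun k l => zd k (zbd l U)) + a * (U * f).

Lemma cancelU x y : U * x = U * y -> x = y.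
Proof. by move=> e; rewrite -[x]mul1r -[y]mul1r -UiU -!mulrA e. Qed.

Lemma metric_traceZ c X : metric_trace Y (fun k l => c * X k l) = c * metric_trace Y X.
Proof.
rewrite /metric_trace mulr_sumr; apply: eq_bigr => k _.
by rewrite mulr_sumr; apply: eq_bigr => l _; rewrite mulrCA.
Qed.

Lemma metric_traceD X X' :
  metric_trace Y (fun k l => X k l + X' k l) = metric_trace Y X + metric_trace Y X'.
Proof.
rewrite /metric_trace -big_split; apply: eq_bigr => k _.
by rewrite -big_split; apply: eq_bigr => l _; rewrite mulrDr.
Qed.

Lemma metric_trace_eq X X' : (forall k l, X k l = X' k l) ->
  metric_trace Y X = metric_trace Y X'.
Proof. by move=> e; apply: eq_bigr => k _; apply: eq_bigr => l _; rewrite e. Qed.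

(** [U = exp f] is known to the ring only through [U * d f = d U], and differentiating this relation
    once more suffices. *)
Lemma hess_exp k l : zd k (zbd l U) = U * Xf zd zbd f k l.
Proof. by rewrite -zbf dfunM -zf /Xf; ring. Qed.

Lemma heat_log : td f = metric_trace Y (Xf zd zbd f) + a * f.
Proof.
apply: cancelU; rewrite tf heatU (metric_trace_eq hess_exp) metric_traceZ.
by ring.
Qed.

Variables (V h l : S).
Hypothesis VE : V = U * h.
Hypothesis heatV : td V = metric_trace Y (fun k m => zd k (zbd m V)) + a * (V * (f + l)).

Lemma hess_quotient k m : zd k (zbd m V) = U * (h * Xf zd zbd f k m + Xh zd zbd f h k m).
Proof.
rewrite VE dfunM drvD !dfunM hess_exp -zbf -zf /Xf /Xh; ring.
Qed.

Lemma heat_quotient : td h = metric_trace Y (Xh zd zbd f h) + a * (h * l).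
Proof.
(* Adding [td U * h] completes the Leibniz rule for [V = U * h], so the heat equations of [V] and
   [U] can be substituted. *)
apply: cancelU; apply: (addrI (td U * h)); rewrite -dfunM -VE heatV.
rewrite (metric_trace_eq hess_quotient) metric_traceZ metric_traceD metric_traceZ.
rewrite heatU (metric_trace_eq hess_exp) metric_traceZ VE.
by ring.
Qed.

End HeatAlgebra.

(** * From the operators of the statement to derivations on space-time *)

Section Bridge.
Context {R : realType} {n : nat}.
Local Notation C := R[i].
Local Notation E := (spacetime R n).
Implicit Types (z y : Cn R n) (s t : R) (k l : 'I_n).

Lemma derive_slice (phi : E -> R^o) (w z : Cn R n) t :
  'D_((w, 0) : E) phi (z, t) = 'D_w (fun y => phi (y, t) : R^o) z.
Proof.
rewrite /derive; set g1 := (fun h => _); set g2 := (fun h => _).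
suff -> : g1 = g2 by []; apply/funext => h; rewrite /g1 /g2 /=.
congr (_ *: (phi _ - _)); congr (_, _) => /=.
by rewrite scaler0 add0r.
Qed.

Lemma near_slice (W : domain E) z t : W (z, t) -> \forall y \near z, W (y, t).
Proof.
move=> Wq; have c : (fun y => (y, t) : E) @ z --> ((z, t) : E).
  by apply: (@cvg_pair _ _ _ (nbhs z) (nbhs z) (nbhs (t : R^o))); [exact: cvg_id|exact: cvg_cst].
have nW : nbhs ((z, t) : E) (W : set E) by apply: open_nbhs_nbhs; split=> //; exact: dset_open.
exact: c _ nW.
Qed.

Section Slices.
Context (W : domain E) (phi : smf W) z t (Wq : W (z, t)) (F : Cn R n -> C).
Hypothesis FE : forall y (Wy : W (y, t)), F y = ev Wy phi.

Lemma dirC_slice (w : Cn R n) : dirC w F z = cderiv ((w, 0) : E) phi (z, t).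
Proof.
by apply: complex_ext; rewrite /= derive_slice; apply: near_eq_derive;
  apply: filterS (near_slice Wq) => y Wy; rewrite (FE Wy).
Qed.

Lemma dz_slice k : dz k F z = ev Wq (dzs k phi).
Proof.
rewrite dzsE evM evD evM !ev_sconst !(ev_sder Wq) /dz /dx /dy !dirC_slice.
by rewrite mulrC mulNr.
Qed.

Lemma dzb_slice k : dzb k F z = ev Wq (dzbs k phi).
Proof.
rewrite dzbsE evM evD evM !ev_sconst !(ev_sder Wq) /dzb /dx /dy !dirC_slice.
by rewrite mulrC.
Qed.

End Slices.

(** The index type of space-time is kept, with a vanishing time term, so that the space-time
    coordinate functions can be reused in [Ck_comp]. *)
Lemma Cn_sum (y : Cn R n) : y = \sum_(i : @coord_index n)
  coord_fun i ((y, 0) : E) *: (@coord_vec R n i).1.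
Proof.
have := congr1 fst (coord_sum ((y, 0) : E)); rewrite fst_sum /= => {1}->.
by apply: eq_bigr.
Qed.

Lemma smoothC_fst (U : set (Cn R n)) (W : set E) (F : Cn R n -> C) :
  open U -> open W -> (forall q, W q -> U q.1) -> smoothC U F ->
  smoothC W (fun q => F q.1).
Proof.
move=> oU oW WU [sr si].
have sc i : smooth W ((fun y : Cn R n => coord_fun i ((y, 0) : E)) \o (fst : E -> Cn R n)).
  case: i => [[k|k]|u]; [exact: (smooth_coord W (inl (inl k)))|exact: (smooth_coord W (inl (inr k)))|exact: smooth_cst].
split=> k.
  exact: (@Ck_comp R E (Cn R n) _ _ _ Cn_sum k W U fst (fun y => complex.Re (F y)) oW oU WU sc (sr k)).
exact: (@Ck_comp R E (Cn R n) _ _ _ Cn_sum k W U fst (fun y => complex.Im (F y)) oW oU WU sc (si k)).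
Qed.

Section Elements.
Context {W : domain E}.
Let oW := dset_open W.

Lemma real_element (f : smf W) (F : E -> R) :
  (forall p (Wp : W p), ev Wp f = (F p)%:C) -> sconj f = f.
Proof.
move=> fE; apply: evP => p Wp; rewrite ev_sconj fE.
by apply: complex_ext; rewrite /= ?oppr0.
Qed.

Lemma smooth_re_element (f : smf W) (F : E -> R) :
  (forall p (Wp : W p), ev Wp f = (F p)%:C) -> smooth W (F : E -> R^o).
Proof.
move=> fE; apply: (smooth_ext oW) (smf_smooth f).1 => p Wp.
by rewrite -[f p]/(ev Wp f) fE.
Qed.

Lemma ev_sder_re (f : smf W) (F : E -> R) w p (Wp : W p) :
  (forall p (Wp : W p), ev Wp f = (F p)%:C) -> ev Wp (sder w f) = ('D_w (F : E -> R^o) p)%:C.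
Proof.
move=> fE; rewrite (ev_sder_real Wp w (real_element fE)); congr (_%:C).
apply: near_eq_derive; apply: (near_open oW Wp) => y Wy.
by rewrite -[f y]/(ev Wy f) fE.
Qed.

Lemma log_element (f : smf W) (F : E -> R) :
  (forall p (Wp : W p), ev Wp f = (F p)%:C) -> (forall p, W p -> 0 < F p) ->
  exists l : smf W, (forall p (Wp : W p), ev Wp l = (ln (F p))%:C) /\
    forall w, f * sder w l = sder w f.
Proof.
move=> fE F0; have sF := smooth_re_element fE.
pose l : smf W := mkS (smoothC_real (smooth_ln oW F0 sF)).
have lE p (Wp : W p) : ev Wp l = (ln (F p))%:C by exact: ev_mkS.
exists l; split=> // w; apply: evP => p Wp; rewrite evM fE (ev_sder_re w Wp lE) (ev_sder_re w Wp fE).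
have [_ ->] := is_derive_ln (F0 _ Wp) (smooth_derivable sF Wp : derivable _ _ w).
by rewrite -rmorphM mulrA mulfV ?mul1r// gt_eqF// F0.
Qed.

Lemma sder_log_ops (f l : smf W) : (forall w, f * sder w l = sder w f) ->
  [/\ forall k, f * dzs k l = dzs k f, forall k, f * dzbs k l = dzbs k f &
      f * dts l = dts f].
Proof.
move=> fl; split=> [k|k|]; last by rewrite !dtsE fl.
  by rewrite !dzsE mulrCA mulrDr fl [f * (_ * _)]mulrCA fl.
by rewrite !dzbsE mulrCA mulrDr fl [f * (_ * _)]mulrCA fl.
Qed.

Lemma static_element (f : smf W) (F : Cn R n -> C) :
  (forall q (Wq : W q), ev Wq f = F q.1) -> dts f = 0.
Proof.
move=> fE; apply: evP => q Wq; rewrite dtsE (ev_sder Wq) ev0.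
transitivity (cderiv et (fun q : E => F q.1) q).
  by apply: (cderiv_ext _ oW Wq) => q' Wq'; exact: (fE _ Wq').
have e (H : Cn R n -> R^o) : 'D_et (fun q : E => H q.1) q = 0.
  rewrite -[RHS](@derive_cst R E R^o (H q.1) q et) /derive.
  set g1 := (fun h => _); set g2 := (fun h => _).
  suff -> : g1 = g2 by []; apply/funext => r; rewrite /g1 /g2 /=.
  by rewrite scaler0 add0r.
apply: complex_ext; first exact: (e (fun y => complex.Re (F y))).
exact: (e (fun y => complex.Im (F y))).
Qed.

Lemma exp_time_element (b : R) : exists e : smf W,
  [/\ forall p (Wp : W p), ev Wp e = (expR (b * p.2))%:C,
      dts e = sconst b%:C * e, forall k, dzs k e = 0 & forall k, dzbs k e = 0].
Proof.
pose g : E -> R^o := fun q => b * q.2.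
have sg : smooth W g.
  apply: (smooth_ext oW _ (smooth_mul oW (smooth_cst W b) (smooth_coord W (inr tt)))).
  by move=> p _.
pose e : smf W := mkS (smoothC_real (smooth_exp oW sg)).
have eE p (Wp : W p) : ev Wp e = (expR (b * p.2))%:C by exact: ev_mkS.
have dg w p : 'D_w g p = b * w.2.
  rewrite (_ : g = b *: (coord_fun (inr tt) : E -> R^o)); last by apply/funext.
  rewrite deriveZ ?derive_coord_fun//.
  exact: (@smooth_derivable _ _ setT _ _ _ (smooth_coord setT (inr tt))).
have sE w : sder w e = sconst (b * w.2)%:C * e.
  apply: evP => p Wp; rewrite (ev_sder_re w Wp eE) evM ev_sconst eE -rmorphM; congr (_%:C).
  have [_ ->] := is_derive_real_comp (is_derive_expR (g p)) (smooth_derivable sg Wp : derivable _ _ w).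
  by rewrite dg mulrC.
exists e; split=> [//||k|k].
- by rewrite dtsE sE/= mulr1.
- by rewrite dzsE !sE /= mulr0 rmorph0 !mul0r mulr0 addr0 mulr0.
- by rewrite dzbsE !sE /= mulr0 rmorph0 !mul0r mulr0 addr0 mulr0.
Qed.

End Elements.

(** [time_derive] is a limit within [times T]; at an interior time it is the usual two-sided
    derivative, hence the derivative of [phi] along [et]. *)
Lemma time_derive_slice (W : domain E) (phi : smf W) (T : \bar R) z t (Wq : W (z, t)) (f : R -> R) :
  0 < t -> (t%:E < T)%E -> (forall s (Ws : W (z, s)), (f s)%:C = ev Ws phi) ->
  sconj phi = phi -> (time_derive T f t)%:C = ev Wq (dts phi).
Proof.
move=> t0 tT fE phiR; rewrite dtsE (ev_sder_real Wq et phiR); congr (_%:C).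
set g : E -> R^o := fun q => complex.Re (phi q).
have fg s : W (z, s) -> f s = g (z, s).
  by move=> Ws; rewrite /g -[phi _]/(ev Ws phi) -fE.
have dg : derivable g (z, t) et by exact: smooth_derivable (smf_smooth phi).1 Wq.
have nW : \forall s \near t, W (z, s).
  have c : (fun s : R => (z, s) : E) @ t --> ((z, t) : E).
    by apply: (@cvg_pair _ _ _ (nbhs t) (nbhs z) (nbhs (t : R^o))); [exact: cvg_cst|exact: cvg_id].
  have nW : nbhs ((z, t) : E) (W : set E) by apply: open_nbhs_nbhs; split=> //; exact: dset_open.
  exact: c _ nW.
have sh : (fun s : R => s - t) @ t^' --> (0 : R)^'.
  move=> A nA; have {}nA : \forall h \near (0 : R), h != 0 -> A h := nA.
  have c : (fun s : R => s - t) @ t --> (0 : R).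
    rewrite -(subrr t).
    by apply: (@cvgB R R^o R (nbhs t) _ id (cst t)); [exact: cvg_id|exact: cvg_cst].
  have H : \forall s \near t, s - t != 0 -> A (s - t) := c _ nA.
  suff : \forall s \near t, s != t -> A (s - t) by [].
  by apply: (filterS _ H) => s + st; apply; rewrite subr_eq0.
have lim0 : (fun h : R => h^-1 * (g (z, h + t) - g (z, t)) : R^o) @ 0^' --> ('D_et g (z, t) : R^o).
  have := dg; rewrite /derivable /derive => /(_ _) H.
  rewrite (_ : (fun h : R => _) = (fun h : R => h^-1 *: (g (h *: (et : E) + (z, t)) - g (z, t)))) //.
  apply/funext => h; congr (_ * (g _ - _)); congr (_, _); rewrite /=; last by rewrite [_ *: 1]mulr1.
  by rewrite scaler0 add0r.
have lim1 : (fun s : R => (s - t)^-1 * (f s - f t) : R^o) @ t^' --> ('D_et g (z, t) : R^o).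
  have H := cvg_comp _ _ sh lim0.
  apply: (cvg_trans _ H); apply: near_eq_cvg; apply: nbhs_dnbhs; apply: filterS nW => s Ws /=.
  by rewrite subrK !fg.
have nT : \forall s \near t, times T s.
  have h1 : \forall s \near t, 0 < s by exact: lt_nbhsr.
  have h2 : \forall s \near t, (s%:E < T)%E.
    case: T tT => [r| |]//; rewrite ?lte_fin => tr.
      by apply: (filterS _ (lt_nbhsl tr)) => s; rewrite lte_fin.
    by apply: (filterS _ h1) => s _; rewrite ltry.
  by apply: filterS2 h1 h2 => s s0 sT; split=> //; exact: ltW.
(* All times near [t] belong to [times T], so the restricted filter is the whole punctured one. *)
rewrite /time_derive (_ : within (times T) t^' = t^'); first by apply/cvg_lim.
apply/funext => A; apply/propext; split=> H; last by apply: filterS H => s.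
by apply: filterS2 (nbhs_dnbhs nT) H => s sT; exact.
Qed.

End Bridge.

(** * Local models of the metric and of the two solutions *)

Section ChartModel.
Context {R : realType} {n : nat} {M : complexManifold R n} (g : kahlerMetric M)
  (a : R) (T : \bar R) (u v : M -> R -> R).
Local Notation C := R[i].
Local Notation E := (spacetime R n).
Implicit Types (c : chart_index M) (z y : Cn R n) (s t : R) (i j k : 'I_n).

(* [Fu] and [Fv] extend [u] and [v] smoothly, also across [t = 0]; [f], [h], [psi]
   are built from the extensions. *)
Record chart_model c := ChartModel {
  cmW :> domain E;
  cm_cimg : forall q, cmW q -> cimg (atlas c) q.1;
  Fu : E -> R;
  Fv : E -> R;
  Fu_gt0 : forall q, cmW q -> 0 < Fu q;
  Fv_gt0 : forall q, cmW q -> 0 < Fv q;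
  Fv_lt : forall q, cmW q -> Fv q < Fu q;
  Fu_agree : forall q, cmW q -> times T q.2 -> u (cinv (atlas c) q.1) q.2 = Fu q;
  Fv_agree : forall q, cmW q -> times T q.2 -> v (cinv (atlas c) q.1) q.2 = Fv q;
  cmU : smf cmW; cmV : smf cmW; cmUi : smf cmW;
  cmf : smf cmW; cmfv : smf cmW; cmpsi : smf cmW;
  cmG : 'I_n -> 'I_n -> smf cmW;
  cmY : 'I_n -> 'I_n -> smf cmW;
  ev_cmU : forall q (Wq : cmW q), ev Wq cmU = (Fu q)%:C;
  ev_cmV : forall q (Wq : cmW q), ev Wq cmV = (Fv q)%:C;
  cmUiU : cmUi * cmU = 1;
  ev_cmf : forall q (Wq : cmW q), ev Wq cmf = (ln (Fu q))%:C;
  ev_cmfv : forall q (Wq : cmW q), ev Wq cmfv = (ln (Fv q))%:C;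
  sder_cmf : forall w, cmU * sder w cmf = sder w cmU;
  sder_cmfv : forall w, cmV * sder w cmfv = sder w cmV;
  cmpsiE : cmpsi * (1 - cmV * cmUi * (cmV * cmUi)) = 1;
  ev_cmG : forall q (Wq : cmW q) i j, ev Wq (cmG i j) = g c q.1 i j;
  cmYG : forall i j, \sum_m cmY i m * cmG m j = (i == j)%:R }.

Hypothesis u_gt0 : forall x t, times T t -> 0 < u x t.
Hypothesis v_gt0 : forall x t, times T t -> 0 < v x t.
Hypothesis v_lt : forall x t, times T t -> v x t < u x t.
Hypothesis u_smooth : smooth_spacetime T u.
Hypothesis v_smooth : smooth_spacetime T v.

(** The open set [O] allows shrinking: later it is a time window, which keeps the model where the
    heat equation holds or where positivity is already known. *)
Lemma chart_model_exists c z t (O : set E) : cimg (atlas c) z -> times T t ->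
  open O -> O (z, t) -> exists m : chart_model c, m (z, t) /\ forall q, m q -> O q.
Proof.
move=> cz Tt oO Oz.
have [Wu [F [oWu Wuz sF uF]]] := u_smooth cz Tt.
have [Wv [F' [oWv Wvz sF' vF]]] := v_smooth cz Tt.
(* The extensions are constrained only at times in [[0, T)]; positivity and [v < u] hold at the
   centre and spread to a neighbourhood by continuity, also to negative times. *)
pose D : set E := [set q | [/\ O q, Wu q, Wv q, cimg (atlas c) q.1 &
  [/\ 0 < F q, 0 < F' q & F' q < F q]]].
have oD : open D.
  rewrite openE => q [Oq Wuq Wvq cq [Fq F'q FF']].
  have cF : {for q, continuous (F : E -> R^o)} by exact: smooth_continuous sF Wuq.
  have cF' : {for q, continuous (F' : E -> R^o)} by exact: smooth_continuous sF' Wvq.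
  have n1 : \forall q' \near q, O q' by exact: open_nbhs_nbhs.
  have n2 : \forall q' \near q, Wu q' by exact: open_nbhs_nbhs.
  have n3 : \forall q' \near q, Wv q' by exact: open_nbhs_nbhs.
  have n4 : \forall q' \near q, cimg (atlas c) q'.1.
    have cf : (fst : E -> Cn R n) @ q --> q.1 by exact: cvg_fst.
    have nc : nbhs q.1 (cimg (atlas c)) by apply: open_nbhs_nbhs; split=> //; exact: cimg_open.
    exact: cf _ nc.
  have n5 : \forall q' \near q, 0 < F q' by exact: (cvgr_gt (F q) cF).
  have n6 : \forall q' \near q, 0 < F' q' by exact: (cvgr_gt (F' q) cF').
  have n7 : \forall q' \near q, 0 < F q' - F' q'.
    have cB : (fun q => F q - F' q : R^o) @ q --> (F q - F' q : R^o) by exact: (cvgB cF cF').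
    by apply: (cvgr_gt (F q - F' q) cB); rewrite subr_gt0.
  apply: (@filterS E (nbhs q) (nbhs_filter q) _ _ _
    (filterI (filterI n1 n2) (filterI (filterI n3 n4) (filterI n5 (filterI n6 n7))))).
  by move=> q' [[? ?] [[? ?] [? [?]]]]; rewrite /= subr_gt0.
have Dz : D (z, t).
  split=> //; split.
  - by rewrite -uF//; exact: u_gt0.
  - by rewrite -vF//; exact: v_gt0.
  - by rewrite -uF// -vF//; exact: v_lt.
pose W : domain E := @Domain R E D oD (z, t) Dz.
have F0 q : W q -> 0 < F q by move=> [_ _ _ _ []].
have F'0 q : W q -> 0 < F' q by move=> [_ _ _ _ []].
have FF' q : W q -> F' q < F q by move=> [_ _ _ _ []].
have WC q : W q -> cimg (atlas c) q.1 by move=> [].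
have sFW : smooth W (F : E -> R^o) by apply: smooth_sub sF => q [].
have sF'W : smooth W (F' : E -> R^o) by apply: smooth_sub sF' => q [].
pose U : smf W := mkS (smoothC_real sFW).
pose V : smf W := mkS (smoothC_real sF'W).
have UE q (Wq : W q) : ev Wq U = (F q)%:C by exact: ev_mkS.
have VE q (Wq : W q) : ev Wq V = (F' q)%:C by exact: ev_mkS.
have C0 (r : R) : r != 0 -> r%:C != 0 :> C by rewrite fmorph_eq0.
have [Ui UiU] := @sinv_exists _ _ _ U (fun q Wq =>
  eq_ind_r (fun x => x != 0) (C0 _ (lt0r_neq0 (F0 _ Wq))) (UE _ Wq)).
have [f [fE fd]] := log_element UE F0.
have [fv [fvE fvd]] := log_element VE F'0.
have hE q (Wq : W q) : ev Wq (V * Ui) = (F' q / F q)%:C.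
  have e : ev Wq Ui * (F q)%:C = 1 by rewrite -(UE _ Wq) -evM UiU ev1.
  have Fq0 : (F q)%:C != 0 :> C by apply: C0; rewrite gt_eqF// F0.
  by rewrite evM VE rmorphM fmorphV; congr (_ * _); apply: (mulIf Fq0); rewrite e mulVf.
have [psi psiE] : exists psi, psi * (1 - V * Ui * (V * Ui)) = 1.
  apply: sinv_exists => q Wq; rewrite evB ev1 evM hE -rmorphM -(rmorph1 (real_complex R)) -rmorphB.
  apply: C0; rewrite subr_eq0 eq_sym -expr2 sqrf_eq1 negb_or.
  have F'F0 : 0 < F' q / F q by rewrite divr_gt0 ?F0 ?F'0.
  by rewrite lt_eqF ?ltr_pdivrMr ?mul1r ?FF' ?F0// gt_eqF// (lt_trans _ F'F0)// ltrN10.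
have sG i j : smoothC W (fun q => g c q.1 i j).
  refine (@smoothC_fst R n (cimg (atlas c)) W (fun y => g c y i j)
    (@cimg_open R n M (atlas c)) (dset_open W) WC _).
  exact: metric_smooth.
pose G i j : smf W := mkS (sG i j).
have GE q (Wq : W q) i j : ev Wq (G i j) = g c q.1 i j by exact: ev_mkS.
pose GM := \matrix_(i, j) G i j.
have [d dG] := @sinv_exists _ _ W (\det GM) (fun q Wq => ltac:(
  rewrite -det_map_mx (_ : map_mx _ _ = g c q.1); [
    have := posdef_unit (metric_posdef g (WC _ Wq)); by rewrite unitmxE unitfE
  | by apply/matrixP => i j; rewrite !mxE; exact: GE])).
pose Y i j := (d *: \adj GM) i j.
have YG i j : \sum_m Y i m * G m j = (i == j)%:R.
  transitivity (((d *: \adj GM) *m GM) i j).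
    by rewrite mxE; apply: eq_bigr => m _; rewrite [GM _ _]mxE.
  by rewrite -scalemxAl mul_adj_mx scale_scalar_mx dG mxE.
have uA q : W q -> times T q.2 -> u (cinv (atlas c) q.1) q.2 = F q.
  case: q => q1 q2 /= [_ Wuq _ cq _] Tq; exact: uF.
have vA q : W q -> times T q.2 -> v (cinv (atlas c) q.1) q.2 = F' q.
  case: q => q1 q2 /= [_ _ Wvq cq _] Tq; exact: vF.
exists (@ChartModel c W WC F F' F0 F'0 FF' uA vA U V Ui f fv psi G Y UE VE UiU fE fvE fd fvd psiE GE YG).
by split=> // q [].
Qed.

Lemma hess_slice (W : domain E) c z t (Wq : W (z, t)) (phi : smf W) (F : M -> R) i j :
  (forall y (Wy : W (y, t)), in_chart c F y = ev Wy phi) ->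
  hess c F i j z = ev Wq (dzs i (dzbs j phi)) /\
  hess_bar c F i j z = ev Wq (dzs i (dzbs j phi)).
Proof.
move=> FE; split; first by apply: dz_slice => y Wy; exact: dzb_slice.
by rewrite comm_dzs_dzbs; apply: dzb_slice => y Wy; exact: dz_slice.
Qed.

(** The matrix of the theorem with the coefficient of [g] left free: it is used with [phi], with
    [phi - 1] and with the barrier. *)
Definition Nmx c t chi z : 'M[C]_n := \matrix_(i, j)
  (hess c (fun x => ln (u x t)) i j z + chi%:C * g c z i j
   - dz i (in_chart c (fun x => v x t / u x t)) z * dzb j (in_chart c (fun x => v x t / u x t)) z
     / (1 - (v (cinv (atlas c) z) t / u (cinv (atlas c) z) t) ^+ 2)%:C).

Lemma Nmx_tensorN (W : domain E) c z t (Wq : W (z, t)) (f h psi chi : smf W)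
    (G : 'I_n -> 'I_n -> smf W) (x : R) :
  (forall y (Wy : W (y, t)), in_chart c (fun x => ln (u x t)) y = ev Wy f) ->
  (forall y (Wy : W (y, t)), in_chart c (fun x => v x t / u x t) y = ev Wy h) ->
  ev Wq psi = ((1 - (v (cinv (atlas c) z) t / u (cinv (atlas c) z) t) ^+ 2)^-1)%:C ->
  ev Wq chi = x%:C -> (forall i j, ev Wq (G i j) = g c z i j) ->
  Nmx c t x z = \matrix_(i, j) ev Wq (tensorN f h psi chi G i j).
Proof.
move=> fS hS psiE chiE GE; apply/matrixP => i j.
rewrite !mxE /tensorN evB evD !evM chiE GE psiE.
have [-> _] := hess_slice Wq i j fS.
rewrite (dz_slice Wq hS) (dzb_slice Wq hS) fmorphV; congr (_ - _); exact: mulrC.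
Qed.

Section Facts.
Variables (c : chart_index M) (m : chart_model c).
Local Notation W := (cmW m).
Local Notation U := (cmU m).
Local Notation V := (cmV m).
Local Notation f := (cmf m).
Local Notation psi := (cmpsi m).
Local Notation G := (@cmG c m).
Local Notation Y := (@cmY c m).

Definition cmh : smf W := V * cmUi m.
Definition cml : smf W := cmfv m - f.
Local Notation h := cmh.
Local Notation l := cml.

Lemma complex_neq0R (r : R) : r != 0 -> r%:C != 0 :> C.
Proof. by rewrite fmorph_eq0. Qed.

Lemma ev_cmh q (Wq : W q) : ev Wq h = (Fv m q / Fu m q)%:C.
Proof.
have e : ev Wq (cmUi m) * (Fu m q)%:C = 1 by rewrite -(ev_cmU Wq) -evM cmUiU ev1.
have Fq0 : (Fu m q)%:C != 0 :> C by apply: complex_neq0R; rewrite gt_eqF// Fu_gt0.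
by rewrite evM ev_cmV rmorphM fmorphV; congr (_ * _); apply: (mulIf Fq0); rewrite e mulVf.
Qed.

Lemma cmVE : V = U * h.
Proof. by rewrite /cmh mulrCA [U * _]mulrC cmUiU mulr1. Qed.

Lemma ev_cml q (Wq : W q) : ev Wq l = (ln (Fv m q / Fu m q))%:C.
Proof.
rewrite /cml evB ev_cmf ev_cmfv -rmorphB; congr (_%:C).
by rewrite ln_div// posrE ?Fu_gt0 ?Fv_gt0.
Qed.

Lemma ratio_bounds q : W q -> 0 < Fv m q / Fu m q < 1.
Proof.
move=> Wq; rewrite divr_gt0 ?Fu_gt0 ?Fv_gt0//=.
by rewrite ltr_pdivrMr ?mul1r ?Fv_lt ?Fu_gt0.
Qed.

Lemma ev_cmpsi q (Wq : W q) : ev Wq psi = ((1 - (Fv m q / Fu m q) ^+ 2)^-1)%:C.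
Proof.
have e : ev Wq psi * (1 - (Fv m q / Fu m q) ^+ 2)%:C = 1.
  rewrite -(ev1 Wq) -(cmpsiE m) evM evB ev1 evM -[V * _]/h ev_cmh.
  by rewrite rmorphB rmorph1 rmorphXn.
have h1 : (1 - (Fv m q / Fu m q) ^+ 2)%:C != 0 :> C.
  have /andP[r0 r1] := ratio_bounds Wq; apply: complex_neq0R; rewrite gt_eqF// subr_gt0.
  by rewrite expr_lt1// ltW.
by apply: (mulIf h1); rewrite e fmorphV mulVf.
Qed.

Lemma cmfR : sconj f = f. Proof. exact: (real_element (@ev_cmf c m)). Qed.
Lemma cmhR : sconj h = h. Proof. exact: (real_element ev_cmh). Qed.
Lemma cmpsiR : sconj psi = psi. Proof. exact: (real_element ev_cmpsi). Qed.

Lemma sder_cml w : h * sder w l = sder w h.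
Proof.
apply: (cancelU (cmUiU m)); rewrite mulrA -cmVE /cml drvB mulrBr sder_cmfv.
rewrite [in X in X - _]cmVE dfunM cmVE mulrAC sder_cmf addrAC subrr add0r.
by [].
Qed.

Lemma matrix_cmG q (Wq : W q) : \matrix_(i, j) ev Wq (G i j) = g c q.1.
Proof. by apply/matrixP => i j; rewrite mxE ev_cmG. Qed.

Lemma cmGR i j : sconj (G i j) = G j i.
Proof.
apply: evP => q Wq; rewrite ev_sconj !ev_cmG.
by rewrite -(psd_hermitian _ _ (posdef_psd (metric_posdef g (cm_cimg Wq)))).
Qed.

Lemma cm_kahler k i j : dzs k (G i j) = dzs i (G k j).
Proof.
apply: evP => -[z t] Wq.
rewrite -(@dz_slice _ _ W (G i j) z t Wq (fun y => g c y i j)); last by move=> y Wy; rewrite ev_cmG.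
rewrite -(@dz_slice _ _ W (G k j) z t Wq (fun y => g c y k j)); last by move=> y Wy; rewrite ev_cmG.
exact: (metric_kahler g (cm_cimg Wq)).
Qed.

Lemma cm_static i j : dts (G i j) = 0.
Proof. by apply: (@static_element _ _ _ _ (fun y => g c y i j)) => q Wq; exact: ev_cmG. Qed.

Lemma ev_cmY q (Wq : W q) i j : ev Wq (Y i j) = invmx (g c q.1) i j.
Proof.
pose YM := \matrix_(i, j) ev Wq (Y i j).
have e : YM *m g c q.1 = 1%:M.
  apply/matrixP => p r; rewrite !mxE.
  have := congr1 (ev Wq) (cmYG m p r); rewrite ev_sum rmorph_nat => <-.
  by apply: eq_bigr => k _; rewrite mxE evM ev_cmG.
have uG := posdef_unit (metric_posdef g (cm_cimg Wq)).
by rewrite -[invmx _]mul1mx -e -mulmxA mulmxV// mulmx1 mxE.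
Qed.

Section TimeSlice.
Variables (z : Cn R n) (t : R) (Wq : W (z, t)).

Lemma christoffel_slice p i k : christoffel g c p i k z = ev Wq (sgamma G Y p i k).
Proof.
rewrite /christoffel /sgamma ev_sum; apply: eq_bigr => r _.
rewrite evM ev_cmY /ginv; congr (_ * _).
by apply: dz_slice => y Wy; rewrite ev_cmG.
Qed.

End TimeSlice.

Lemma curv_slice z t (Wq : W (z, t)) i j k r : curv g c z i j k r = ev Wq (scurv G Y i j k r).
Proof.
rewrite /curv /scurv evN ev_sum; congr (- _); apply: eq_bigr => p _.
rewrite evM ev_cmG; congr (_ * _).
by apply: dzb_slice => y Wy; exact: christoffel_slice.
Qed.

Lemma bisect_slice z t (Wq : W (z, t)) x w : bisect g c z x w = sbisect Wq G Y x w.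
Proof.
apply: eq_bigr => i _; apply: eq_bigr => j _; apply: eq_bigr => k _; apply: eq_bigr => r _.
by rewrite (curv_slice Wq).
Qed.

Lemma bisect_model_slice z t (Wq : W (z, t)) x w :
  bisect_model g c z x w = sbisect_model Wq G x w.
Proof.
apply: eq_bigr => i _; apply: eq_bigr => j _; apply: eq_bigr => k _; apply: eq_bigr => r _.
by rewrite !ev_cmG.
Qed.

Lemma laplacian_slice z t (Wq : W (z, t)) (phi : smf W) (F : M -> R) :
  (forall y (Wy : W (y, t)), in_chart c F y = ev Wy phi) ->
  laplacian g c F z = ev Wq (metric_trace Y (fun k r => dzs k (dzbs r phi))).
Proof.
move=> FE; rewrite /laplacian /metric_trace ev_sum mulr_sumr; apply: eq_bigr => k _.
rewrite ev_sum mulr_sumr; apply: eq_bigr => r _.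
have [-> ->] := hess_slice Wq k r FE.
by rewrite evM ev_cmY /ginv mulrCA mulV2_double.
Qed.

Lemma Nmx_slice z t (Wq : W (z, t)) (chi : smf W) (x : R) : times T t ->
  ev Wq chi = x%:C ->
  Nmx c t x z = \matrix_(i, j) ev Wq (tensorN f h psi chi G i j).
Proof.
move=> Tt chiE; apply: Nmx_tensorN => //.
- by move=> y Wy; rewrite /in_chart ev_cmf (Fu_agree Wy).
- by move=> y Wy; rewrite /in_chart ev_cmh (Fu_agree Wy)// (Fv_agree Wy).
- by rewrite ev_cmpsi (Fu_agree Wq)// (Fv_agree Wq).
- by move=> i j; rewrite ev_cmG.
Qed.

Hypothesis heat_u : heat_solution g a T u.
Hypothesis heat_v : heat_solution g a T v.
Hypothesis W_time : forall q, W q -> 0 < q.2 /\ (q.2%:E < T)%E.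

Lemma W_times q : W q -> times T q.2.
Proof. by move=> /W_time[q0 qT]; split=> //; exact: ltW. Qed.

(** The smooth extension solves the equation only where it agrees with [w]; [W_time] keeps the
    domain inside [0 < t < T], where the time derivative is also two-sided. *)
Lemma heat_element (w : M -> R -> R) (Fw : E -> R) (phi lphi : smf W) :
  heat_solution g a T w ->
  (forall q (Wq : W q), ev Wq phi = (Fw q)%:C) ->
  (forall q (Wq : W q), ev Wq lphi = (ln (Fw q))%:C) ->
  (forall q, W q -> w (cinv (atlas c) q.1) q.2 = Fw q) ->
  dts phi = metric_trace Y (fun k r => dzs k (dzbs r phi)) + sconst a%:C * (phi * lphi).
Proof.
move=> [_ hw] phiE lE wE; apply: evP => -[z t] Wq.
have [x cx xz] := cm_cimg Wq.
have [t0 tT] := W_time Wq.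
have xE : cinv (atlas c) z = x by rewrite -[z]xz cmapK.
have := hw c x t cx (W_times Wq); rewrite [cmap _ _]xz.
rewrite (@time_derive_slice _ _ W phi T z t Wq (w x)) //; first last.
- exact: (real_element phiE).
- by move=> s Ws; rewrite phiE -(wE _ Ws)/= xE.
move=> ->; rewrite evD !evM ev_sconst phiE lE -(wE _ Wq)/= xE; congr (_ + _); last first.
  by rewrite !rmorphM mulrA.
by apply: laplacian_slice => y Wy; rewrite /in_chart phiE -(wE _ Wy).
Qed.

Lemma cm_heat_f : dts f = metric_trace Y (Xf dzs dzbs f) + sconst a%:C * f.
Proof.
have [zf zbf tf] := sder_log_ops (sder_cmf m).
apply: (heat_log (cmUiU m) zf zbf tf).
apply: (heat_element heat_u (@ev_cmU c m) (@ev_cmf c m)) => q Wq.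
by rewrite (Fu_agree Wq)//; exact: W_times.
Qed.

Lemma cm_heat_h : dts h = metric_trace Y (Xh dzs dzbs f h) + sconst a%:C * (h * l).
Proof.
have [zf zbf tf] := sder_log_ops (sder_cmf m).
apply: (heat_quotient (cmUiU m) zf zbf _ cmVE).
  apply: (heat_element heat_u (@ev_cmU c m) (@ev_cmf c m)) => q Wq.
  by rewrite (Fu_agree Wq)//; exact: W_times.
have -> : f + l = cmfv m by rewrite /cml addrC subrK.
apply: (heat_element heat_v (@ev_cmV c m) (@ev_cmfv c m)) => q Wq.
by rewrite (Fv_agree Wq)//; exact: W_times.
Qed.

End Facts.
End ChartModel.

(** * The barrier *)

Section PositivityNearby.
Context {R : realType} {n : nat}.
Local Notation C := R[i].
Local Notation E := (spacetime R n).

Lemma norm_le_Re_Im (x : C) : `|x| <= (`|complex.Re x| + `|complex.Im x|)%:C.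
Proof.
have nr (r : R) : `|r%:C| = `|r|%:C :> C.
  by rewrite normc_def/= expr0n addr0 sqrtr_sqr.
have ni : `|imagC| = 1 :> C by rewrite normc_def/= expr0n add0r expr1n sqrtr1.
have {1}-> : x = (complex.Re x)%:C + imagC * (complex.Im x)%:C.
  by case: x => p r; apply: complex_ext => /=; ring.
apply: le_trans (ler_normD _ _) _; rewrite normrM ni mul1r !nr.
by rewrite [X in _ <= X]rmorphD.
Qed.

(** The radius from [posdef_open] is shared between real and imaginary parts, and one neighbourhood
    serves the finitely many entries. *)
Lemma posdef_near (W : domain E) (B : 'I_n -> 'I_n -> smf W) p (Wp : W p) :
  (forall i j, sconj (B i j) = B j i) -> posdef (\matrix_(i, j) ev Wp (B i j)) ->
  \forall q \near p, forall Wq : W q, posdef (\matrix_(i, j) ev Wq (B i j)).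
Proof.
move=> BR /posdef_open[e e0 eP].
have e2 : 0 < e / 2 by rewrite divr_gt0.
have near1 (x : 'I_n * 'I_n) : \forall q \near p,
    `|complex.Re (B x.1 x.2 p) - complex.Re (B x.1 x.2 q)| <= e / 2 /\
    `|complex.Im (B x.1 x.2 p) - complex.Im (B x.1 x.2 q)| <= e / 2.
  have [cr ci] := smf_continuous (B x.1 x.2) Wp.
  by apply: filterI; [move/cvgrPdist_le: cr; apply|move/cvgrPdist_le: ci; apply].
have nW : \forall q \near p, W q by apply: open_nbhs_nbhs; split=> //; exact: dset_open.
have Fp : Filter (nbhs p) := nbhs_filter p.
apply: (@filterS E (nbhs p) Fp _ _ _ (@filter_forall E _ _ (nbhs p) Fp near1)).
move=> q Hq Wq; apply: eP => i j; first by rewrite !mxE -ev_sconj BR.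
have [hr hi] := Hq (i, j); rewrite !mxE.
apply: le_trans (norm_le_Re_Im _) _; rewrite lecR.
rewrite ReD ReN ImD ImN distrC [X in _ + X]distrC.
by rewrite [leRHS]splitr lerD.
Qed.

End PositivityNearby.

Section Barrier.
Context {R : realType} {n : nat}.
Local Notation C := R[i].
Local Notation E := (spacetime R n).
Variables (a eps : R).
Hypothesis a0 : a != 0.

(** [phi = a p], and [p] satisfies the logistic equation [p' = a (p - p^2)], so [phi'], [phi''] and
    the barrier are polynomials in [p]. *)
Definition barrier_p (t : R) := (1 - expR (- a * t))^-1.
Definition barrier (t : R) := a * barrier_p t + eps * (a ^+ 2 * (barrier_p t - barrier_p t ^+ 2)).
Definition dbarrier (t : R) := a ^+ 2 * (barrier_p t - barrier_p t ^+ 2)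
  + eps * (a ^+ 3 * (1 - 2 * barrier_p t) * (barrier_p t - barrier_p t ^+ 2)).

Lemma expR_neq1 t : 0 < t -> 1 - expR (- a * t) != 0.
Proof.
move=> t0; rewrite subr_eq0 eq_sym -expR0; apply/eqP => /expR_inj/eqP.
by rewrite mulf_eq0 oppr_eq0 (negbTE a0) gt_eqF.
Qed.

(* [p - p^2 = - e^{-at} p^2], so [phi' = a^2 (p - p^2)] is negative. *)
Lemma barrier_p_lt t : 0 < t -> barrier_p t - barrier_p t ^+ 2 < 0.
Proof.
move=> t0; have e := expR_neq1 t0; rewrite /barrier_p.
move: e (expR_gt0 (- a * t)); set x := expR _ => e x0.
have -> : (1 - x)^-1 - (1 - x)^-1 ^+ 2 = - (x * (1 - x)^-1 ^+ 2) by field.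
by rewrite oppr_lt0 mulr_gt0// exprn_even_gt0//= invr_neq0.
Qed.

(** [phi] solves the Riccati equation and [phi'] its linearisation at [phi], as one sees by
    differentiating the equation; only the term quadratic in [eps] remains. *)
Lemma barrier_supersolution t : 0 < t -> 0 < eps ->
  0 < dbarrier t + barrier t ^+ 2 - a * barrier t.
Proof.
move=> t0 e0; have -> : dbarrier t + barrier t ^+ 2 - a * barrier t =
    (eps * (a ^+ 2 * (barrier_p t - barrier_p t ^+ 2))) ^+ 2.
  by rewrite /dbarrier /barrier; ring.
have p0 : barrier_p t - barrier_p t ^+ 2 != 0 by rewrite lt_eqF// barrier_p_lt.
have h : eps * (a ^+ 2 * (barrier_p t - barrier_p t ^+ 2)) != 0.
  by apply: mulf_neq0; [rewrite gt_eqF|apply: mulf_neq0 => //; exact: expf_neq0].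
by rewrite exprn_even_gt0.
Qed.

Lemma barrier_lt t : 0 < t -> 0 < eps -> barrier t < a / (1 - expR (- a * t)).
Proof.
move=> t0 e0; rewrite /barrier -/(barrier_p t) gtrDl pmulr_rlt0//.
by rewrite pmulr_rlt0 ?barrier_p_lt// exprn_even_gt0.
Qed.

Lemma barrier_algebra (S : comNzRingType) (A p q x : S) :
  p * (1 - x) = 1 -> q * (1 - x) + p * (A * x) = 0 -> q = - (p * (p * (A * x))).
Proof.
move=> px e0; have -> : q = p * (q * (1 - x) + p * (A * x)) - p * (p * (A * x)).
  by transitivity (p * (1 - x) * q); [rewrite px mul1r|ring].
by rewrite e0 mulr0 sub0r.
Qed.

(** The exponential [x] is differentiated directly, and [p] implicitly through [p * (1 - x) = 1]. *)
Lemma barrier_element (W : domain E) : (forall q : E, W q -> 0 < q.2) ->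
  exists chi : smf W, [/\ forall q (Wq : W q), ev Wq chi = (barrier q.2)%:C,
    forall q (Wq : W q), ev Wq (dts chi) = (dbarrier q.2)%:C,
    forall k, dzs k chi = 0 & forall k, dzbs k chi = 0].
Proof.
move=> W0; have [x [xE tx zx zbx]] := @exp_time_element R n W (- a).
have [p px] : exists p, p * (1 - x) = 1.
  apply: sinv_exists => q Wq; rewrite evB ev1 xE -(rmorph1 (real_complex R)) -rmorphB.
  by rewrite fmorph_eq0 expR_neq1// W0.
have pE q (Wq : W q) : ev Wq p = (barrier_p q.2)%:C.
  have e := congr1 (ev Wq) px; rewrite evM evB ev1 xE in e.
  have h : (1 - expR (- a * q.2))%:C != 0 :> C by rewrite fmorph_eq0 expR_neq1// W0.
  apply: (mulIf h); rewrite /barrier_p fmorphV mulVf//.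
  by rewrite -e rmorphB rmorph1.
have kill (d : derivation (smf W)) : d x = 0 -> d p = 0.
  move=> dx; have e : d p * (1 - x) = 0.
    by have := congr1 (fun y => d y) px; rewrite dfunM drvB dfun1 dx subrr mulr0 addr0.
  transitivity (p * (d p * (1 - x))); first by rewrite mulrCA px mulr1.
  by rewrite e mulr0.
have tp : dts p = - (p * (p * (sconst a%:C * x))).
  have := congr1 (fun y => dts y) px.
  rewrite dfunM drvB dfun1 tx sub0r => e; apply: (barrier_algebra px).
  have eN : sconst (- a)%:C = - sconst a%:C :> smf W by rewrite -rmorphN; congr sconst; exact: rmorphN.
  by rewrite -[RHS]e eN mulNr opprK.
pose chi := sconst a%:C * p + sconst (eps * a ^+ 2)%:C * (p - p * p).
have kc (d : derivation (smf W)) : kills_const d -> d x = 0 -> d chi = 0.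
  move=> kd dx; rewrite /chi drvD !dfunM !kd drvB dfunM (kill d dx).
  by rewrite !(mul0r, mulr0, addr0, subr0).
exists chi; split=> [q Wq|q Wq|k|k].
- rewrite /chi evD !evM !ev_sconst evB evM pE -!rmorphM -rmorphB -rmorphM -rmorphD.
  by congr (_%:C); rewrite /barrier; ring.
- have kd := @kills_dts R n W.
  rewrite /chi drvD !dfunM !kd !mul0r !add0r drvB dfunM tp.
  rewrite evD !evM !ev_sconst evB evD !evM evN !evM ev_sconst xE pE.
  rewrite -!(rmorphM, rmorphN, rmorphD, rmorphB).
  have h := expR_neq1 (W0 _ Wq).
  congr (_%:C); rewrite /dbarrier /barrier_p.
  by move: h; set y := expR _ => h; field.
- exact: (kc _ (@kills_dzs R n W k)).
- exact: (kc _ (@kills_dzbs R n W k)).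
Qed.

End Barrier.

(** * The first time positivity fails *)

Section Global.
Context {R : realType} {n : nat} {M : complexManifold R n} (g : kahlerMetric M)
  (a : R) (T : \bar R) (u v : M -> R -> R).
Local Notation C := R[i].
Local Notation E := (spacetime R n).
Implicit Types (c d : chart_index M) (z y : Cn R n) (s t : R) (i j k : 'I_n) (x : M).
Hypothesis u_gt0 : forall x t, times T t -> 0 < u x t.
Hypothesis v_gt0 : forall x t, times T t -> 0 < v x t.
Hypothesis v_lt : forall x t, times T t -> v x t < u x t.
Hypothesis heat_u : heat_solution g a T u.
Hypothesis heat_v : heat_solution g a T v.
Local Notation N := (Nmx g u v).

Lemma chart_model_at c z t (O : set E) : cimg (atlas c) z -> times T t ->
  open O -> O (z, t) -> exists m : chart_model g T u v c, m (z, t) /\ forall q, m q -> O q.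
Proof. exact: (chart_model_exists g u_gt0 v_gt0 v_lt heat_u.1 heat_v.1). Qed.

Lemma cimg_cmap c x : cdom (atlas c) x -> cimg (atlas c) (cmap (atlas c) x).
Proof. by move=> cx; exists x. Qed.

(** * Independence of the chart *)

Section Transition.
Variables (c d : chart_index M).
Local Notation tau := (transition (atlas c) (atlas d)).
Local Notation O := (overlap (atlas c) (atlas d)).

Lemma overlapP z : O z -> [/\ cimg (atlas c) z, cdom (atlas d) (cinv (atlas c) z) &
  cinv (atlas d) (tau z) = cinv (atlas c) z].
Proof.
move=> [x [cx dx] <-]; split; first exact: cimg_cmap.
  by rewrite cmapK.
by rewrite /transition /= cmapK// cmapK.
Qed.

Lemma overlap_near z : O z -> \forall y \near z, O y.
Proof.
move=> [x [cx dx] xz].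
have n1 : \forall y \near z, cimg (atlas c) y.
  by apply: open_nbhs_nbhs; split; [exact: cimg_open|rewrite -xz; exact: cimg_cmap].
have n2 : \forall y \near z, cdom (atlas d) (cinv (atlas c) y).
  have cc : {for z, continuous (cinv (atlas c))} by rewrite -xz; exact: cinv_continuous.
  have nd : nbhs (cinv (atlas c) z) (cdom (atlas d)).
    by apply: open_nbhs_nbhs; split; [exact: cdom_open|rewrite -xz cmapK].
  exact: cc _ nd.
apply: filterS2 n1 n2 => y [x' cx' <-]; rewrite cmapK// => dx'.
by exists x'.
Qed.

Lemma overlap_open : open O.
Proof. by rewrite openE => z /overlap_near. Qed.

Lemma transition_continuous z : O z -> {for z, continuous tau}.
Proof.
move=> [x [cx dx] xz]; rewrite -xz; apply: continuous_comp.
  exact: cinv_continuous.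
by rewrite cmapK//; exact: cmap_continuous.
Qed.

(** The transition map is a holomorphic map of the kind treated above, so a model in the chart [d]
    can be pulled back by it, and [N] transforms by the Jacobian. *)
Lemma Nmx_transition x t chi : cdom (atlas c) x -> cdom (atlas d) x -> times T t ->
  posdef (N d t chi (cmap (atlas d) x)) -> posdef (N c t chi (cmap (atlas c) x)).
Proof.
move=> cx dx Tt pd; set z := cmap (atlas c) x.
have Oz : O z by exists x.
have tz : tau z = cmap (atlas d) x by rewrite /transition /= cmapK.
have dtz : cimg (atlas d) (tau z) by rewrite tz; exact: cimg_cmap.
have [m [mz _]] := @chart_model_at d (tau z) t setT dtz Tt openT I.
pose D : set E := [set q | O q.1 /\ m (tau q.1, q.2)].
have oD : open D.
  rewrite openE => q [Oq mq].
  have n1 : \forall q' \near q, O q'.1.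
    have cf : (fst : E -> Cn R n) @ q --> q.1 by exact: cvg_fst.
    exact: cf _ (overlap_near Oq).
  have n2 : \forall q' \near q, m (tau q'.1, q'.2).
    have cf : (fun q : E => (tau q.1, q.2) : E) @ q --> ((tau q.1, q.2) : E).
      apply: (@cvg_pair _ _ _ (nbhs q) (nbhs (tau q.1)) (nbhs (q.2 : R^o))); last exact: cvg_snd.
      have cf : (fst : E -> Cn R n) @ q --> q.1 by exact: cvg_fst.
      exact: cvg_comp cf (transition_continuous Oq).
    have nm : nbhs ((tau q.1, q.2) : E) (cmW m : set E).
      by apply: open_nbhs_nbhs; split=> //; exact: dset_open.
    exact: cf _ nm.
  exact: (@filterS2 E (nbhs q) (nbhs_filter q) _ _ _ (fun q' => @conj _ _) n1 n2).
have Dz : D (z, t) by [].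
pose W : domain E := @Domain R E D oD (z, t) Dz.
have WO q : W q -> O q.1 by case.
have hol := atlas_holomorphic c d.
pose P k : smf W := mkS (@smoothC_fst R n O W (zcoord k \o tau)
  overlap_open (dset_open W) WO (hol k).1).
have PE q (Wq : W q) k : ev Wq (P k) = zcoord k (tau q.1) by exact: ev_mkS.
have hE q : W q -> hmap P q = (tau q.1, q.2).
  move=> Wq; rewrite /hmap [in RHS](_ : tau q.1 = ((tau q.1).1, (tau q.1).2)); last by case: (tau q.1).
  congr ((_, _), _); apply/rowP => k; rewrite mxE -[P k q]/(ev Wq (P k)) PE//.
have hW q : W q -> m (hmap P q) by move=> Wq; rewrite hE//; case: Wq.
have holP k r : dzbs r (P k) = 0.
  apply: evP => -[y s] Wq; rewrite ev0.
  rewrite -(@dzb_slice _ _ W (P k) y s Wq (zcoord k \o tau)); last by move=> y' Wy'; rewrite PE.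
  by have [_ H] := hol k; exact: H (WO _ Wq).
pose pl := pull hW.
have Wz : W (z, t) := Dz.
have plE q (Wq : W q) (phi : smf m) (F : E -> R) :
    (forall q (mq : m q), ev mq phi = (F q)%:C) -> ev Wq (pl phi) = (F (tau q.1, q.2))%:C.
  by move=> FE; rewrite ev_pull FE hE.
have agr y s : W (y, s) -> times T s ->
    Fu m (tau y, s) = u (cinv (atlas c) y) s /\ Fv m (tau y, s) = v (cinv (atlas c) y) s.
  move=> [Oy my] Ts; have [_ _ e] := overlapP Oy.
  by rewrite -(Fu_agree my Ts) -(Fv_agree my Ts)/= [cinv _ _]e.
pose G' := pulltensor hW (@cmG _ _ _ _ _ _ _ _ m).
have jE k i : ev Wz (jac P k i) = dz i (zcoord k \o tau) z.
  by rewrite /jac -(@dz_slice _ _ W (P k) z t Wz (zcoord k \o tau)).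
have G'E i j : ev Wz (G' i j) = g c z i j.
  rewrite (metric_change g Oz) /G' /pulltensor ev_sum; apply: eq_bigr => p _.
  rewrite ev_sum; apply: eq_bigr => q _.
  by rewrite !evM ev_sconj !jE ev_pull ev_cmG hE//= [X in X * _]mulrC.
have NE : N c t chi z = \matrix_(i, j) ev Wz
    (tensorN (pl (cmf m)) (pl (cmh m)) (pl (cmpsi m)) (pl (sconst chi%:C)) G' i j).
  apply: Nmx_tensorN.
  - move=> y Wy; rewrite (plE _ Wy _ _ (@ev_cmf _ _ _ _ _ _ _ _ m)) /in_chart.
    by have [-> _] := agr _ _ Wy Tt.
  - move=> y Wy; rewrite (plE _ Wy _ _ (@ev_cmh _ _ _ _ _ _ _ _ m)) /in_chart.
    by have [-> ->] := agr _ _ Wy Tt.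
  - rewrite (plE _ Wz _ _ (@ev_cmpsi _ _ _ _ _ _ _ _ m)).
    by have [-> ->] := agr _ _ Wz Tt.
  - by rewrite /pl pull_const ev_sconst.
  - exact: G'E.
have NdE : N d t chi (tau z) = \matrix_(i, j) ev mz
    (tensorN (cmf m) (cmh m) (cmpsi m) (sconst chi%:C) (@cmG _ _ _ _ _ _ _ _ m) i j).
  by apply: Nmx_slice => //; rewrite ev_sconst.
have hzt : hmap P (z, t) = (tau z, t) by rewrite hE.
move=> w w0; rewrite NE (hform_tensorN_pull _ _ _ _ _ hW holP Wz).
have -> : \matrix_(i, j) ev (hW _ Wz) (tensorN (cmf m) (cmh m) (cmpsi m) (sconst chi%:C)
    (@cmG _ _ _ _ _ _ _ _ m) i j) = N d t chi (cmap (atlas d) x).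
  by rewrite -tz NdE; apply/matrixP => i j; rewrite !mxE; exact: ev_point.
(* The Jacobian is injective: a vector that it kills would have length zero for the metric in the
   chart [c], which is the pullback of the metric in [d]. *)
apply: pd; apply: contraNneq w0 => wJ.
have := @metric_posdef _ _ _ g c z (cimg_cmap cx) w; apply: contraPT => w0.
move=> /(_ w0); suff -> : hform (g c z) w w = 0 by rewrite ltxx.
transitivity (hform (\matrix_(i, j) ev Wz (G' i j)) w w).
  by congr (hform _ _ _); apply/matrixP => i j; rewrite mxE G'E.
rewrite (ev_pulltensor hW Wz) wJ /hform big1// => i _; rewrite big1// => j _.
by rewrite [(0 : 'rV_n) _ _]mxE mulr0 mul0r.
Qed.

End Transition.

Definition good x t chi := forall c, cdom (atlas c) x ->
  posdef (N c t chi (cmap (atlas c) x)).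

Lemma goodP c x t chi : cdom (atlas c) x -> times T t ->
  posdef (N c t chi (cmap (atlas c) x)) -> good x t chi.
Proof. by move=> cx Tt pd d dx; apply: (@Nmx_transition d c). Qed.

Lemma times_gt0 t : 0 < t -> (t%:E < T)%E -> times T t.
Proof. by move=> t0 tT; split=> //; exact: ltW. Qed.

Lemma lt_ereal_near t : (t%:E < T)%E -> \forall s \near t, (s%:E < T)%E.
Proof.
case: T => [r| |]//; last first.
  by move=> _; have h1 : \forall s \near t, t - 1 < s by [apply: lt_nbhsr; rewrite gtrBl];
  apply: filterS h1 => s _; rewrite ltry.
rewrite lte_fin => tr; have h1 : \forall s \near t, s < r by exact: lt_nbhsl.
by apply: filterS h1 => s; rewrite lte_fin.
Qed.

Definition window b : set E := [set q | b < q.2 /\ (q.2%:E < T)%E].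

Lemma window_near b t : b < t -> (t%:E < T)%E -> \forall s \near t, b < s /\ (s%:E < T)%E.
Proof.
move=> bt tT; have h1 : \forall s \near t, b < s by exact: lt_nbhsr.
by apply: filterI => //; exact: lt_ereal_near.
Qed.

Lemma window_open b : open (window b).
Proof.
rewrite openE => q [bq qT]; have cs : (snd : E -> R^o) @ q --> q.2 by exact: cvg_snd.
exact: cs _ (window_near bq qT).
Qed.

Lemma cvg_chart c x t : cdom (atlas c) x ->
  (fun p : M * R => (cmap (atlas c) p.1, p.2) : E) @ (filter_prod (nbhs x) (nbhs t))
    --> ((cmap (atlas c) x, t) : E).
Proof.
move=> cx; apply: (@cvg_pair _ _ _ _ (nbhs (cmap (atlas c) x)) (nbhs (t : R^o))); last exact: cvg_snd.
have cf : (fst : M * R -> M) @ (filter_prod (nbhs x) (nbhs t)) --> x by exact: cvg_fst.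
exact: cvg_comp cf (cmap_continuous cx).
Qed.

Lemma hermitian_tensor c (m : chart_model g T u v c) (chi : smf m) : sconj chi = chi ->
  forall i j, sconj (tensorN (cmf m) (cmh m) (cmpsi m) chi (@cmG _ _ _ _ _ _ _ _ m) i j) =
    tensorN (cmf m) (cmh m) (cmpsi m) chi (@cmG _ _ _ _ _ _ _ _ m) j i.
Proof.
move=> cR; apply: sconj_tensorN => //; [exact: cmfR|exact: cmhR|exact: cmpsiR|exact: cmGR].
Qed.

Hypothesis a0 : a != 0.
Hypothesis T0 : (0 < T)%E.
Hypothesis cptM : compact [set: M].

Lemma phi_gt0 t : 0 < t -> 0 < a / (1 - expR (- a * t)).
Proof.
move=> t0; case/orP: (lt_total a0) => aN.
  rewrite ltr_ndivlMr ?mul0r// subr_lt0 -expR0 ltr_expR.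
  by rewrite mulr_gt0// oppr_gt0.
rewrite divr_gt0// subr_gt0 -expR0 ltr_expR.
by rewrite mulNr oppr_lt0 mulr_gt0.
Qed.

Lemma barrier_shift (P x gm y : C) : P != 0 ->
  gm + P^-1 * (x + -1 * gm + y) = P^-1 * (x + (P - 1) * gm + y).
Proof. by move=> P0; field. Qed.

(** Dividing [N] by [phi] removes the pole at [t = 0]: the quotient extends smoothly to [t = 0] with
    value [g], so it is positive nearby, and compactness makes the time uniform. The [- 1] leaves
    room to place the barrier strictly below [phi]. *)
Lemma initial_positive : \forall t \near (0 : R), 0 < t -> (t%:E < T)%E ->
  forall x, good x t (a / (1 - expR (- a * t)) - 1).
Proof.
have cov := (compact_near_coveringP [set: M]).1 cptM.
have := cov R (nbhs (0 : R)) (fun s x => 0 < s -> (s%:E < T)%E ->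
  good x s (a / (1 - expR (- a * s)) - 1)) (nbhs_filter (0 : R)).
move=> H; apply: (filterS _ (H _)) => [s Hs s0 sT x|x _]; first exact: Hs.
have [c cx] := atlas_cover x.
have T00 : times T 0 by split.
have [m [m0 _]] := chart_model_at (cimg_cmap cx) T00 openT I.
have [e [eE _ _ _]] := @exp_time_element R n m (- a).
(* [th] is [1 / phi], smooth across [t = 0] and zero there. *)
pose th : smf m := sconst (a^-1)%:C * (1 - e).
have thE q (mq : m q) : ev mq th = (a^-1 * (1 - expR (- a * q.2)))%:C.
  by rewrite /th evM evB ev1 ev_sconst eE -(rmorph1 (real_complex R)) -rmorphB -rmorphM.
pose X := tensorN (cmf m) (cmh m) (cmpsi m) (sconst (- 1)%:C) (@cmG _ _ _ _ _ _ _ _ m).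
pose B i j := @cmG _ _ _ _ _ _ _ _ m i j + th * X i j.
have BR i j : sconj (B i j) = B j i.
  rewrite [LHS]rmorphD [X in _ + X = _]rmorphM [X in X + _ = _]cmGR.
  rewrite [X in _ + X * _ = _](real_element thE) [X in _ + _ * X = _]hermitian_tensor//.
  by rewrite sconj_const; congr sconst; apply: complex_ext; rewrite /= ?oppr0.
have B0 : posdef (\matrix_(i, j) ev m0 (B i j)).
  have -> : \matrix_(i, j) ev m0 (B i j) = g c (cmap (atlas c) x).
    apply/matrixP => i j; rewrite mxE /B evD evM thE ev_cmG/= mulr0 expR0 subrr mulr0.
    by rewrite mul0r addr0.
  exact: metric_posdef (cimg_cmap cx).
have nB := cvg_chart (t := 0) cx (posdef_near BR B0).
have nm : nbhs ((cmap (atlas c) x, 0) : E) (cmW m : set E).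
  by apply: open_nbhs_nbhs; split=> //; exact: dset_open.
have nW := cvg_chart (t := 0) cx nm.
have nd : \forall p \near filter_prod (nbhs x) (nbhs (0 : R)), cdom (atlas c) p.1.
  have cf : (fst : M * R -> M) @ (filter_prod (nbhs x) (nbhs (0 : R))) --> x by exact: cvg_fst.
  by apply: cf; apply: open_nbhs_nbhs; split=> //; exact: cdom_open.
have {}nB : \forall p \near filter_prod (nbhs x) (nbhs (0 : R)),
  forall Wq : m (cmap (atlas c) p.1, p.2), posdef (\matrix_(i, j) ev Wq (B i j)) := nB.
have {}nW : \forall p \near filter_prod (nbhs x) (nbhs (0 : R)),
  m (cmap (atlas c) p.1, p.2) := nW.
apply: filterS3 nB nW nd => -[y s] /= pB my cy s0 sT.
have Ts := times_gt0 s0 sT.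
apply: (goodP cy Ts) => w w0.
have := pB my w w0.
set phi := a / (1 - expR (- a * s)).
have p0 : 0 < phi by exact: phi_gt0.
have -> : \matrix_(i, j) ev my (B i j) = (phi^-1)%:C *: N c s (phi - 1) (cmap (atlas c) y).
  rewrite (@Nmx_slice _ _ _ _ _ _ _ _ m _ _ my (sconst (phi - 1)%:C))//; last by rewrite ev_sconst.
  apply/matrixP => i j; rewrite !mxE /B evD evM thE /X /tensorN !(evD, evB, evM) !ev_sconst/=.
  rewrite -/(phi) (_ : a^-1 * (1 - expR (- a * s)) = phi^-1); last by rewrite /phi invf_div mulrC.
  rewrite fmorphV rmorphB rmorph1 rmorphN1.
  have pC : phi%:C != 0 :> C by rewrite fmorph_eq0 gt_eqF.
  exact: barrier_shift.
by rewrite hform_scale pmulr_rgt0// ltcR invr_gt0.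
Qed.

Variables (kappa eps : R).
Hypothesis kappa0 : 0 <= kappa.
Hypothesis curvature : bisectional_ge g kappa.
Hypothesis reaction : forall x t, times T t ->
  0 <= kappa + a * (- 1 - 2 * ((1 - (v x t / u x t) ^+ 2)^-1 * ln (v x t / u x t))).
Hypothesis eps0 : 0 < eps.
Local Notation chi := (barrier a eps).

Lemma good_near x t : 0 < t -> (t%:E < T)%E -> good x t (chi t) ->
  \forall y \near x & s \near t, good y s (chi s).
Proof.
move=> t0 tT gx; have [c cx] := atlas_cover x.
have [m [m0 mw]] := chart_model_at (cimg_cmap cx) (times_gt0 t0 tT) (@window_open 0) (conj t0 tT).
have [ch [chE _ _ _]] := @barrier_element R n a eps a0 m (fun q mq => (mw q mq).1).
pose X := tensorN (cmf m) (cmh m) (cmpsi m) ch (@cmG _ _ _ _ _ _ _ _ m).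
have XR := hermitian_tensor (real_element chE).
have X0 : posdef (\matrix_(i, j) ev m0 (X i j)).
  by rewrite -(Nmx_slice (times_gt0 t0 tT) (chE _ m0)); exact: gx.
have nm : nbhs ((cmap (atlas c) x, t) : E) (cmW m : set E).
  by apply: open_nbhs_nbhs; split=> //; exact: dset_open.
have nd : \forall p \near filter_prod (nbhs x) (nbhs t), cdom (atlas c) p.1.
  have cf : (fst : M * R -> M) @ (filter_prod (nbhs x) (nbhs t)) --> x by exact: cvg_fst.
  by apply: cf; apply: open_nbhs_nbhs; split=> //; exact: cdom_open.
have nB : \forall p \near filter_prod (nbhs x) (nbhs t),
  forall Wq : m (cmap (atlas c) p.1, p.2), posdef (\matrix_(i, j) ev Wq (X i j))
  := cvg_chart (t := t) cx (posdef_near XR X0).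
have nW : \forall p \near filter_prod (nbhs x) (nbhs t),
  m (cmap (atlas c) p.1, p.2) := cvg_chart (t := t) cx nm.
apply: filterS3 nB nW nd => -[y s] /= pB my cy.
have [s0 sT] := mw _ my.
apply: (goodP cy (times_gt0 s0 sT)).
by rewrite (Nmx_slice (times_gt0 s0 sT) (chE _ my)).
Qed.

(** Tube lemma: positivity is open in space-time and [M] is compact. *)
Lemma good_tube t : 0 < t -> (t%:E < T)%E -> (forall x, good x t (chi t)) ->
  \forall s \near t, forall x, good x s (chi s).
Proof.
move=> t0 tT gt; have cov := (compact_near_coveringP [set: M]).1 cptM.
have H := cov R (nbhs t) (fun s x => good x s (chi s)) (nbhs_filter t)
  (fun x _ => good_near t0 tT (gt x)).
by apply: (filterS _ H) => s Hs x; exact: Hs.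
Qed.

Lemma psd_null_vector (S : 'M[C]_n) : psd S -> ~ posdef S ->
  exists2 V : 'rV_n, V != 0 & hform S V V = 0.
Proof.
move=> pS /existsNP[V /not_implyP[V0 /negP VS]]; exists V => //.
by apply/eqP; apply: contraNT VS => h0; rewrite lt_def h0 pS.
Qed.

(** If the form were negative at time [ts], it would be negative at the same space point slightly
    earlier, where positivity is known. The window [t0 < q.2] keeps those earlier points inside the
    interval covered by the hypothesis. *)
Lemma psd_limit c (m : chart_model g T u v c) (ch : smf m) t0 ts :
  (forall q (mq : m q), ev mq ch = (chi q.2)%:C) ->
  (forall q, m q -> t0 < q.2 /\ (q.2%:E < T)%E) -> 0 < t0 ->
  (forall t, t0 <= t -> t < ts -> forall x, good x t (chi t)) ->
  forall (y : E) (my : m y), y.2 <= ts -> psd (\matrix_(i, j) ev my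
    (tensorN (cmf m) (cmh m) (cmpsi m) ch (@cmG _ _ _ _ _ _ _ _ m) i j)).
Proof.
move=> chE mw t00 gts.
pose X := tensorN (cmf m) (cmh m) (cmpsi m) ch (@cmG _ _ _ _ _ _ _ _ m).
have mT q (mq : m q) : times T q.2.
  by have [h1 h2] := mw _ mq; apply: times_gt0 => //; exact: lt_trans t00 h1.
have early (y : E) (my : m y) : y.2 < ts -> psd (\matrix_(i, j) ev my (X i j)).
  case: y my => z s my /= st; have [sl _] := mw _ my.
  have [x cx xz] := cm_cimg my.
  have := gts s (ltW sl) st x c cx; rewrite [cmap _ _]xz.
  by rewrite (Nmx_slice (mT _ my) (chE _ my)) => /posdef_psd.
move=> y my; rewrite le_eqVlt => /orP[/eqP yt|]; last exact: early.
move=> V; pose q := hcontract V X.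
have qR : sconj q = q.
  by apply: sconj_hcontract; apply: hermitian_tensor; exact: (real_element chE).
rewrite -(ev_contract V my).
have im0 : complex.Im (ev my q) = 0.
  have := congr1 (fun p => complex.Im (ev my p)) qR; rewrite /= ev_sconj.
  case: (ev my q) => p r /= /eqP.
  by rewrite eq_sym -subr_eq0 opprK -mulr2n mulrn_eq0/= => /eqP.
suff re0 : 0 <= complex.Re (ev my q) by rewrite lecE/= im0 eqxx.
rewrite leNgt; apply/negP => re0.
have [cr _] := smf_continuous q my.
have n1 : \forall p \near y, complex.Re (q p) < 0 by exact: (cvgr_lt (complex.Re (q y)) cr).
have n2 : \forall p \near y, m p by apply: open_nbhs_nbhs; split=> //; exact: dset_open.
have cs : (fun s : R => (y.1, s) : E) @ ts --> (y : E).
  rewrite [X in _ --> X](_ : y = (y.1, ts)); last by rewrite -yt; case: (y).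
  by apply: (@cvg_pair _ _ _ (nbhs ts) (nbhs y.1) (nbhs (ts : R^o))); [exact: cvg_cst|exact: cvg_id].
have m1 : \forall s \near ts, complex.Re (q (y.1, s)) < 0 := cs _ n1.
have m2 : \forall s \near ts, m (y.1, s) := cs _ n2.
have m3 : \forall s \near ts^'-, s < ts by exact: nbhs_left_lt.
have H : \forall s \near ts^'-, [/\ complex.Re (q (y.1, s)) < 0, m (y.1, s) & s < ts].
  by near=> s; split; near: s; [exact: cvg_within m1|exact: cvg_within m2|exact: m3].
have [s [s1 s2 s3]] := filter_ex H.
have := early _ s2 s3 V; rewrite -(ev_contract V s2) lecE => /andP[_].
by rewrite leNgt s1.
Unshelve. all: by end_near. Qed.

(** If positivity failed at [ts], the form, nonnegative by [psd_limit], would have a null vector,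
    which [null_vector_chart] excludes. *)
Lemma good_at_limit t0 ts : 0 < t0 -> t0 < ts -> (ts%:E < T)%E ->
  (forall t, t0 <= t -> t < ts -> forall x, good x t (chi t)) ->
  forall x, good x ts (chi ts).
Proof.
move=> t00 tts tsT gts x c cx.
have ts0 : 0 < ts by exact: lt_trans tts.
have Tts := times_gt0 ts0 tsT.
have [m [m0 mw]] := chart_model_at (cimg_cmap cx) Tts (@window_open t0) (conj tts tsT).
have mw0 q : m q -> 0 < q.2 /\ (q.2%:E < T)%E.
  by move=> /mw[h1 h2]; split=> //; exact: lt_trans t00 h1.
have [ch [chE tchE zch zbch]] := @barrier_element R n a eps a0 m (fun q mq => (mw0 q mq).1).
have ps := psd_limit chE mw t00 gts.
rewrite (Nmx_slice Tts (chE _ m0)); apply: contrapT => npd.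
have [V V0 Vn] := psd_null_vector (ps _ m0 (lexx _)) npd.
have [zl zbl _] := sder_log_ops (sder_cml m).
apply: (@null_vector_chart R n m _ m0 (cmf m) (cmh m) (cml m) (cmpsi m) ch
  (@cmG _ _ _ _ _ _ _ _ m) (@cmY _ _ _ _ _ _ _ _ m) a (cmfR m) (cmhR m) (cmpsiR m)
  (real_element chE) (@cmGR _ _ _ _ _ _ _ _ m) (@cmYG _ _ _ _ _ _ _ _ m) _
  (@cm_kahler _ _ _ _ _ _ _ _ m) (@cm_static _ _ _ _ _ _ _ _ m) (cmpsiE m) zl zbl zch zbch
  (cm_heat_f heat_u mw0) (cm_heat_h heat_u heat_v mw0) V V0 ps Vn kappa (chi ts)
  (dbarrier a eps ts) (1 - (Fv m (cmap (atlas c) x, ts) / Fu m (cmap (atlas c) x, ts)) ^+ 2)^-1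
  (ln (Fv m (cmap (atlas c) x, ts) / Fu m (cmap (atlas c) x, ts))) kappa0).
- by rewrite matrix_cmG; exact: metric_posdef (cimg_cmap cx).
- move=> w1 w2; rewrite -bisect_slice -bisect_model_slice.
  exact: curvature (cimg_cmap cx) w1 w2.
- exact: chE.
- exact: tchE.
- exact: ev_cmpsi.
- exact: ev_cml.
- rewrite invr_gt0 subr_gt0 expr_lt1//; have /andP[r0 r1] := ratio_bounds m0; first exact: r1.
  exact: ltW.
- exact: barrier_supersolution.
- rewrite -(Fu_agree m0)// -(Fv_agree m0)//=; exact: reaction.
Qed.

Lemma good_forward t0 t1 : 0 < t0 -> t0 <= t1 -> (t1%:E < T)%E ->
  (forall x, good x t0 (chi t0)) -> forall x, good x t1 (chi t1).
Proof.
move=> t00 t01 t1T g0 x1; apply: contrapT => bad1.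
(* The infimum of the bad times is itself good, by [good_at_limit] or, at [t0], by assumption;
   [good_tube] then keeps bad times away from it, a contradiction. *)
pose S : set R := [set t | [/\ t0 <= t, t <= t1 & ~ forall x, good x t (chi t)]].
have S1 : S t1 by split=> // gt; exact: bad1 (gt x1).
have lbS : lbound S t0 by move=> t [].
have infS : has_inf S by split; [exists t1|exists t0].
set ts := inf S.
have t0s : t0 <= ts by apply: lb_le_inf => //; exists t1.
have ts1 : ts <= t1 by apply: ge_inf => //; exists t0.
have tsT : (ts%:E < T)%E by apply: le_lt_trans t1T; rewrite lee_fin.
have ts0 : 0 < ts by exact: lt_le_trans t0s.
have gts t : t0 <= t -> t < ts -> forall x, good x t (chi t).
  move=> tt0 tts; apply: contrapT => bt; have : ts <= t.
    by apply: ge_inf; [exists t0|split=> //; exact: le_trans (ltW tts) ts1].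
  by rewrite leNgt tts.
have gs : forall x, good x ts (chi ts).
  move: t0s; rewrite le_eqVlt => /orP[/eqP <-//|t0s].
  exact: (good_at_limit t00 t0s tsT gts).
have /nbhs_ballP[d /= d0 dP] := good_tube ts0 tsT gs.
have [s [ts0' ts1' bs] ss] := inf_adherent d0 infS.
have ls : ts <= s by apply: ge_inf; [exists t0|split].
by apply: bs; apply: dP; rewrite /ball/= distrC ger0_norm ?subr_ge0// ltrBlDl.
Qed.

End Global.

(** * The differential Harnack inequality *)

Section LogInequalities.
Context {R : realType}.
Implicit Types x y : R.

Lemma ln_le_sub1 x : 0 < x -> ln x <= x - 1.
Proof.
move=> x0; have h : -1 < x - 1 by rewrite -subr_gt0 opprK subrK.
by have := le_ln1Dx h; rewrite addrC subrK.
Qed.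

(** The tangent bound of [ln] at [x ^+ 2]. It settles the reaction term for [a > 0], and for [a < 0]
    it shows [K >= 0]. *)
Lemma log_ratio_ge1 x : 0 < x < 1 -> 1 <= - (2 * ln x / (1 - x ^+ 2)).
Proof.
move=> /andP[x0 x1]; have d0 : 0 < 1 - x ^+ 2 by rewrite subr_gt0 expr_lt1// ltW.
have := ln_le_sub1 (exprn_gt0 2 x0); rewrite lnXn// -mulr_natl => h.
rewrite -mulNr ler_pdivlMr// mul1r; lra.
Qed.

(* Concavity of [ln]: with [Y = lam X + (1 - lam)], add the bounds of
   [ln (X / Y)] and [ln (1 / Y)] by [ln r <= r - 1]. *)
Lemma log_ratio_mono x y : 0 < x -> x < y -> y < 1 ->
  - (2 * ln y / (1 - y ^+ 2)) <= - (2 * ln x / (1 - x ^+ 2)).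
Proof.
move=> x0 xy y1; have y0 : 0 < y by exact: lt_trans xy.
have X0 : 0 < x ^+ 2 by rewrite exprn_gt0.
have Y0 : 0 < y ^+ 2 by rewrite exprn_gt0.
have XY : x ^+ 2 < y ^+ 2 by rewrite ltrXn2r// ?nnegrE ltW.
have Y1 : y ^+ 2 < 1 by rewrite expr_lt1// ltW.
have h1 := ln_le_sub1 (divr_gt0 X0 Y0).
have h2 : ln ((y ^+ 2)^-1) <= (y ^+ 2)^-1 - 1 by apply: ln_le_sub1; rewrite invr_gt0.
rewrite ln_div ?posrE// in h1; rewrite lnV ?posrE// in h2.
have lnE z : 0 < z -> 2 * ln z = ln (z ^+ 2) by move=> z0; rewrite lnXn// mulr_natl.
rewrite !lnE//.
move: h1 h2 X0 Y0 XY Y1; move: (x ^+ 2) (y ^+ 2) => X Y h1 h2 X0 Y0 XY Y1.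
move: h1 h2; move: (ln X) (ln Y) => A B h1 h2.
have dY : 0 < 1 - Y by rewrite subr_gt0.
have dX : 0 < 1 - X by rewrite subr_gt0 (lt_trans XY).
rewrite lerN2 ler_pdivrMr// mulrAC ler_pdivlMr//.
have k1 : (1 - Y) * (A - B) <= (1 - Y) * (X / Y - 1) by rewrite ler_pM2l.
have k2 : (Y - X) * - B <= (Y - X) * (Y^-1 - 1) by apply: ler_wpM2l => //; rewrite subr_ge0 ltW.
have k3 : (1 - Y) * (X / Y - 1) + (Y - X) * (Y^-1 - 1) = 0.
  by field; rewrite gt_eqF.
have := lerD k1 k2; rewrite k3; lra.
Qed.

End LogInequalities.

Lemma shift_coefficient (S : comNzRingType) (x y gm P C : S) :
  x + P * gm - y = x + C * gm - y + (P - C) * gm.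
Proof. by ring. Qed.

(** * Propagation from an early time to all times *)

Section Positivity.
Context {R : realType} {n : nat} {M : complexManifold R n} (g : kahlerMetric M)
  (a : R) (T : \bar R) (u v : M -> R -> R).
Hypothesis u_gt0 : forall x t, times T t -> 0 < u x t.
Hypothesis v_gt0 : forall x t, times T t -> 0 < v x t.
Hypothesis v_lt : forall x t, times T t -> v x t < u x t.
Hypothesis heat_u : heat_solution g a T u.
Hypothesis heat_v : heat_solution g a T v.
Hypothesis a0 : a != 0.
Hypothesis T0 : (0 < T)%E.
Hypothesis cptM : compact [set: M].
Variable kappa : R.
Hypothesis kappa0 : 0 <= kappa.
Hypothesis curvature : bisectional_ge g kappa.
Hypothesis reaction : forall x t, times T t ->
  0 <= kappa + a * (- 1 - 2 * ((1 - (v x t / u x t) ^+ 2)^-1 * ln (v x t / u x t))).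

Lemma harnack_positive t : 0 < t -> (t%:E < T)%E -> forall x,
  good g u v x t (a / (1 - expR (- a * t))).
Proof.
move=> t0 tT x.
have init := initial_positive u_gt0 v_gt0 v_lt heat_u heat_v a0 T0 cptM.
have n1 : \forall s \near 0^'+, 0 < s -> (s%:E < T)%E ->
    forall x, good g u v x s (a / (1 - expR (- a * s)) - 1).
  by exact: cvg_within init.
have n2 : \forall s \near 0^'+, 0 < s :> R by exact: nbhs_right_gt.
have n3 : \forall s \near 0^'+, s < t by exact: nbhs_right_lt.
have [s [s0 st gs]] : exists s, [/\ 0 < s, s < t & forall x,
    good g u v x s (a / (1 - expR (- a * s)) - 1)].
  have : \forall s \near 0^'+, [/\ 0 < s, s < t & forall x,
      good g u v x s (a / (1 - expR (- a * s)) - 1)].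
    near=> s; have s0 : 0 < s by near: s; exact: n2.
    have st : s < t by near: s; exact: n3.
    split=> //; have h : 0 < s -> (s%:E < T)%E ->
        forall x, good g u v x s (a / (1 - expR (- a * s)) - 1) by near: s; exact: n1.
    by apply: h => //; apply: lt_trans tT; rewrite lte_fin.
  by move=> H; have [s Hs] := filter_ex H; exists s.
pose D := a ^+ 2 * (barrier_p a s - barrier_p a s ^+ 2).
have D0 : D < 0 by rewrite /D pmulr_rlt0 ?barrier_p_lt// exprn_even_gt0.
(* [D] is [phi'(s) < 0], so this choice gives [chi(s) = phi(s) + eps phi'(s) = phi(s) - 1], for
   which positivity at time [s] is known. *)
pose eps := - D^-1.
have e0 : 0 < eps by rewrite /eps oppr_gt0 invr_lt0.
have sE : barrier a eps s = a / (1 - expR (- a * s)) - 1.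
  by rewrite /barrier -/D /eps mulNr mulVf ?lt_eqF.
have gs' y : good g u v y s (barrier a eps s) by rewrite sE.
have gt : good g u v x t (barrier a eps t).
  exact: (good_forward u_gt0 v_gt0 v_lt heat_u heat_v a0 cptM kappa0 curvature reaction e0 s0 (ltW st) tT gs').
move=> c cx w w0; have := gt c cx w w0.
set chi := barrier a eps t; set phi := a / _.
(* The difference of the two matrices is [(phi - chi) g], positive definite, so positivity with
   [chi] passes to [phi]. *)
have lt : chi < phi by exact: barrier_lt.
set z := cmap (atlas c) x.
have -> : Nmx g u v c t phi z = Nmx g u v c t chi z + (phi - chi)%:C *: g c z.
  by apply/matrixP => i j; rewrite !mxE [(phi - chi)%:C]rmorphB; exact: shift_coefficient.
rewrite hform_add hform_scale => N0; rewrite addr_gt0// mulr_gt0//.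
  by rewrite ltcR subr_gt0.
by apply: metric_posdef; [exists x|].
Unshelve. all: by end_near. Qed.

End Positivity.

Local Open Scope complex_scope.

Theorem theorem1p3 (R : realType) (n : nat) (M : complexManifold R n)
  (g : kahlerMetric M) (a : R) (T : \bar R) (u v : M -> R -> R) :
  let h : M -> R -> R := fun x t => v x t / u x t in
  compact [set: M] ->
  a != 0 ->
  (0 < T)%E ->
  (forall x t, times T t -> 0 < u x t) ->
  (forall x t, times T t -> 0 < v x t) ->
  heat_solution g a T u ->
  heat_solution g a T v ->
  [/\ 0 < a,
      forall x t, times T t -> 0 < h x t < 1
    & nonneg_bisectional g]
  \/ (exists c K : R,
      [/\ a < 0,
          0 < c,
          forall x t, times T t -> c < h x t < 1,
          - 1 - 2 * ln c / (1 - c ^+ 2) <= K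
        & bisectional_ge g (- a * K)]) ->
  forall t : R, 0 < t -> (t%:E < T)%E ->
  forall (c : chart_index M) (x : M), cdom (atlas c) x ->
  let z := cmap (atlas c) x in
  posdef (\matrix_(i, j)
    (hess c (fun y => ln (u y t)) i j z
     + (a / (1 - expR (- a * t)))%:C * g c z i j
     - dz i (in_chart c (h ^~ t)) z * dzb j (in_chart c (h ^~ t)) z
       / (1 - h x t ^+ 2)%:C)).
Proof.
move=> h cptM a0 T0 u_gt0 v_gt0 heat_u heat_v cases t t0 tT c x cx z.
have T00 : times T 0 by split.
(* Both cases are instances of one statement with a curvature constant [kappa]: 0 when [a > 0], and
   [- a * K] when [a < 0]. *)
have [hlt [kappa [kappa0 curvature reaction]]] :
  (forall x t, times T t -> h x t < 1) /\ exists kappa : R, [/\ 0 <= kappa,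
    bisectional_ge g kappa & forall x t, times T t ->
      0 <= kappa + a * (- 1 - 2 * ((1 - h x t ^+ 2)^-1 * ln (h x t)))].
  have shape (y : R) : 2 * ((1 - y ^+ 2)^-1 * ln y) = 2 * ln y / (1 - y ^+ 2).
    by rewrite mulrA mulrAC.
  case: cases => [[ap h01 nn]|[d [K [an d0 hd Kd curv]]]].
    split=> [y s ys|]; first by have /andP[] := h01 y s ys.
    exists 0; split=> // [e w ew V W|y s ys]; first by rewrite mul0r; exact: nn.
    rewrite add0r shape; apply: mulr_ge0; first exact: ltW.
    by have := log_ratio_ge1 (h01 y s ys); lra.
  split=> [y s ys|]; first by have /andP[] := hd y s ys.
  (* The bounds on [h] at the given point and at time 0 force the lower constant below 1. *)
  have d1 : d < 1 by have /andP[] := hd x 0 T00; exact: lt_trans.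
  have dd : 0 < d < 1 by rewrite d0.
  exists (- a * K); split=> // [|y s ys].
    have K0 : 0 <= K.
      by move: Kd (log_ratio_ge1 dd); move: (2 * ln d / _) => X; lra.
    by apply: mulr_ge0 => //; rewrite oppr_ge0 ltW.
  rewrite shape; have /andP[dh h1] := hd y s ys.
  (* As [h] exceeds the constant [d], the quantity [- 2 ln h / (1 - h^2)] is at most its value at
     [d], hence at most [K + 1]; the factor [- a > 0] preserves the sign. *)
  have := log_ratio_mono d0 dh h1.
  move: Kd; move: (2 * ln d / _) (2 * ln (h y s) / _) => X Y Kd XY.
  have -> : - a * K + a * (- 1 - Y) = - a * (K + 1 + Y) by ring.
  by apply: mulr_ge0; [rewrite oppr_ge0 ltW|lra].
have v_lt y s : times T s -> v y s < u y s.
  by move=> ys; have := hlt y s ys; rewrite /h ltr_pdivrMr ?mul1r// u_gt0.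
have := harnack_positive u_gt0 v_gt0 v_lt heat_u heat_v a0 T0 cptM kappa0 curvature reaction t0 tT cx.
congr (posdef _); apply/matrixP => i j; rewrite !mxE /h cmapK//.
Qed.
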